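(* Let $d\ge 1$ be an integer, $\eta>0$, and let $R$ be a positive random variable bounded above by a constant $\bar r>0$. Let $\mathcal P(\lambda)$ be the probability that no two spheres overlap when the centers form a homogeneous Poisson point process of intensity $\lambda$ on $[0,1]^d$ and the radii are i.i.d. copies of $R/\lambda^{\eta}$, independent of the centers (in either the torus or the Euclidean model). Let $\gamma=\pi^{d/2}/\Gamma(d/2+1)$, $m_1=\mathbb E[(R+\widehat R)^d]$ with $\widehat R$ an independent copy of $R$, and $\gamma'=\gamma$ in the torus model, $\gamma'=\gamma/2^d$ in the Euclidean model. Then $$\lim_{\lambda\to\infty}\mathcal P(\lambda)=1\ \text{ if }\eta d>2,\qquad \lim_{\lambda\to\infty}\mathcal P(\lambda)=\exp\left(-\frac{\gamma m_1}{2}\right)\ \text{ if }\eta d=2,$$ $$\lim_{\lambda\to\infty}\frac{1}{\lambda^{2-\eta d}}\log\mathcal P(\lambda)=-\frac{\gamma m_1}{2}\ \text{ if }1<\eta d<2,\qquad \lim_{\lambda\to\infty}\frac1\lambda\log\mathcal P(\lambda)=-1\ \text{ if }0<\eta d<1.$$ When $\eta d=1$, the limit $\delta:=\lim_{\lambda\to\infty}\frac1\lambda\log\mathcal P(\lambda)$ exists and $-1\le\delta<0$. Furthermore, (still for $\eta d=1$) $\delta\nearrow 0$ as $\gamma m_1\searrow 0$, and $\delta\le-\frac12\left(1-\frac{1}{\gamma'\bar r^d}\right)^2$ if $R\equiv\bar r$ and $\gamma'\bar r^d>1$. In addition, for the torus model, $$\lim_{\lambda\to\infty}\left[\mathcal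 P(\lambda)\exp\left(\frac{\gamma m_1}{2}\lambda^{2-\eta d}\right)\right]=1\quad\text{ if }\ 5/3<\eta d<2.$$
   Context: Torus model: $[0,1]^d$ has periodic boundary, and the sphere $S(x,r)$ centered at $x\in[0,1]^d$ with radius $r$ is the set of points $(y_1 \bmod 1,\dots,y_d \bmod 1)$ with $y\in\mathbb R^d$, $\|x-y\|<r$. Euclidean model: no periodicity, $S(x,r)$ is the ordinary open ball of radius $r$ centered at $x$ in $\mathbb R^d$. Two spheres overlap if they intersect. The statements hold for each of the two models unless one is specified. It is assumed throughout that $2\bar r/\lambda^\eta<1$ (automatic for large $\lambda$). The constant $\gamma$ is the volume of the unit ball in $\mathbb R^d$. The statement ''$\delta\nearrow0$ as $\gamma m_1\searrow0$'' refers to $\delta$ as a function of the law of $R$ (it tends to $0$ as $\gamma m_1$ tends to $0$). *)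

(* Defs.v *)
From HB Require Import structures.
From mathcomp Require Import all_boot all_order all_algebra finmap.
From mathcomp Require Import all_classical all_reals all_analysis.
Set Implicit Arguments.
Unset Strict Implicit.
Unset Printing Implicit Defensive.
Import Order.TTheory GRing.Theory Num.Theory.
Import numFieldNormedType.Exports.
Local Open Scope classical_set_scope.
Local Open Scope ring_scope.

Inductive model := Torus | Euclidean.

Section geometry.
Context {K : realType}.

Definition Gamma (s : K) : K :=
  \int[lebesgue_measure]_(t in `]0, +oo[) (t `^ (s - 1) * expR (- t)).

Definition unit_ball_volume (d : nat) : K :=
  pi `^ (d%:R / 2) / Gamma (d%:R / 2 + 1).

(* The constant gamma' of the packing bound. *)
Definition packing_volume (m : model) (d : nat) : K :=
  match m with
  | Torus => unit_ball_volume d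
  | Euclidean => unit_ball_volume d / 2 ^+ d
  end.

Definition unit_cube (d : nat) : set (d.-tuple K) :=
  [set x | forall i, 0 <= tnth x i <= 1].

(* d-dimensional Lebesgue measure, by Cavalieri slicing along the first
   coordinate; [0.-tuple K] has one point, of mass 1. *)
Fixpoint volume (d : nat) : set (d.-tuple K) -> \bar K :=
  match d with
  | 0 => fun A => \d_[tuple] A
  | d'.+1 => fun A =>
      (\int[lebesgue_measure]_x volume [set t : d'.-tuple K | A (cons_tuple x t)])%E
  end.

Definition euclidean_distance d (x y : d.-tuple K) : K :=
  Num.sqrt (\sum_(i < d) (tnth x i - tnth y i) ^+ 2).

Definition mod1 d (y : d.-tuple K) : d.-tuple K :=
  map_tuple (fun t => t - (Num.floor t)%:~R) y.

Definition sphere (m : model) d (x : d.-tuple K) (r : K) : set (d.-tuple K) :=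
  let ball := [set y | euclidean_distance x y < r] in
  match m with
  | Torus => [set mod1 y | y in ball]
  | Euclidean => ball
  end.

Definition overlap (m : model) d (x : d.-tuple K) (r : K)
    (y : d.-tuple K) (s : K) : Prop :=
  sphere m x r `&` sphere m y s !=set0.

End geometry.
Arguments unit_cube {K} d _.

Section independence.
Context {K : realType} {dT : measure_display} {T : measurableType dT}.
Variable P : probability T K.

(* The events [f @^-1` A] with [A] measurable: the sigma-algebra of [f]. *)
Definition events_of {dU} {U : measurableType dU} (f : T -> U) : set (set T) :=
  preimage_set_system setT f measurable.

Definition mutually_independent (I : choiceType) {dU} {U : measurableType dU}
    (f : I -> T -> U) : Prop :=
  forall (J : {fset I}) (A : I -> set T),
    (forall j, j \in J -> events_of (f j) (A j)) ->
    P (\bigcap_(j in [set` J]) A j) = (\prod_(j <- J) P (A j))%E.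

Definition independent_sigma_algebras (F G : set (set T)) : Prop :=
  forall A B, F A -> G B -> P (A `&` B) = (P A * P B)%E.

End independence.

Section poisson_process.
Context {K : realType} {dT : measure_display} {T : measurableType dT}.
Variables (P : probability T K) (d : nat).

(* A finite random configuration of points is given by its number [N] of points
   and by [X 0, ..., X (N - 1)] (in any measurable order, with multiplicities);
   the values of [X i] for [i >= N] are irrelevant. *)
Implicit Types (N : {RV P >-> nat}) (X : nat -> {RV P >-> d.-tuple K}).

Definition point_count N X (B : set (d.-tuple K)) (w : T) : nat :=
  (\sum_(i < N w) (X i w \in B))%N.

(* [poisson_prob r k] does not depend on [k]; it is the Dirac mass at 0 when
   [r = 0]. *)
Definition homogeneous_poisson_on_cube (lambda : K) N X : Prop :=
  [/\ forall w i, (i < N w)%N -> unit_cube d (X i w),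
      forall B : set (d.-tuple K), measurable B -> B `<=` unit_cube d ->
        forall U, P (point_count N X B @^-1` U) =
          poisson_prob (lambda * fine (volume B)) 0%N U
    & forall n (B : 'I_n -> set (d.-tuple K)),
        (forall i, measurable (B i)) -> (forall i, B i `<=` unit_cube d) ->
        trivIset setT B ->
        mutually_independent P (fun i => point_count N X (B i))].

Definition sigma_of_centers N X : set (set T) :=
  <<s events_of N `|` \bigcup_i events_of (X i) >>.

Definition sigma_of_radii (rho : nat -> {RV P >-> K}) : set (set T) :=
  <<s \bigcup_i events_of (rho i) >>.

Definition no_overlap_event (m : model) N X (rho : nat -> {RV P >-> K}) : set T :=
  [set w | forall i j, (i < j < N w)%N ->
     ~ overlap m (X i w) (rho i w) (X j w) (rho j w)].

End poisson_process.

Section hard_spheres.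
Context {K : realType} {dO : measure_display} {O : measurableType dO}.
Variables (Q : probability O K) (R : {RV Q >-> K}).

(* [p] is the probability that no two spheres overlap when the centers are
   Poisson with intensity [lambda] and the radii are i.i.d. copies of
   [R / lambda `^ eta] independent of the centers. *)
Definition no_overlap_probability (m : model) (d : nat) (eta lambda p : K) :
    Prop :=
  exists (dT : measure_display) (T : measurableType dT) (P : probability T K)
         (N : {RV P >-> nat}) (X : nat -> {RV P >-> d.-tuple K})
         (rho : nat -> {RV P >-> K}),
    [/\ homogeneous_poisson_on_cube lambda N X,
        mutually_independent P rho,
        forall i B, measurable B ->
          P (rho i @^-1` B) = Q [set w | B (R w / lambda `^ eta)],
        independent_sigma_algebras P (sigma_of_centers N X) (sigma_of_radii rho)
      & P (no_overlap_event m N X rho) = p%:E].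

(* E[(R + R')^d], the independent copy R' of R being realized on the second
   factor of the product space. *)
Definition mixed_moment (d : nat) : K :=
  fine (\int[(Q \x Q)%E]_w ((R w.1 + R w.2) ^+ d)%:E)%E.

(* [Pr] is unconstrained at the intensities [lambda] with
   [2 rbar / lambda^eta >= 1]. *)
Definition hard_sphere_setting (m : model) (d : nat) (eta rbar : K)
    (Pr : K -> K) : Prop :=
  [/\ 0 < rbar,
      {ae Q, forall w, 0 < R w <= rbar}
    & forall lambda, 0 < lambda -> 2 * rbar / lambda `^ eta < 1 ->
        no_overlap_probability m d eta lambda (Pr lambda)].

End hard_spheres.

(* Main.v *)
(* Conditioning on the number of points, P(lambda) = e^(-lambda) Z f, where
   f = lambda on the cube and Z f = sum_n Z_n f / n! is the partition function of
   the hard-sphere gas: Z_0 f = 1 and Z_(n+1) f = int f(z) Z_n (f c(z, .)) dz, with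
   c(z, y) = 1 if the marked points z and y do not overlap and 0 otherwise.

   Put I = int f, v(z) = int f(y) (1 - c(z, y)) dy, q = int f v and q2 = int f v^2.
   Comparing the derivative of t |-> ln Z(t f) with I - t q from below and with
   I - t q + 2 t^2 q2 from above gives I - q/2 <= ln Z f <= I - q/2 + 2 q2/3.
   Here I = lambda, q ~ gamma m_1 lambda^(2 - eta d), exactly so on the torus, and
   q2 = O(lambda^(3 - 2 eta d)), which is negligible as soon as eta d > 1; the sharp
   torus asymptotics only need eta d > 3/2. For eta d = 1 the lower estimate gives
   delta >= - gamma m_1 / 2, while the upper one, applied to t f with t small, gives
   delta < 0 because Z f <= Z(t f) e^((1 - t) I).

   For eta d <= 1, disjoint spheres lie in a container of volume C (1 on the torus,
   2^d in the Euclidean model). Tilting each point by the volume b(z) of its sphere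
   yields Z f <= exp (tau C + int f e^(- tau b)), and the choice of tau gives the
   limit -1 and the bound for constant radii.

   For eta d = 1, cutting the cube into M^d subcubes and using Z(f + g) <= Z f Z g
   shows that - ln P is superadditive after rescaling in the Euclidean model, so that
   its normalization converges. The two models differ only through the points close
   to the boundary, whose contribution is o(lambda). *)

From HB Require Import structures.
Require Import Defs.
From mathcomp Require Import all_boot all_order all_algebra finmap all_fingroup.
From mathcomp Require Import all_classical all_reals all_analysis.
From mathcomp Require Import measurable_realfun measurable_fun_approximation.
From mathcomp Require Import ring lra.
Import Order.TTheory GRing.Theory Num.Theory.
Import numFieldNormedType.Exports.
Local Open Scope classical_set_scope.
Local Open Scope ring_scope.
Set Implicit Arguments.
Unset Strict Implicit.
Unset Printing Implicit Defensive.

(** * Configuration integrals *)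

(** The hypothesis on the centres fixes only their counts in disjoint Borel sets, and [X] lists the
    points in an arbitrary measurable order. So the joint law of X 0, ..., X (n - 1) on the event N
    = n is not determined; only its sum over all permutations is. The passage to Z therefore runs
    through sums over ['S_n], computed first for finitely many labels, then for product sets, then
    for all measurable sets. The non-overlap event does not see the order, which brings back the
    factor 1/n!.

    The estimates of ln Z (t f) are not obtained from a cluster expansion, whose signed series would
    restrict the intensity. They come from inequalities between nonnegative coefficients. A first
    point z replaces f by f c(z, .); restoring f costs v(z) for each remaining point, and a second
    application of the same idea to the correction gives the term in q2. Since these inequalities
    hold for every finite weight, the intensity can be tuned independently of the radii, which the
    critical case uses.

    The marks are the sample points of [Q] rather than radii, so that the second-order term is
    directly a double integral over [Q]. *)

Definition weight d (S : measurableType d) (K : realType) (f : S -> K) : Prop :=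
  measurable_fun setT f /\ forall x, 0 <= f x.

Lemma weight_ge0 d (S : measurableType d) (K : realType) (f : S -> K) x :
  weight f -> 0 <= f x.
Proof. by case. Qed.

Section configuration_integrals.
Context {K : realType} {d : measure_display} {S : measurableType d}.
Variable mu : {sigma_finite_measure set S -> \bar K}.

(** Unfolded, this is the integral over n-tuples of the product of all f(x_i) and of all c(x_i, x_j)
    with i < j. Peeling off one point and absorbing its interactions into the weight turns the
    estimates below into inductions over all weights at once. *)
Fixpoint conf_int (c : S -> S -> K) (n : nat) (f : S -> K) : \bar K :=
  match n with
  | 0 => 1%E
  | n'.+1 => (\int[mu]_z ((f z)%:E * conf_int c n' (fun y => (f y * c z y)%R)))%E
  end.

Definition compatibility (c : S -> S -> K) : Prop :=
  [/\ measurable_fun setT (fun z : S * S => c z.1 z.2),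
      forall x y, 0 <= c x y <= 1
    & forall x y, c x y = c y x].

Variable c : S -> S -> K.
Hypothesis cc : compatibility c.

Let mc : measurable_fun setT (fun z : S * S => c z.1 z.2). Proof. by case: cc. Qed.
Let c_ge0 x y : 0 <= c x y. Proof. by case: cc => _ /(_ x y)/andP[]. Qed.
Let c_le1 x y : c x y <= 1. Proof. by case: cc => _ /(_ x y)/andP[]. Qed.
Let c_sym x y : c x y = c y x. Proof. by case: cc. Qed.

Local Notation F := (conf_int c).

Lemma conf_int_ge0 n f : (forall x, 0 <= f x) -> (0 <= F n f)%E.
Proof.
elim: n f => [|n IH] f f0 /=; first exact: lee01.
apply: integral_ge0 => z _; apply: mule_ge0; first by rewrite lee_fin.
by apply: IH => y; rewrite mulr_ge0.
Qed.

(** The parameter space has to vary in the induction: under the integral over z the weight depends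
    on the pair (w, z), so the induction hypothesis is needed on [W * S]. *)
Lemma measurable_conf_int n d' (W : measurableType d') (f : W -> S -> K) :
  measurable_fun setT (fun z : W * S => f z.1 z.2) -> (forall w x, 0 <= f w x) ->
  measurable_fun setT (fun w => F n (f w)).
Proof.
elim: n d' W f => [|n IH] d' W f mf f0 /=; first exact: measurable_cst.
pose g (z : W * S) := ((f z.1 z.2)%:E * F n (fun y => (f z.1 y * c z.2 y)%R))%E.
have mg : measurable_fun setT g.
  apply: emeasurable_funM; first exact: measurableT_comp.
  apply: (IH _ _ (fun (z : W * S) y => f z.1 y * c z.2 y)); last first.
    by move=> z x; rewrite mulr_ge0.
  have m1 : measurable_fun [set: W * S * S] (fun z => (z.1.1, z.2)).
    by apply: measurable_fun_pair => //; exact: measurableT_comp.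
  have m2 : measurable_fun [set: W * S * S] (fun z => (z.1.2, z.2)).
    by apply: measurable_fun_pair => //; exact: measurableT_comp.
  by apply: measurable_funM; [exact: (measurableT_comp mf m1)
                             |exact: (measurableT_comp mc m2)].
have g0 z : (0 <= g z)%E.
  by apply: mule_ge0; [rewrite lee_fin|apply: conf_int_ge0 => y; rewrite mulr_ge0].
exact: (measurable_fun_fubini_tonelli_F (m2 := mu) g).
Qed.

Lemma weight_thin f z : weight f -> weight (fun y => f y * c z y).
Proof.
move=> [mf f0]; split=> [|y]; last by rewrite mulr_ge0.
apply: measurable_funM => //.
exact: (measurableT_comp mc (measurable_pair1 z)).
Qed.

Lemma measurable_conf_int_thin n f : weight f ->
  measurable_fun setT (fun z => F n (fun y => f y * c z y)).
Proof.
move=> [mf f0]; apply: (measurable_conf_int n (f := fun z y => f y * c z y)).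
  by apply: measurable_funM => //; exact: measurableT_comp.
by move=> w x; rewrite mulr_ge0.
Qed.

Let mthin n f : weight f ->
  measurable_fun setT (fun z => F n (fun y => f y * c z y)%R).
Proof. exact: measurable_conf_int_thin. Qed.

Let mweight (f : S -> K) : weight f -> measurable_fun [set: S] (fun z => (f z)%:E).
Proof. by move=> [mf _]; exact: measurableT_comp. Qed.

Lemma conf_int_thin_ge0 n f z : weight f -> (0 <= F n (fun y => f y * c z y)%R)%E.
Proof. by move=> [_ f0]; apply: conf_int_ge0 => y; rewrite mulr_ge0. Qed.

Let mintegrand n f g : weight f -> weight g ->
  measurable_fun [set: S] (fun z => (f z)%:E * F n (fun y => g y * c z y)%R)%E.
Proof. by move=> wf wg; apply: emeasurable_funM; [exact: mweight|exact: mthin]. Qed.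

Let integrand_ge0 n f g z : weight f -> weight g ->
  (0 <= (f z)%:E * F n (fun y => g y * c z y)%R)%E.
Proof.
by move=> wf wg; apply: mule_ge0; [rewrite lee_fin weight_ge0|exact: conf_int_thin_ge0].
Qed.

Implicit Types f g : S -> K.

Lemma weightD f g : weight f -> weight g -> weight (fun x => f x + g x).
Proof.
by move=> [mf f0] [mg g0]; split=> [|x]; [exact: measurable_funD|rewrite addr_ge0].
Qed.

Lemma weightZ (k : K) f : 0 <= k -> weight f -> weight (fun x => k * f x).
Proof.
by move=> k0 [mf f0]; split=> [|x]; [exact: measurable_funM|rewrite mulr_ge0].
Qed.

Lemma conf_intZ n (k : K) f : 0 <= k -> weight f ->
  F n (fun x => k * f x) = ((k ^+ n)%:E * F n f)%E.
Proof.
move=> k0; elim: n f => [|n IH] f wf; first by rewrite expr0 mul1e.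
rewrite /= -ge0_integralZl//=; last 3 first.
- exact: mintegrand.
- by move=> z _; exact: integrand_ge0.
- by rewrite lee_fin exprn_ge0.
apply: eq_integral => z _; under eq_fun do rewrite -mulrA.
rewrite (IH _ (weight_thin z wf)) exprSr !EFinM muleA muleA; congr (_ * _)%E.
by rewrite -!EFinM; congr EFin; ring.
Qed.

Let thinD f g z : (fun y => (f y + g y) * c z y) =
  (fun y => f y * c z y + g y * c z y).
Proof. by apply/funext => y; rewrite mulrDl. Qed.

Let ge0_int f : weight f -> (0 <= \int[mu]_z (f z)%:E)%E.
Proof. by move=> wf; apply: integral_ge0 => z _; rewrite lee_fin weight_ge0. Qed.

Let le_thin f z : weight f -> (\int[mu]_y (f y * c z y)%:E <= \int[mu]_y (f y)%:E)%E.
Proof.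
move=> wf; apply: ge0_le_integral => //.
- by move=> y _; rewrite lee_fin (weight_ge0 _ (weight_thin z wf)).
- exact: mweight (weight_thin z wf).
- exact: mweight.
- by move=> y _; rewrite lee_fin ler_piMr// weight_ge0.
Qed.

Let integralD2 (f1 f2 : S -> K) (h : S -> \bar K) : weight f1 -> weight f2 ->
  measurable_fun [set: S] h -> (forall x, 0 <= h x)%E ->
  (\int[mu]_z ((f1 z + f2 z)%:E * h z) =
   \int[mu]_z ((f1 z)%:E * h z) + \int[mu]_z ((f2 z)%:E * h z))%E.
Proof.
move=> w1 w2 mh h0; rewrite -ge0_integralD//=.
- apply: eq_integral => z _.
  by rewrite EFinD ge0_muleDl ?lee_fin ?weight_ge0.
- by move=> z _; rewrite mule_ge0// lee_fin weight_ge0.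
- by apply: emeasurable_funM => //; exact: mweight.
- by move=> z _; rewrite mule_ge0// lee_fin weight_ge0.
- by apply: emeasurable_funM => //; exact: mweight.
Qed.

Lemma conf_int_mono n f g : weight f -> weight g -> (forall x, f x <= g x) ->
  (F n f <= F n g)%E.
Proof.
elim: n f g => [|n IH] f g wf wg fg //=.
apply: ge0_le_integral => //.
- by move=> z _; exact: integrand_ge0.
- exact: mintegrand.
- exact: mintegrand.
move=> z _; apply: lee_pmul; rewrite ?lee_fin ?weight_ge0//.
  exact: conf_int_thin_ge0.
by apply: IH; [exact: weight_thin|exact: weight_thin|move=> x; rewrite ler_wpM2r].
Qed.

Lemma conf_int_thin_le n f z : weight f -> (F n (fun y => (f y * c z y)%R) <= F n f)%E.
Proof.
move=> wf; apply: conf_int_mono => //; first exact: weight_thin.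
by move=> y; rewrite ler_piMr// weight_ge0.
Qed.

(** All interactions are dropped, since thinning only lowers the weight. *)
Lemma conf_int_le_exp n f : weight f -> (F n f <= (\int[mu]_z (f z)%:E) ^+ n)%E.
Proof.
elim: n f => [|n IH] f wf //.
rewrite expeS [leLHS]/= -ge0_integralZr//=; last 3 first.
- exact: mweight.
- by move=> z _; rewrite lee_fin weight_ge0.
- by apply: expe_ge0; exact: ge0_int.
apply: ge0_le_integral => //.
- by move=> z _; exact: integrand_ge0.
- exact: mintegrand.
- by apply: emeasurable_funM => //; exact: mweight.
move=> z _; apply: lee_pmul; rewrite ?lee_fin ?weight_ge0//.
  exact: conf_int_thin_ge0.
by apply: le_trans (IH _ wf); exact: conf_int_thin_le.
Qed.

(** Union bound over the point taken from g: either no point is, or one of the n points carries g,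
    and bounding its interactions by 1 factors its integral out. At n = 0 the truncated [n.-1] is
    multiplied by 0. *)
Lemma conf_int_drop n f g : weight f -> weight g ->
  (F n (fun x => (f x + g x)%R) <= F n f +
     n%:R%:E * ((\int[mu]_x (g x)%:E) * F n.-1 (fun x => (f x + g x)%R)))%E.
Proof.
elim: n f g => [|n IH] f g wf wg; first by rewrite mul0e adde0.
have wfg := weightD wf wg.
have I0 := ge0_int wg.
have F0 m h : weight h -> (0 <= F m h)%E by move=> [_ h0]; exact: conf_int_ge0.
rewrite [leLHS]/= integralD2//; [|exact: mthin|by move=> z; exact: conf_int_thin_ge0].
have -> : (n.+1%:R%:E = n%:R%:E + 1 :> \bar K)%E by rewrite -natr1 EFinD.
rewrite ge0_muleDl ?mul1e ?lee_fin// [leRHS]addeA.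
apply: leeD; last first.
  rewrite -ge0_integralZr//=; [|exact: mweight| |exact: F0]; last first.
    by move=> z _; rewrite lee_fin weight_ge0.
  apply: ge0_le_integral => //.
  - by move=> z _; exact: integrand_ge0.
  - exact: mintegrand.
  - by apply: emeasurable_funM => //; exact: mweight.
  - move=> z _; apply: lee_pmul; rewrite ?lee_fin ?weight_ge0//.
      exact: conf_int_thin_ge0.
    exact: conf_int_thin_le.
rewrite [n.+1.-1]/=.
(* The induction hypothesis is applied to the weights thinned by z. Bounding the integral of the
   thinned g by that of g makes k independent of z. *)
pose k := (n%:R%:E * \int[mu]_x (g x)%:E)%E.
have k0 : (0 <= k)%E by rewrite mule_ge0// lee_fin.
apply: (@le_trans _ _ (\int[mu]_z ((f z)%:E * F n (fun y => f y * c z y)%R +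
   k * ((f z)%:E * F n.-1 (fun y => (f y + g y) * c z y)%R)))%E).
  apply: ge0_le_integral => //.
  - by move=> z _; exact: integrand_ge0.
  - exact: mintegrand.
  - apply: emeasurable_funD; first exact: mintegrand.
    by apply: emeasurable_funM => //; exact: mintegrand.
  move=> z _; rewrite thinD.
  rewrite muleCA -ge0_muleDr; last 2 first.
  - exact: conf_int_thin_ge0.
  - by rewrite mule_ge0// F0// -thinD; exact: weight_thin.
  apply: lee_wpmul2l; first by rewrite lee_fin weight_ge0.
  apply: (le_trans (IH _ _ (weight_thin z wf) (weight_thin z wg))).
  apply: leeD => //; rewrite muleA; apply: lee_wpmul2r.
    by apply: F0; rewrite -thinD; exact: weight_thin.
  by apply: lee_wpmul2l; [rewrite lee_fin|exact: le_thin].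
rewrite ge0_integralD//=; last 4 first.
- by move=> z _; exact: integrand_ge0.
- exact: mintegrand.
- by move=> z _; rewrite mule_ge0//; exact: integrand_ge0.
- by apply: emeasurable_funM => //; exact: mintegrand.
apply: leeD => //.
rewrite ge0_integralZl//=; [|exact: mintegrand|by move=> z _; exact: integrand_ge0].
rewrite /k -muleA.
(* For n = 0 the factor k vanishes. Otherwise the right-hand side unfolds to an integral over its
   first point, and f is enlarged to f + g there. *)
case: n IH @k k0 => [|n] IH k k0; first by rewrite !mul0e.
apply: lee_wpmul2l; rewrite ?lee_fin//; apply: lee_wpmul2l => //=.
apply: ge0_le_integral => //.
- by move=> z _; exact: integrand_ge0.
- exact: mintegrand.
- exact: mintegrand.
move=> z _; apply: lee_wpmul2r; first exact: conf_int_thin_ge0.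
by rewrite lee_fin lerDl weight_ge0.
Qed.

Let thinC f z y : (fun x => f x * c z x * c y x) = (fun x => f x * c y x * c z x).
Proof. by apply/funext => x; rewrite mulrAC. Qed.

(** Fubini and the symmetry of c: the factor c(z, y) may be charged to either point. A point
    carrying g that is met second can thus be counted as if it had been integrated first. *)
Lemma conf_int_swap n f g : weight f -> weight g ->
  (\int[mu]_z ((f z)%:E * \int[mu]_y ((g y * c z y)%:E *
      F n (fun x => f x * c z x * c y x)%R)) =
   \int[mu]_y ((g y)%:E * F n.+1 (fun x => f x * c y x)%R))%E.
Proof.
move=> wf wg; have [mf f0] := wf; have [mg g0] := wg.
pose h (z : S * S) := ((f z.1 * (g z.2 * c z.1 z.2))%:E *
   F n (fun x => f x * c z.1 x * c z.2 x)%R)%E.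
have mcp i : measurable_fun [set: S * S * S]
    (fun z => c (if i then z.1.1 else z.1.2) z.2).
  have mp : measurable_fun [set: S * S * S]
      (fun z => ((if i then z.1.1 else z.1.2), z.2)).
    by apply: measurable_fun_pair => //; case: i; exact: measurableT_comp.
  exact: (measurableT_comp mc mp).
have mh : measurable_fun setT h.
  apply: emeasurable_funM.
    apply: measurableT_comp => //; apply: measurable_funM.
      exact: measurableT_comp.
    by apply: measurable_funM => //; exact: measurableT_comp.
  apply: (measurable_conf_int n (f := fun (z : S * S) x => f x * c z.1 x * c z.2 x)).
    apply: measurable_funM; last exact: (mcp false).
    by apply: measurable_funM; [exact: measurableT_comp|exact: (mcp true)].
  by move=> w x; rewrite !mulr_ge0.
have h0 z : (0 <= h z)%E.
  apply: mule_ge0; first by rewrite lee_fin !mulr_ge0.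
  by apply: conf_int_ge0 => x; rewrite !mulr_ge0.
transitivity (\int[mu]_z \int[mu]_y h (z, y))%E.
  apply: eq_integral => z _; rewrite -ge0_integralZl//=.
  - by apply: eq_integral => y _; rewrite /h /= EFinM muleA.
  - apply: emeasurable_funM; first exact: mweight (weight_thin z wg).
    exact: mthin (weight_thin z wf).
  - move=> y _; rewrite mule_ge0 ?lee_fin ?mulr_ge0//.
    by apply: conf_int_ge0 => x; rewrite !mulr_ge0.
  - by rewrite lee_fin.
rewrite (fubini_tonelli h)//; apply: eq_integral => y _ /=.
rewrite -ge0_integralZl//=; last 3 first.
- by apply: emeasurable_funM;
    [exact: mweight (weight_thin y wf)|exact: mthin (weight_thin y wf)].
- by move=> z _; exact: (integrand_ge0 n z (weight_thin y wf) (weight_thin y wf)).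
- by rewrite lee_fin.
apply: eq_integral => z _; rewrite /h /= thinC muleA; congr (_ * _)%E.
by rewrite -EFinM; congr EFin; rewrite (c_sym z y); ring.
Qed.

(** The product of the (f + g)(x_i) is expanded, and only the terms with at most one factor g are
    kept; the others are nonnegative. In contrast with [conf_int_drop], the point carrying g keeps
    its interactions and all the other points carry f. *)
Lemma conf_int_add n f g : weight f -> weight g ->
  (F n f + n%:R%:E * \int[mu]_y ((g y)%:E * F n.-1 (fun x => f x * c y x)%R)
   <= F n (fun x => (f x + g x)%R))%E.
Proof.
elim: n f g => [|n IH] f g wf wg; first by rewrite mul0e adde0.
have wfg := weightD wf wg.
have F0 m h : weight h -> (0 <= F m h)%E by move=> [_ h0]; exact: conf_int_ge0.
rewrite [leRHS]/= integralD2//; [|exact: mthin|by move=> z; exact: conf_int_thin_ge0].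
have -> : (n.+1%:R%:E = n%:R%:E + 1 :> \bar K)%E by rewrite -natr1 EFinD.
have J0 m : (0 <= \int[mu]_y ((g y)%:E * F m (fun x => f x * c y x)%R))%E.
  by apply: integral_ge0 => y _; exact: integrand_ge0.
rewrite ge0_muleDl ?mul1e ?lee_fin// [leLHS]addeA [n.+1.-1]/=.
have fle z x : f x * c z x <= (f x + g x) * c z x.
  by rewrite ler_wpM2r// lerDl weight_ge0.
apply: leeD; last first.
  apply: ge0_le_integral => //.
  - by move=> z _; exact: integrand_ge0.
  - exact: mintegrand.
  - exact: mintegrand.
  move=> z _; apply: lee_wpmul2l; first by rewrite lee_fin weight_ge0.
  by apply: conf_int_mono; [exact: weight_thin|exact: weight_thin|exact: fle].
case: n IH => [|n] IH.
  rewrite mul0e adde0 /=; apply: ge0_le_integral => //.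
  - by move=> z _; rewrite mule1 lee_fin weight_ge0.
  - by apply: emeasurable_funM => //; exact: mweight.
  - by apply: emeasurable_funM => //; exact: mweight.
pose J z := (\int[mu]_y ((g y * c z y)%:E * F n (fun x => f x * c z x * c y x)%R))%E.
have mJ : measurable_fun [set: S] J.
  pose h (z : S * S) := ((g z.2 * c z.1 z.2)%:E *
     F n (fun x => f x * c z.1 x * c z.2 x)%R)%E.
  have [mf f0] := wf; have [mg g0] := wg.
  apply: (measurable_fun_fubini_tonelli_F (m2 := mu) h).
    have mcp i : measurable_fun [set: S * S * S]
        (fun z => c (if i then z.1.1 else z.1.2) z.2).
      have mp : measurable_fun [set: S * S * S]
          (fun z => ((if i then z.1.1 else z.1.2), z.2)).
        by apply: measurable_fun_pair => //; case: i; exact: measurableT_comp.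
      exact: (measurableT_comp mc mp).
    apply: emeasurable_funM.
      apply: measurableT_comp => //; apply: measurable_funM => //.
      exact: measurableT_comp.
    apply: (measurable_conf_int n (f := fun (z : S * S) x => f x * c z.1 x * c z.2 x)).
      apply: measurable_funM; last exact: (mcp false).
      by apply: measurable_funM; [exact: measurableT_comp|exact: (mcp true)].
    by move=> w x; rewrite !mulr_ge0.
  move=> z; apply: mule_ge0; first by rewrite lee_fin !mulr_ge0.
  by apply: conf_int_ge0 => x; rewrite !mulr_ge0.
have J0' z : (0 <= J z)%E.
  apply: integral_ge0 => y _; apply: mule_ge0.
    by rewrite lee_fin mulr_ge0// weight_ge0.
  by apply: conf_int_ge0 => x; rewrite !mulr_ge0// weight_ge0.
(* In the induction hypothesis the point carrying g comes after z, hence the exchange of the two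
   integrations. *)
rewrite -conf_int_swap// -/J.
rewrite -ge0_integralZl//=; last 2 first.
- by apply: emeasurable_funM => //; exact: mweight.
- by move=> z _; apply: mule_ge0; [rewrite lee_fin weight_ge0|exact: J0'].
rewrite -ge0_integralD//=; last 4 first.
- by move=> z _; exact: (integrand_ge0 n.+1 z wf wf).
- exact: (mintegrand n.+1 wf wf).
- move=> z _; apply: mule_ge0; first by rewrite lee_fin.
  by apply: mule_ge0; [rewrite lee_fin weight_ge0|exact: J0'].
- by apply: emeasurable_funM => //; apply: emeasurable_funM => //; exact: mweight.
apply: ge0_le_integral => //.
- move=> z _; apply: adde_ge0; first exact: (integrand_ge0 n.+1 z wf wf).
  apply: mule_ge0; first by rewrite lee_fin.
  by apply: mule_ge0; [rewrite lee_fin weight_ge0|exact: J0'].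
- apply: emeasurable_funD; first exact: (mintegrand n.+1 wf wf).
  by apply: emeasurable_funM => //; apply: emeasurable_funM => //; exact: mweight.
- exact: (mintegrand n.+1 wf wfg).
move=> z _.
rewrite muleCA -ge0_muleDr; last 2 first.
- exact: (conf_int_thin_ge0 n.+1 z wf).
- by apply: mule_ge0; [rewrite lee_fin|exact: J0'].
apply: lee_wpmul2l; first by rewrite lee_fin weight_ge0.
have := IH _ _ (weight_thin z wf) (weight_thin z wg).
by rewrite -thinD.
Qed.

Definition excluded f (z : S) : \bar K := (\int[mu]_y (f y * (1 - c z y))%:E)%E.

Let wexcl f z : weight f -> weight (fun y => f y * (1 - c z y)).
Proof.
move=> [mf f0]; split => [|y]; last by rewrite mulr_ge0// subr_ge0.
apply: measurable_funM => //; apply: measurable_funB => //.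
exact: (measurableT_comp mc (measurable_pair1 z)).
Qed.

Lemma excluded_ge0 f z : weight f -> (0 <= excluded f z)%E.
Proof.
by move=> wf; apply: integral_ge0 => y _; rewrite lee_fin (weight_ge0 _ (wexcl z wf)).
Qed.

Lemma measurable_excluded f : weight f -> measurable_fun [set: S] (excluded f).
Proof.
move=> [mf f0].
apply: (measurable_fun_fubini_tonelli_F (m2 := mu)
  (fun z : S * S => (f z.2 * (1 - c z.1 z.2))%:E)).
  apply: measurableT_comp => //; apply: measurable_funM; first exact: measurableT_comp.
  exact: measurable_funB.
by move=> z; rewrite lee_fin mulr_ge0// subr_ge0.
Qed.

Let split_thin f z : f = (fun y => f y * c z y + f y * (1 - c z y)).
Proof. by apply/funext => y; rewrite mulrBr mulr1 addrC subrK. Qed.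

(** Coefficientwise form of Z' >= (I - t q) Z for t |-> Z (t f). Once the first point z is fixed, f
    splits into f c(z, .) and f (1 - c(z, .)), the latter of mass v(z); [conf_int_drop] restores the
    full weight at the price n v(z) [F n.-1 f]. *)
Lemma conf_int_rec_lower n f : weight f ->
  ((\int[mu]_z (f z)%:E) * F n f <= F n.+1 f +
    n%:R%:E * ((\int[mu]_z ((f z)%:E * excluded f z)) * F n.-1 f))%E.
Proof.
move=> wf.
have F0 m : (0 <= F m f)%E by apply: conf_int_ge0 => x; exact: weight_ge0.
have mE : measurable_fun [set: S] (fun z => (f z)%:E * excluded f z)%E.
  by apply: emeasurable_funM; [exact: mweight|exact: measurable_excluded].
have E0 z : (0 <= (f z)%:E * excluded f z)%E.
  by rewrite mule_ge0 ?lee_fin ?weight_ge0// excluded_ge0.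
rewrite -ge0_integralZr//=; [|exact: mweight|by move=> z _; rewrite lee_fin weight_ge0].
rewrite muleA (muleC n%:R%:E) -muleA -ge0_integralZr//=; last by rewrite mule_ge0// lee_fin.
rewrite -ge0_integralD//=; last 4 first.
- by move=> z _; exact: integrand_ge0.
- exact: mintegrand.
- by move=> z _; rewrite mule_ge0// mule_ge0// lee_fin.
- by apply: emeasurable_funM.
apply: ge0_le_integral => //.
- by move=> z _; rewrite mule_ge0// lee_fin weight_ge0.
- by apply: emeasurable_funM => //; exact: mweight.
- apply: emeasurable_funD; first exact: mintegrand.
  by apply: emeasurable_funM.
move=> z _; rewrite -[X in (_ <= _ + X)%E]muleA -ge0_muleDr; last 2 first.
- exact: conf_int_thin_ge0.
- by rewrite mule_ge0 ?excluded_ge0// mule_ge0// lee_fin.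
apply: lee_wpmul2l; first by rewrite lee_fin weight_ge0.
have := conf_int_drop n (weight_thin z wf) (wexcl z wf).
by rewrite -split_thin -/(excluded f z) (muleCA (excluded f z)).
Qed.

Lemma excluded_le f z : weight f -> (excluded f z <= \int[mu]_y (f y)%:E)%E.
Proof.
move=> wf; apply: ge0_le_integral => //.
- by move=> y _; rewrite lee_fin (weight_ge0 _ (wexcl z wf)).
- exact: mweight (wexcl z wf).
- exact: mweight.
- by move=> y _; rewrite lee_fin ler_piMr ?weight_ge0// gerBl.
Qed.

(** For a and b in [0, 1], 1 - a b <= (1 - a) + (1 - b). *)
Let excluded_pair f z y : weight f ->
  (\int[mu]_x (f x * (1 - c z x * c y x))%:E <= excluded f z + excluded f y)%E.
Proof.
move=> wf; have [mf f0] := wf.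
have mcz w : measurable_fun [set: S] (c w).
  exact: (measurableT_comp mc (measurable_pair1 w)).
rewrite -ge0_integralD//=; last 4 first.
- by move=> x _; rewrite lee_fin (weight_ge0 _ (wexcl z wf)).
- exact: mweight (wexcl z wf).
- by move=> x _; rewrite lee_fin (weight_ge0 _ (wexcl y wf)).
- exact: mweight (wexcl y wf).
apply: ge0_le_integral => //=.
- by move=> x _; rewrite lee_fin mulr_ge0// subr_ge0 mulr_ile1.
- apply: measurableT_comp => //; apply: measurable_funM => //.
  by apply: measurable_funB => //; exact: measurable_funM.
- by apply: emeasurable_funD; [exact: mweight (wexcl z wf)|exact: mweight (wexcl y wf)].
move=> x _; rewrite -EFinD lee_fin -mulrDr ler_wpM2l//.
rewrite -subr_ge0 (_ : _ - _ = (1 - c z x) * (1 - c y x)); last by ring.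
by rewrite mulr_ge0// subr_ge0.
Qed.

(** Coefficientwise form of Z' <= (I - t q + 2 t^2 q2) Z. Here [conf_int_add] singles out one point
    y in the excluded region of z, but leaves the weight thinned by both z and y; [conf_int_drop]
    undoes this thinning at the price v(z) + v(y). *)
Lemma conf_int_rec_upper n f : weight f ->
  (F n.+1 f + n%:R%:E * ((\int[mu]_z ((f z)%:E * excluded f z)) * F n.-1 f)
   <= (\int[mu]_z (f z)%:E) * F n f +
     (2 * n%:R * n.-1%:R)%:E *
       ((\int[mu]_z ((f z)%:E * (excluded f z * excluded f z))) * F n.-2 f))%E.
Proof.
move=> wf; have [mf f0] := wf.
have F0 m : (0 <= F m f)%E by apply: conf_int_ge0 => x; exact: weight_ge0.
have wt z := weight_thin z wf.
have we z := wexcl z wf.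
have mE : measurable_fun [set: S] (excluded f) by exact: measurable_excluded.
have E0 z : (0 <= excluded f z)%E by exact: excluded_ge0.
have mf' := mweight wf.
have f0' z : (0 <= (f z)%:E)%E by rewrite lee_fin.
pose W z := (\int[mu]_y ((f y * (1 - c z y))%:E * excluded f y))%E.
pose h (z : S * S) := ((f z.2 * (1 - c z.1 z.2))%:E * excluded f z.2)%E.
have mh : measurable_fun setT h.
  apply: emeasurable_funM; last exact: measurableT_comp.
  apply: measurableT_comp => //; apply: measurable_funM; first exact: measurableT_comp.
  exact: measurable_funB.
have h0 z : (0 <= h z)%E.
  by apply: mule_ge0 => //; rewrite lee_fin mulr_ge0// subr_ge0.
have mW : measurable_fun [set: S] W.
  exact: (measurable_fun_fubini_tonelli_F (m2 := mu) h).
have W0 z : (0 <= W z)%E.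
  by apply: integral_ge0 => y _; exact: (h0 (z, y)).
(* The terms v(z) and v(y) of that price contribute equally: by Fubini and the symmetry of c, both
   integrate to q2. Hence the factor 2. *)
have WE : (\int[mu]_z ((f z)%:E * W z) =
           \int[mu]_z ((f z)%:E * (excluded f z * excluded f z)))%E.
  pose g (z : S * S) := ((f z.1)%:E * h z)%E.
  transitivity (\int[mu]_z \int[mu]_y g (z, y))%E.
    apply: eq_integral => z _; rewrite -ge0_integralZl//=.
      exact: (measurableT_comp mh (measurable_pair1 z)).
    by move=> y _; exact: (h0 (z, y)).
  rewrite (fubini_tonelli g); last 2 first.
  - apply: emeasurable_funM => //.
    exact: (measurableT_comp mf' measurable_fst).
  - by move=> z; exact: mule_ge0.
  apply: eq_integral => y _ /=.
  transitivity (\int[mu]_x (((f y)%:E * excluded f y) * (f x * (1 - c y x))%:E))%E.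
    apply: eq_integral => x _; rewrite /g /h /= (c_sym y x).
    rewrite !EFinM; rewrite -!muleA [LHS]muleCA; congr (_ * _)%E.
    by rewrite [LHS]muleA [LHS]muleC.
  rewrite ge0_integralZl//=.
  - by rewrite -muleA.
  - exact: mweight (we y).
  - by move=> x _; rewrite lee_fin (weight_ge0 _ (we y)).
  - exact: mule_ge0.
have key z : (F n (fun y => f y * c z y)%R + n%:R%:E * (excluded f z * F n.-1 f)
    <= F n f + (n%:R * n.-1%:R)%:E *
       ((excluded f z * excluded f z + W z) * F n.-2 f))%E.
  have L2 := conf_int_add n (wt z) (we z).
  rewrite -split_thin in L2.
  have L1 y : (F n.-1 f <= F n.-1 (fun x => f x * c z x * c y x)%R +
      n.-1%:R%:E * ((excluded f z + excluded f y) * F n.-2 f))%E.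
    have wzy := weight_thin y (wt z).
    have we' : weight (fun x => f x * (1 - c z x * c y x)).
      have mcz w : measurable_fun [set: S] (c w).
        exact: (measurableT_comp mc (measurable_pair1 w)).
      split=> [|x].
        apply: measurable_funM => //.
        by apply: measurable_funB => //; exact: measurable_funM.
      by rewrite mulr_ge0// subr_ge0 mulr_ile1.
    have := conf_int_drop n.-1 wzy we'.
    rewrite (_ : (fun x => f x * c z x * c y x + f x * (1 - c z x * c y x)) = f);
      last by apply/funext => x; ring.
    move=> /le_trans; apply; apply: leeD => //.
    apply: lee_wpmul2l; rewrite ?lee_fin//; apply: lee_wpmul2r => //.
    exact: excluded_pair.
  have L3 : (excluded f z * F n.-1 f <=
     \int[mu]_y ((f y * (1 - c z y))%:E * F n.-1 (fun x => f x * c z x * c y x)%R) +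
     n.-1%:R%:E * ((excluded f z * excluded f z + W z) * F n.-2 f))%E.
    pose G y := F n.-1 (fun x => f x * c z x * c y x).
    have mG : measurable_fun [set: S] G by exact: mthin (wt z).
    have G0 y : (0 <= G y)%E by apply: conf_int_ge0 => x; rewrite !mulr_ge0.
    have o0 y : (0 <= (f y * (1 - c z y))%:E)%E.
      by rewrite lee_fin (weight_ge0 _ (we z)).
    have mo := mweight (we z).
    have mB : measurable_fun [set: S] (fun y =>
        (f y * (1 - c z y))%:E * (excluded f z + excluded f y))%E.
      by apply: emeasurable_funM => //; exact: emeasurable_funD.
    have B0 y : (0 <= (f y * (1 - c z y))%:E * (excluded f z + excluded f y))%E.
      by rewrite mule_ge0// adde_ge0.
    have -> : (excluded f z * excluded f z + W z)%E =
        (\int[mu]_y ((f y * (1 - c z y))%:E * (excluded f z + excluded f y)))%E.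
      rewrite {1}/excluded -ge0_integralZr//= -ge0_integralD//=.
      - apply: eq_integral => y _; rewrite [RHS]ge0_muleDr//.
      - by move=> y _; rewrite mule_ge0.
      - exact: emeasurable_funM.
      - by move=> y _; rewrite mule_ge0.
      - exact: emeasurable_funM.
    rewrite muleA (muleC n.-1%:R%:E) -muleA -[X in (_ <= _ + X)%E]ge0_integralZr//=;
      last by rewrite mule_ge0// lee_fin.
    rewrite -[leRHS]ge0_integralD//=; last 4 first.
    - by move=> y _; apply: mule_ge0 => //; exact: G0.
    - exact: emeasurable_funM.
    - move=> y _; apply: mule_ge0; first exact: B0.
      by apply: mule_ge0 => //; rewrite lee_fin.
    - exact: emeasurable_funM.
    rewrite {1}/excluded -ge0_integralZr//=.
    apply: ge0_le_integral => //.
    - by move=> y _; apply: mule_ge0.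
    - exact: emeasurable_funM.
    - by apply: emeasurable_funD; exact: emeasurable_funM.
    move=> y _; rewrite -[X in (_ <= _ + X)%E]muleA -ge0_muleDr; last 2 first.
    - exact: G0.
    - apply: mule_ge0; first by apply: adde_ge0; exact: E0.
      by apply: mule_ge0; [rewrite lee_fin|exact: F0].
    apply: lee_wpmul2l => //; apply: (le_trans (L1 y)).
    by apply: leeD => //; rewrite muleCA.
  apply: (@le_trans _ _ (F n (fun y => (f y * c z y)%R) + n%:R%:E *
    (\int[mu]_y ((f y * (1 - c z y))%:E * F n.-1 (fun x => f x * c z x * c y x)%R) +
     n.-1%:R%:E * ((excluded f z * excluded f z + W z) * F n.-2 f)))%E).
    by apply: leeD => //; apply: lee_wpmul2l => //; rewrite lee_fin.
  rewrite ge0_muleDr; last 2 first.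
  - apply: integral_ge0 => y _; apply: mule_ge0.
      by rewrite lee_fin (weight_ge0 _ (we z)).
    by apply: conf_int_ge0 => x; rewrite !mulr_ge0.
  - by rewrite !mule_ge0 ?lee_fin// adde_ge0// mule_ge0.
  rewrite [leLHS]addeA EFinM -[X in (_ <= _ + X)%E]muleA; apply: leeD => //.
pose V z := (excluded f z * excluded f z)%E.
have mV : measurable_fun [set: S] V by exact: emeasurable_funM.
have V0 z : (0 <= V z)%E by exact: mule_ge0.
pose k := (n%:R * n.-1%:R)%:E : \bar K.
have k0 : (0 <= k)%E by rewrite lee_fin mulr_ge0.
have mfV : measurable_fun [set: S] (fun z => (f z)%:E * (V z + W z))%E.
  by apply: emeasurable_funM => //; exact: emeasurable_funD.
have fV0 z : (0 <= (f z)%:E * (V z + W z))%E by rewrite mule_ge0// adde_ge0.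
have -> : ((2 * n%:R * n.-1%:R)%:E *
    ((\int[mu]_z ((f z)%:E * (excluded f z * excluded f z))) * F n.-2 f))%E =
    (\int[mu]_z ((f z)%:E * (V z + W z)) * (k * F n.-2 f))%E.
  rewrite [X in _ = (X * _)%E](eq_integral
    (fun z => (f z)%:E * V z + (f z)%:E * W z)%E); last first.
    by move=> z _; rewrite ge0_muleDr//; exact: V0.
  rewrite ge0_integralD//=; last 4 first.
  - by move=> z _; exact: mule_ge0.
  - exact: emeasurable_funM.
  - by move=> z _; exact: mule_ge0.
  - exact: emeasurable_funM.
  rewrite WE -/V -[2 * _ * _]mulrA EFinM -/k muleA [RHS]muleA; congr (_ * _)%E.
  rewrite -muleA muleC -muleA; rewrite [RHS]muleC; congr (_ * _)%E.
  rewrite (_ : (2%:E : \bar K) = 1 + 1)%E; last by rewrite -EFinD; congr EFin; ring.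
  by rewrite ge0_muleDr ?lee01// mule1.
rewrite muleA (muleC n%:R%:E) -muleA.
have mfE : measurable_fun [set: S] (fun z => (f z)%:E * excluded f z)%E.
  exact: emeasurable_funM.
rewrite -[X in (_ + X <= _)%E]ge0_integralZr//=; last 2 first.
- by move=> z _; exact: mule_ge0.
- by rewrite mule_ge0// lee_fin.
rewrite -[leLHS]ge0_integralD//=; last 4 first.
- by move=> z _; exact: integrand_ge0.
- exact: mintegrand.
- by move=> z _; rewrite !mule_ge0 ?lee_fin.
- exact: emeasurable_funM.
rewrite -[X in (_ <= X + _)%E]ge0_integralZr//=.
rewrite -[X in (_ <= _ + X)%E]ge0_integralZr//=; last by rewrite mule_ge0.
rewrite -[leRHS]ge0_integralD//=; last 4 first.
- by move=> z _; exact: mule_ge0.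
- exact: emeasurable_funM.
- move=> z _; apply: mule_ge0; first exact: fV0.
  by apply: mule_ge0; [exact: k0|exact: F0].
- exact: emeasurable_funM.
apply: ge0_le_integral => //=.
- move=> z _; apply: adde_ge0; first exact: integrand_ge0.
  apply: mule_ge0; first exact: mule_ge0.
  by apply: mule_ge0; [rewrite lee_fin|exact: F0].
- apply: emeasurable_funD; first exact: mintegrand.
  exact: emeasurable_funM.
- by apply: emeasurable_funD; exact: emeasurable_funM.
move=> z _.
rewrite -[X in (_ + X <= _)%E]muleA -[X in (_ <= _ + X)%E]muleA.
rewrite -ge0_muleDr; last 2 first.
- exact: conf_int_thin_ge0.
- apply: mule_ge0; first exact: E0.
  by apply: mule_ge0; [rewrite lee_fin|exact: F0].
rewrite -ge0_muleDr//; last first.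
  apply: mule_ge0; first by apply: adde_ge0; [exact: V0|exact: W0].
  by apply: mule_ge0; [exact: k0|exact: F0].
apply: lee_wpmul2l => //.
by have := key z; rewrite (muleCA n%:R%:E) (muleCA _ (_ + _)%E).
Qed.

(** Pascal's rule, arranged according to whether the first point carries f or g. *)
Let pascal n (A B : nat -> \bar K) : (forall k, 0 <= A k)%E -> (forall k, 0 <= B k)%E ->
  (\sum_(k < n.+1) 'C(n, k)%:R%:E * (A k.+1 * B (n - k)%N) +
   \sum_(k < n.+1) 'C(n, k)%:R%:E * (A k * B (n.+1 - k)%N) =
   \sum_(k < n.+2) 'C(n.+1, k)%:R%:E * (A k * B (n.+1 - k)%N))%E.
Proof.
move=> A0 B0; pose X k := (A k * B (n.+1 - k)%N)%E.
have X0 k : (0 <= X k)%E by exact: mule_ge0.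
rewrite [RHS]big_ord_recl/= -/(X 0%N) bin0.
have -> : (\sum_(i < n.+1) 'C(n.+1, bump 0 i)%:R%:E *
      (A (bump 0 i) * B (n.+1 - bump 0 i)%N) =
    \sum_(i < n.+1) 'C(n, i.+1)%:R%:E * X i.+1 +
    \sum_(i < n.+1) 'C(n, i)%:R%:E * (A i.+1 * B (n - i)%N))%E.
  rewrite -big_split/=; apply: eq_bigr => i _.
  rewrite /bump add1n binS natrD EFinD ge0_muleDl ?lee_fin//.
rewrite addeA addeC; congr (_ + _)%E.
transitivity (\sum_(i < n.+2) 'C(n, i)%:R%:E * X i)%E.
  by rewrite [RHS]big_ord_recr/= bin_small// mul0e adde0.
by rewrite big_ord_recl/= bin0.
Qed.

(** Each of the n points is labelled f or g. Interactions between the two groups are dropped, those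
    within a group are kept, and the binomial coefficient counts the labellings. *)
Lemma conf_int_binomial n f g : weight f -> weight g ->
  (F n (fun x => (f x + g x)%R) <=
   \sum_(k < n.+1) 'C(n, k)%:R%:E * (F k f * F (n - k)%N g))%E.
Proof.
have C0 m k : (0 <= 'C(m, k)%:R%:E :> \bar K)%E by rewrite lee_fin.
elim: n f g => [|n IH] f g wf wg; first by rewrite big_ord1 bin0 !mul1e.
have F0 m h : weight h -> (0 <= F m h)%E by move=> [_ h0]; exact: conf_int_ge0.
have wt z := weight_thin z wf; have wu z := weight_thin z wg.
rewrite -(@pascal n (fun k => F k f) (fun k => F k g))//; last 2 first.
- by move=> k; exact: F0.
- by move=> k; exact: F0.
have wfg := weightD wf wg.
rewrite [leLHS]/= integralD2//; [|exact: mthin|by move=> z; exact: conf_int_thin_ge0].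
apply: leeD.
  apply: (@le_trans _ _ (\int[mu]_z \sum_(k < n.+1)
      ('C(n, k)%:R%:E * F (n - k)%N g) * ((f z)%:E * F k (fun y => f y * c z y)%R))%E).
    apply: ge0_le_integral => //.
    - by move=> z _; exact: integrand_ge0.
    - exact: mintegrand.
    - by apply: emeasurable_sum => k; apply: emeasurable_funM => //; exact: mintegrand.
    move=> z _; rewrite thinD.
    apply: (@le_trans _ _ ((f z)%:E * \sum_(k < n.+1) 'C(n, k)%:R%:E *
       (F k (fun y => f y * c z y)%R * F (n - k)%N (fun y => g y * c z y)%R)))%E.
      by apply: lee_wpmul2l; [rewrite lee_fin weight_ge0|exact: IH].
    rewrite ge0_sume_distrr; last by move=> k _; rewrite !mule_ge0// F0.
    apply: lee_sum => k _.
    rewrite [leLHS]muleCA -[leRHS]muleA; apply: lee_wpmul2l => //.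
    rewrite [leRHS]muleC -[leRHS]muleA; apply: lee_wpmul2l.
      by rewrite lee_fin weight_ge0.
    by apply: lee_wpmul2l; [exact: F0|exact: conf_int_thin_le].
  rewrite ge0_integral_sum//=; last 2 first.
  - by move=> k; apply: emeasurable_funM => //; exact: mintegrand.
  - move=> k z _; apply: mule_ge0; first by rewrite mule_ge0// F0.
    exact: integrand_ge0.
  apply: lee_sum => k _; rewrite ge0_integralZl//=; last 3 first.
  - exact: mintegrand.
  - by move=> z _; exact: integrand_ge0.
  - by rewrite mule_ge0// F0.
  by rewrite -muleA; apply: lee_wpmul2l => //; rewrite muleC.
apply: (@le_trans _ _ (\int[mu]_z \sum_(k < n.+1)
    ('C(n, k)%:R%:E * F k f) * ((g z)%:E * F (n - k)%N (fun y => g y * c z y)%R))%E).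
  apply: ge0_le_integral => //.
  - by move=> z _; exact: integrand_ge0.
  - exact: mintegrand.
  - by apply: emeasurable_sum => k; apply: emeasurable_funM => //; exact: mintegrand.
  move=> z _; rewrite thinD.
  apply: (@le_trans _ _ ((g z)%:E * \sum_(k < n.+1) 'C(n, k)%:R%:E *
     (F k (fun y => f y * c z y)%R * F (n - k)%N (fun y => g y * c z y)%R)))%E.
    by apply: lee_wpmul2l; [rewrite lee_fin weight_ge0|exact: IH].
  rewrite ge0_sume_distrr; last by move=> k _; rewrite !mule_ge0// F0.
  apply: lee_sum => k _.
  rewrite [leLHS]muleCA -[leRHS]muleA; apply: lee_wpmul2l => //.
  rewrite [leRHS]muleCA; apply: lee_wpmul2l.
    by rewrite lee_fin weight_ge0.
  by apply: lee_wpmul2r; [exact: F0|exact: conf_int_thin_le].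
rewrite ge0_integral_sum//=; last 2 first.
- by move=> k; apply: emeasurable_funM => //; exact: mintegrand.
- move=> k z _; apply: mule_ge0; first by rewrite mule_ge0// F0.
  exact: integrand_ge0.
apply: lee_sum => k _; rewrite ge0_integralZl//=; last 3 first.
- exact: mintegrand.
- by move=> z _; exact: integrand_ge0.
- by rewrite mule_ge0// F0.
by rewrite -muleA (subSn (leq_ord k)).
Qed.

End configuration_integrals.

Section configuration_integrals_monotone.
Context {K : realType} {d : measure_display} {S : measurableType d}.
Variable mu : {sigma_finite_measure set S -> \bar K}.

(** The comparison of c with c' is asked only where f is positive, because the other points do not
    contribute. This allows the two models to be compared on a part of the cube. *)
Lemma le_conf_int c c' n f g : compatibility c -> compatibility c' ->
  weight f -> weight g ->
  (forall x, f x <= g x) -> (forall x y, 0 < f x -> 0 < f y -> c x y <= c' x y) ->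
  (conf_int mu c n f <= conf_int mu c' n g)%E.
Proof.
move=> cc cc'; elim: n f g => [|n IH] f g wf wg fg cc12 //=.
have [_ c01 _] := cc; have [_ c01' _] := cc'.
apply: ge0_le_integral => //.
- move=> z _; apply: mule_ge0; first by rewrite lee_fin weight_ge0.
  exact: conf_int_thin_ge0.
- by apply: emeasurable_funM; [apply: measurableT_comp => //; case: wf
     |exact: measurable_conf_int_thin].
- by apply: emeasurable_funM; [apply: measurableT_comp => //; case: wg
     |exact: measurable_conf_int_thin].
move=> z _.
have := weight_ge0 z wf; rewrite le_eqVlt => /predU1P[<-|fz0].
  rewrite mul0e; apply: mule_ge0; first by rewrite lee_fin weight_ge0.
  exact: conf_int_thin_ge0.
apply: lee_pmul => //.
- by rewrite lee_fin ltW.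
- exact: conf_int_thin_ge0.
- by rewrite lee_fin.
apply: IH.
- exact: weight_thin.
- exact: weight_thin.
- move=> x; have := weight_ge0 x wf; rewrite le_eqVlt => /predU1P[<-|fx0].
    by rewrite mul0r; apply: mulr_ge0; [exact: weight_ge0|case/andP: (c01' z x)].
  apply: ler_pM => //; [exact: ltW|by case/andP: (c01 z x)|exact: cc12].
- move=> x y fx fy; apply: cc12.
    case/andP: (c01 z x) => c0 _; move: fx.
    by have := weight_ge0 x wf; rewrite le_eqVlt => /predU1P[<-|//]; rewrite mul0r ltxx.
  case/andP: (c01 z y) => c0 _; move: fy.
  by have := weight_ge0 y wf; rewrite le_eqVlt => /predU1P[<-|//]; rewrite mul0r ltxx.
Qed.

End configuration_integrals_monotone.

(** * Integration of differential inequalities *)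

Section differential_comparison.
Context {K : realType}.
Implicit Types (f df : K -> K) (A B C t : K).

Let cubic (A B C t : K) := A * t + B * t ^+ 2 + C * t ^+ 3.

Let is_derive_cubic A B C t :
  is_derive t (1 : K) (cubic A B C) (A + 2 * B * t + 3 * C * t ^+ 2).
Proof.
rewrite /cubic; apply: is_derive_eq.
rewrite /GRing.scale /=; ring.
Qed.

Let is_derive_damped A B C f df t : is_derive t (1 : K) f (df t) ->
  is_derive t (1 : K) (fun t => f t * expR (- cubic A B C t))
    ((df t - (A + 2 * B * t + 3 * C * t ^+ 2) * f t) * expR (- cubic A B C t)).
Proof.
move=> d1.
have d2 := is_derive_cubic A B C t.
apply: is_derive_eq.
rewrite /GRing.scale /=; ring.
Qed.

(** Gronwall: f(t) exp(- (A t + B t^2 + C t^3)) is nondecreasing on [0, 1], the polynomial being the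
    primitive of the given rate. *)
Lemma comparison_lower A B C f df : (forall t, is_derive t (1 : K) f (df t)) ->
  (forall t, 0 < t < 1 -> (A + 2 * B * t + 3 * C * t ^+ 2) * f t <= df t) ->
  f 0 * expR (A + B + C) <= f 1.
Proof.
move=> fdf h.
have D t := is_derive_damped A B C (fdf t).
have mono : {in `[0, 1] &, {homo (fun t => f t * expR (- cubic A B C t)) : x y / x <= y}}.
  apply: ger0_derive1_le_cc.
  - by move=> x _; exact: ex_derive.
  - move=> x; rewrite in_itv/= => /h hx.
    by rewrite derive1E derive_val mulr_ge0// ?expR_ge0// subr_ge0.
  - apply: continuous_subspaceT => x.
    by apply/differentiable_continuous/derivable1_diffP; exact: ex_derive.
have := mono 0 1; rewrite !in_itv/= !lexx !ler01 => /(_ isT isT isT).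
rewrite /cubic !mulr0 !expr0n/= !mulr0 !addr0 oppr0 expR0 mulr1 !expr1n !mulr1.
by rewrite expRN ler_pdivlMr// expR_gt0.
Qed.

Lemma comparison_upper A B C f df : (forall t, is_derive t (1 : K) f (df t)) ->
  (forall t, 0 < t < 1 -> df t <= (A + 2 * B * t + 3 * C * t ^+ 2) * f t) ->
  f 1 <= f 0 * expR (A + B + C).
Proof.
move=> fdf h; rewrite -lerN2 -mulNr.
apply: (@comparison_lower _ _ _ (fun t => - f t) (fun t => - df t)) => t.
by move=> /h; rewrite mulrN lerN2.
Qed.

End differential_comparison.

(** Coefficients of t times a power series; the 0 stands for the missing coefficient of index -1. *)
Definition delay {K : realType} (b : nat -> K) n := if n is m.+1 then b m else 0.

(** * Partition functions *)

Section exponential_generating_function.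
Context {K : realType}.
Variables (a : nat -> K) (I : K).
Hypotheses (a_ge0 : forall n, 0 <= a n) (a0 : a 0 = 1).
Hypothesis a_le : forall n, a n <= I ^+ n / n`!%:R.

Let cvg_dominated (b : nat -> K) (C J x : K) :
  (forall n, `|b n| <= C * (J ^+ n / n`!%:R)) -> cvgn (pseries b x).
Proof.
move=> bC; apply: normed_cvg.
apply: (@series_le_cvg _ _ (fun n => C * exp_coeff (J * `|x|) n)).
- by move=> n; exact: normr_ge0.
- move=> n; rewrite /exp_coeff /= exprMn mulrAC mulrA mulr_ge0 ?exprn_ge0//.
  exact: (le_trans (normr_ge0 _) (bC n)).
- move=> n; rewrite /exp_coeff /= exprMn normrM normrX mulrAC mulrA.
  by rewrite ler_wpM2r ?exprn_ge0// -mulrA.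
- rewrite (_ : series _ = C \*: series (exp_coeff (J * `|x|))).
    by apply: is_cvgZr; exact: is_cvg_series_exp_coeff.
  by apply/funext => n; rewrite /series /= scaler_sumr.
Qed.

Let G t := limn (pseries a t).

Let abs_a n : `|a n| <= 1 * (I ^+ n / n`!%:R). 
Proof. by rewrite mul1r ger0_norm. Qed.

Let abs_da n : `|pseries_diffs a n| <= I * (I ^+ n / n`!%:R). 
Proof.
rewrite /pseries_diffs ger0_norm ?mulr_ge0// mulrA -exprS.
apply: le_trans (ler_wpM2l (ler0n _ _) (a_le n.+1)) _.
have n3 : n`!%:R != 0 :> K by rewrite pnatr_eq0 -lt0n fact_gt0.
rewrite factS natrM le_eqVlt; apply/orP; left; apply/eqP; field.
by rewrite ?n3 ?nat1r ?pnatr_eq0.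
Qed.

Let abs_dda n : `|pseries_diffs (pseries_diffs a) n| <= I ^+ 2 * (I ^+ n / n`!%:R). 
Proof.
rewrite /pseries_diffs ger0_norm ?mulr_ge0//.
apply: le_trans (ler_wpM2l (ler0n _ _) (ler_wpM2l (ler0n _ _) (a_le n.+2))) _.
rewrite !factS !natrM !(exprS _ n.+1) !(exprS _ n).
have n3 : n`!%:R != 0 :> K by rewrite pnatr_eq0 -lt0n fact_gt0.
by rewrite le_eqVlt; apply/orP; left; apply/eqP; field;
  rewrite ?n3 ?nat1r -?natrD ?pnatr_eq0.
Qed.

Let cvg_a t : cvgn (pseries a t). Proof. exact: cvg_dominated abs_a. Qed.

Let cvg_da t : cvgn (pseries (pseries_diffs a) t). Proof. exact: cvg_dominated abs_da. Qed.

Let is_derive_G t : is_derive t (1 : K) G (limn (pseries (pseries_diffs a) t)).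
Proof.
apply: (@pseries_snd_diffs _ _ (`|t| + 1)); [exact: cvg_a|exact: cvg_da|..].
  exact: cvg_dominated abs_dda.
by rewrite [ltRHS]ger0_norm ?addr_ge0// ltrDl.
Qed.

Let lim_delay (b : nat -> K) t : cvgn (pseries b t) ->
  pseries (delay b) t @ \oo --> t * limn (pseries b t).
Proof.
move=> cb; rewrite -cvg_shiftS /=.
rewrite (_ : (fun n => _) = (fun n => t * pseries b t n)).
  by apply: cvgZr.
apply/funext => n; rewrite /pseries /series /= big_nat_recl//= mul0r add0r.
by rewrite mulr_sumr; apply: eq_bigr => i _; rewrite exprS mulrCA.
Qed.

Let G0 : G 0 = 1.
Proof.
apply/cvg_lim => //; rewrite -cvg_shiftS /=.
rewrite (_ : (fun n => _) = cst 1); first exact: cvg_cst.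
apply/funext => n; rewrite /pseries /series /= big_nat_recl//= expr0 mulr1 a0.
by rewrite big1 ?addr0// => i _; rewrite expr0n mulr0.
Qed.

Let cvgD (b b' : nat -> K) u v t : pseries b t @ \oo --> u -> pseries b' t @ \oo --> v ->
  pseries (fun n => b n + b' n) t @ \oo --> u + v.
Proof.
move=> bu bv; rewrite (_ : pseries _ t = pseries b t \+ pseries b' t).
  exact: cvgD.
apply/funext => n; rewrite /pseries /series /= -big_split/=.
by apply: eq_bigr => i _; rewrite mulrDl.
Qed.

Let cvgZ (b : nat -> K) k u t : pseries b t @ \oo --> u ->
  pseries (fun n => k * b n) t @ \oo --> k * u.
Proof.
move=> bu; rewrite (_ : pseries _ t = k \*: pseries b t); first exact: cvgZr.
apply/funext => n; rewrite /pseries /series /= scaler_sumr.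
by apply: eq_bigr => i _; rewrite -mulrA.
Qed.

Let le_lim (b b' : nat -> K) u v t : 0 < t -> (forall n, b n <= b' n) ->
  pseries b t @ \oo --> u -> pseries b' t @ \oo --> v -> u <= v.
Proof.
move=> t0 bb' bu bv.
rewrite -(cvg_lim _ bu)// -(cvg_lim _ bv)//; apply: ler_lim.
- by apply/cvg_ex; exists u.
- by apply/cvg_ex; exists v.
apply: nearW => n; apply: ler_sum => i _.
by rewrite ler_wpM2r// exprn_ge0// ltW.
Qed.

(** Multiplied by t^n and summed, the recursion reads G' + q t G >= I G for the generating function
    G, and the rate I - q t integrates to I - q/2 over [0, 1]. The bound [a_le] gives convergence
    everywhere, hence term by term differentiation. *)
Lemma egf_lower q :
  (forall n, I * a n <= n.+1%:R * a n.+1 + q * delay a n) ->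
  expR (I - q / 2) <= limn (series a).
Proof.
move=> rec; have := @comparison_lower _ I (- (q / 2)) 0 G _ is_derive_G.
rewrite G0 mul1r addr0 (_ : G 1 = limn (series a)); last first.
  congr (limn _); apply/funext => n; apply: eq_bigr => i _.
  by rewrite /= expr1n mulr1.
apply => t /andP[t0 t1].
have A := cvgZ (k := I) (@cvg_a t).
have B := cvgD (@cvg_da t) (cvgZ (k := q) (lim_delay (@cvg_a t))).
have := le_lim t0 _ A B; rewrite -/(G t) => /(_ rec); lra.
Qed.

(** Same argument with the rate I - q t + q2 t^2, the double shift accounting for t^2. *)
Lemma egf_upper q q2 :
  (forall n, n.+1%:R * a n.+1 + q * delay a n <= I * a n + q2 * delay (delay a) n) ->
  limn (series a) <= expR (I - q / 2 + q2 / 3).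
Proof.
move=> rec; have := @comparison_upper _ I (- (q / 2)) (q2 / 3) G _ is_derive_G.
rewrite G0 mul1r (_ : G 1 = limn (series a)); last first.
  congr (limn _); apply/funext => n; apply: eq_bigr => i _.
  by rewrite /= expr1n mulr1.
apply => t /andP[t0 t1].
have S1 := lim_delay (@cvg_a t).
have c1 : cvgn (pseries (delay a) t) by apply/cvg_ex; exists (t * G t).
have S2 := lim_delay c1; rewrite (cvg_lim _ S1)// in S2.
have A := cvgD (cvgZ (k := I) (@cvg_a t)) (cvgZ (k := q2) S2).
have B := cvgD (@cvg_da t) (cvgZ (k := q) S1).
have := le_lim t0 _ B A; rewrite -/(G t) => /(_ rec); lra.
Qed.

End exponential_generating_function.

(** Division by n! absorbs the factors n and n (n - 1) into shifts. For n = 0 and 1 these factors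
    vanish, so the truncated predecessors agree with the zeros of [delay]; hence the case split. *)
Lemma rec_rescale (K : realType) (x : nat -> K) (I q q2 : K) n :
  let a k := x k / k`!%:R in
  (n.+1%:R * a n.+1 + q * delay a n) * n`!%:R = x n.+1 + n%:R * (q * x n.-1) /\
  (I * a n + 2 * q2 * delay (delay a) n) * n`!%:R =
    I * x n + 2 * n%:R * n.-1%:R * (q2 * x n.-2).
Proof.
have f1 k : k.+1`!%:R = k.+1%:R * k`!%:R :> K by rewrite factS natrM.
case: n => [|[|n]] /=; rewrite ?f1 ?fact0.
- by split; field.
- by split; field.
have n2 : n`!%:R != 0 :> K by rewrite pnatr_eq0 -lt0n fact_gt0.
by split; field; rewrite n2 -?natrD ?nat1r ?pnatr_eq0.
Qed.

Section partition_function.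
Context {K : realType} {d : measure_display} {S : measurableType d}.
Variable mu : {sigma_finite_measure set S -> \bar K}.
Implicit Types (c : S -> S -> K) (f g : S -> K).

Definition mass f : K := fine (\int[mu]_z (f z)%:E).

Definition finite_weight f := weight f /\ (\int[mu]_z (f z)%:E < +oo)%E.

Definition partition_function c f : K :=
  limn (series (fun n => fine (conf_int mu c n f) / n`!%:R)).

Lemma massE f : finite_weight f -> (\int[mu]_z (f z)%:E)%E = (mass f)%:E.
Proof.
move=> [wf If]; rewrite /mass fineK// ge0_fin_numE//.
by apply: integral_ge0 => z _; rewrite lee_fin weight_ge0.
Qed.

Lemma mass_ge0 f : weight f -> 0 <= mass f.
Proof.
by move=> wf; apply: fine_ge0; apply: integral_ge0 => z _; rewrite lee_fin weight_ge0.
Qed.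

Lemma finite_weight_le f g : weight f -> finite_weight g -> (forall x, f x <= g x) ->
  finite_weight f.
Proof.
move=> wf [wg Ig] fg; split => //; apply: le_lt_trans Ig.
apply: ge0_le_integral => //.
- by move=> z _; rewrite lee_fin weight_ge0.
- by apply: measurableT_comp => //; case: wf.
- by apply: measurableT_comp => //; case: wg.
- by move=> z _; rewrite lee_fin.
Qed.

Lemma finite_weightD f g : finite_weight f -> finite_weight g ->
  finite_weight (fun x => f x + g x).
Proof.
move=> [wf If] [wg Ig]; split; first exact: weightD.
under eq_integral do rewrite EFinD.
rewrite ge0_integralD//=; first exact: lte_add_pinfty.
- by move=> z _; rewrite lee_fin weight_ge0.
- by apply: measurableT_comp => //; case: wf.
- by move=> z _; rewrite lee_fin weight_ge0.
- by apply: measurableT_comp => //; case: wg.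
Qed.

Lemma finite_weightZ (k : K) f : 0 <= k -> finite_weight f ->
  finite_weight (fun x => k * f x).
Proof.
move=> k0 [wf If]; split; first exact: weightZ.
under eq_integral do rewrite EFinM.
rewrite ge0_integralZl//=; first by rewrite lte_mul_pinfty.
- by apply: measurableT_comp => //; case: wf.
- by move=> z _; rewrite lee_fin weight_ge0.
Qed.

Lemma massZ (k : K) f : 0 <= k -> finite_weight f -> mass (fun x => k * f x) = k * mass f.
Proof.
move=> k0 ff; have [wf If] := ff.
apply: EFin_inj; rewrite -massE; last exact: finite_weightZ.
rewrite EFinM -massE//; under eq_integral do rewrite EFinM.
rewrite ge0_integralZl//=.
- by apply: measurableT_comp => //; case: wf.
- by move=> z _; rewrite lee_fin weight_ge0.
Qed.

Section fixed_compatibility.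
Variable c : S -> S -> K.
Hypothesis cc : compatibility c.

Local Notation F := (conf_int mu c).
Local Notation a := (fun f n => fine (F n f) / n`!%:R : K).
Local Notation Z := (partition_function c).

Let F_ge0 n f : finite_weight f -> (0 <= F n f)%E.
Proof. by move=> [[mf f0] _]; exact: conf_int_ge0. Qed.

Let F_fin n f : finite_weight f -> F n f \is a fin_num.
Proof.
move=> ff; rewrite ge0_fin_numE ?F_ge0//; have [wf _] := ff.
apply: le_lt_trans (conf_int_le_exp mu cc n wf) _.
by rewrite massE// -EFin_expe ltry.
Qed.

Let F_le n f : finite_weight f -> fine (F n f) <= mass f ^+ n.
Proof.
move=> ff; have [wf _] := ff.
by rewrite -lee_fin fineK ?F_fin// EFin_expe -massE//; exact: conf_int_le_exp.
Qed.

Let a_ge0 f : finite_weight f -> forall n, 0 <= a f n.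
Proof. by move=> ff n; rewrite mulr_ge0// fine_ge0// F_ge0. Qed.

Let a_0 f : a f 0 = 1. Proof. by rewrite /= divr1. Qed.

Let a_le f : finite_weight f -> forall n, a f n <= mass f ^+ n / n`!%:R.
Proof. by move=> ff n; rewrite ler_wpM2r// F_le. Qed.

Let cvg_Z f : finite_weight f -> cvgn (series (a f)).
Proof.
move=> ff; apply: (@series_le_cvg _ _ (exp_coeff (mass f))).
- exact: a_ge0.
- by move=> n; apply: le_trans (a_ge0 ff n) (a_le ff n).
- exact: a_le.
- exact: is_cvg_series_exp_coeff.
Qed.

Let partial_le f n : finite_weight f -> series (a f) n <= Z f.
Proof.
move=> ff; apply: nondecreasing_cvgn_le; last exact: cvg_Z.
apply/nondecreasing_seqP => k; rewrite /series /= big_nat_recr//= lerDl.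
exact: a_ge0.
Qed.

Lemma partition_function_ge1 f : finite_weight f -> 1 <= Z f.
Proof.
by move=> ff; rewrite -(a_0 f); have := partial_le 1 ff; rewrite /series /= big_nat1.
Qed.

Lemma partition_function_cvg f : finite_weight f ->
  series (fun n => fine (conf_int mu c n f) / n`!%:R) @ \oo --> Z f.
Proof. exact: cvg_Z. Qed.

Lemma partition_function_le_exp f : finite_weight f -> Z f <= expR (mass f).
Proof.
move=> ff; apply: ler_lim; [exact: cvg_Z|exact: is_cvg_series_exp_coeff|].
by apply: nearW => n; apply: ler_sum => i _; exact: a_le.
Qed.

(** By the binomial inequality, the coefficients are at most those of the Cauchy product of the two
    series. They are nonnegative, so partial sums can be compared. *)
Lemma partition_functionD f g : finite_weight f -> finite_weight g ->
  Z (fun x => f x + g x) <= Z f * Z g.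
Proof.
move=> ff fg; have ffg := finite_weightD ff fg.
have [wf _] := ff; have [wg _] := fg.
apply: limr_le; first exact: cvg_Z.
apply: nearW => n.
apply: (@le_trans _ _ (\sum_(0 <= k < n) \sum_(0 <= l < n) a f k * a g l)); last first.
  rewrite (_ : \sum_(0 <= k < n) _ = series (a f) n * series (a g) n).
    by rewrite ler_pM ?partial_le ?sumr_ge0// => k _; exact: a_ge0.
  rewrite /series /= mulr_suml; apply: eq_bigr => k _.
  by rewrite mulr_sumr.
apply: (@le_trans _ _ (\sum_(0 <= m < n) \sum_(k < m.+1) a f k * a g (m - k)%N)).
  apply: ler_sum => m _.
  rewrite ler_pdivrMr ?ltr0n ?fact_gt0//.
  rewrite -lee_fin fineK; last exact: F_fin.
  apply: le_trans (conf_int_binomial mu cc m wf wg) _.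
  rewrite mulr_suml -sumEFin; apply: lee_sum => k _.
  rewrite -[conf_int mu c k f]fineK ?F_fin// -[conf_int mu c (m - k) g]fineK ?F_fin//.
  rewrite -!EFinM lee_fin.
  have km : (k <= m)%N by rewrite -ltnS.
  rewrite -(bin_fact km) !natrM.
  have n1 : k`!%:R != 0 :> K by rewrite pnatr_eq0 -lt0n fact_gt0.
  have n2 : (m - k)`!%:R != 0 :> K by rewrite pnatr_eq0 -lt0n fact_gt0.
  by rewrite le_eqVlt; apply/orP; left; apply/eqP; field; rewrite n1 n2.
(* The triangle k + l < n is summed row by row; extending each row to l < n then completes the
   square. *)
have -> : \sum_(0 <= m < n) \sum_(k < m.+1) a f k * a g (m - k)%N =
    \sum_(k < n) a f k * series (a g) (n - k)%N.
  elim: n => [|n IH]; first by rewrite big_nil big_ord0.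
  rewrite big_nat_recr//= IH !big_ord_recr/= subnn addrA; congr (_ + _).
    rewrite -big_split/=; apply: eq_bigr => k _.
    by rewrite -mulrDr (subSn (ltnW (ltn_ord k))) /series /= big_nat_recr.
  by rewrite subSnn /series /= big_nat1.
rewrite big_mkord; apply: ler_sum => k _; rewrite -mulr_sumr.
rewrite ler_wpM2l ?a_ge0// /series /=.
rewrite [leRHS](big_cat_nat _ (leq_subr k n))//= lerDl.
by apply: sumr_ge0 => l _; exact: a_ge0.
Qed.

Let excluded_le_mass f z : finite_weight f -> (excluded mu c f z <= (mass f)%:E)%E.
Proof. by move=> ff; rewrite -massE//; apply: excluded_le => //; case: ff. Qed.

Let excluded_pair_fin f : finite_weight f ->
  (\int[mu]_z ((f z)%:E * excluded mu c f z))%E \is a fin_num.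
Proof.
move=> ff; have [wf If] := ff.
have E0 z := excluded_ge0 mu cc z wf.
have f0 z : (0 <= (f z)%:E)%E by rewrite lee_fin weight_ge0.
have mf : measurable_fun [set: S] (fun z => (f z)%:E).
  by apply: measurableT_comp => //; case: wf.
rewrite ge0_fin_numE; last by apply: integral_ge0 => z _; exact: mule_ge0.
apply: (@le_lt_trans _ _ (\int[mu]_z ((f z)%:E * (mass f)%:E))%E).
  apply: ge0_le_integral => //.
  - by move=> z _; exact: mule_ge0.
  - by apply: emeasurable_funM => //; exact: measurable_excluded.
  - by apply: emeasurable_funM.
  - by move=> z _; apply: lee_wpmul2l => //; exact: excluded_le_mass.
rewrite ge0_integralZr//=; last by rewrite lee_fin mass_ge0.
by rewrite massE// -EFinM ltry.
Qed.

Let excluded_triple_fin f : finite_weight f ->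
  (\int[mu]_z ((f z)%:E * (excluded mu c f z * excluded mu c f z)))%E \is a fin_num.
Proof.
move=> ff; have [wf If] := ff.
have E0 z := excluded_ge0 mu cc z wf.
have f0 z : (0 <= (f z)%:E)%E by rewrite lee_fin weight_ge0.
have mf : measurable_fun [set: S] (fun z => (f z)%:E).
  by apply: measurableT_comp => //; case: wf.
have mE := measurable_excluded mu cc wf.
rewrite ge0_fin_numE; last first.
  by apply: integral_ge0 => z _; apply: mule_ge0 => //; exact: mule_ge0.
apply: (@le_lt_trans _ _ (\int[mu]_z ((f z)%:E * ((mass f)%:E * (mass f)%:E)))%E).
  apply: ge0_le_integral => //.
  - by move=> z _; apply: mule_ge0 => //; exact: mule_ge0.
  - by apply: emeasurable_funM => //; exact: emeasurable_funM.
  - by apply: emeasurable_funM.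
  - move=> z _; apply: lee_wpmul2l => //.
    by apply: lee_pmul => //; exact: excluded_le_mass.
rewrite ge0_integralZr//=; last by rewrite mule_ge0// lee_fin mass_ge0.
by rewrite massE// -!EFinM ltry.
Qed.

Lemma partition_function_lower f : finite_weight f ->
  expR (mass f - fine (\int[mu]_z ((f z)%:E * excluded mu c f z)) / 2) <= Z f.
Proof.
move=> ff; have [wf If] := ff.
have A := egf_lower (a_ge0 ff) (a_0 f) (a_le ff).
rewrite /partition_function; apply: A => n.
have := conf_int_rec_lower mu cc n wf.
rewrite massE// -(fineK (excluded_pair_fin ff)); set q := fine _.
rewrite -(fineK (F_fin n ff)) -(fineK (F_fin n.+1 ff)) -(fineK (F_fin n.-1 ff)).
rewrite -!EFinM -EFinD lee_fin => h.
rewrite mulrA ler_pdivrMr ?ltr0n ?fact_gt0//; apply: (le_trans h).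
rewrite le_eqVlt; apply/orP; left; apply/eqP.
have n1 : n`!%:R != 0 :> K by rewrite pnatr_eq0 -lt0n fact_gt0.
case: n h n1 => [|n] h n1 /=.
  by rewrite mul0r mulr0 !addr0 !mulr1 mul1r divr1.
have n2 : n`!%:R != 0 :> K by rewrite pnatr_eq0 -lt0n fact_gt0.
rewrite !factS !natrM; field.
by rewrite n2 -?natrD ?nat1r ?pnatr_eq0.
Qed.

Lemma partition_function_upper f : finite_weight f ->
  Z f <= expR (mass f - fine (\int[mu]_z ((f z)%:E * excluded mu c f z)) / 2
    + 2 * fine (\int[mu]_z ((f z)%:E * (excluded mu c f z * excluded mu c f z))) / 3).
Proof.
move=> ff; have [wf If] := ff.
have A := egf_upper (a_ge0 ff) (a_0 f) (a_le ff).
rewrite /partition_function; apply: A => n.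
have := conf_int_rec_upper mu cc n wf.
rewrite massE// -(fineK (excluded_pair_fin ff)) -(fineK (excluded_triple_fin ff)).
set q := fine (\int[_]__ (_ * excluded _ _ _ _)); set q2 := fine _.
rewrite -(fineK (F_fin n ff)) -(fineK (F_fin n.+1 ff)) -(fineK (F_fin n.-1 ff)).
rewrite -(fineK (F_fin n.-2 ff)).
rewrite -!EFinM -!EFinD lee_fin => h.
have n1 : 0 < n`!%:R :> K by rewrite ltr0n fact_gt0.
rewrite -(ler_pM2r n1).
have [-> ->] := rec_rescale (fun k => fine (F k f)) (mass f) q q2 n.
exact: h.
Qed.

End fixed_compatibility.

Lemma le_partition_function c c' f g : compatibility c -> compatibility c' ->
  finite_weight f -> finite_weight g -> (forall x, f x <= g x) ->
  (forall x y, 0 < f x -> 0 < f y -> c x y <= c' x y) ->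
  partition_function c f <= partition_function c' g.
Proof.
move=> cc cc' ff fg fg' cc12.
have [wf _] := ff; have [wg _] := fg.
apply: ler_lim.
- by have /cvgP := partition_function_cvg cc ff.
- by have /cvgP := partition_function_cvg cc' fg.
apply: nearW => n; apply: ler_sum => i _; rewrite ler_wpM2r//.
have h : forall c f, compatibility c -> finite_weight f -> conf_int mu c i f \is a fin_num.
  move=> {fg' cc12 wf}c {}f {}cc {}ff; have [wf _] := ff.
  rewrite ge0_fin_numE; last by apply: conf_int_ge0 => // x; exact: weight_ge0.
  apply: (le_lt_trans (conf_int_le_exp mu cc i wf)).
  by rewrite massE// -EFin_expe ltry.
by rewrite -lee_fin !fineK ?h//; exact: le_conf_int.
Qed.

(** The part (1 - t) f is split off, and its points are then treated as free. *)
Lemma partition_function_thin c f (t : K) : compatibility c -> finite_weight f ->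
  0 <= t <= 1 ->
  partition_function c f <= partition_function c (fun x => t * f x) *
    expR ((1 - t) * mass f).
Proof.
move=> cc ff /andP[t0 t1].
have t1' : 0 <= 1 - t by rewrite subr_ge0.
have -> : f = (fun x => t * f x + (1 - t) * f x) by apply/funext => x; ring.
have -> : (fun x => t * (t * f x + (1 - t) * f x)) = (fun x => t * f x).
  by apply/funext => x; ring.
have -> : mass (fun x => t * f x + (1 - t) * f x) = mass f.
  by congr mass; apply/funext => x; ring.
apply: le_trans (partition_functionD cc (finite_weightZ t0 ff) (finite_weightZ t1' ff)) _.
apply: ler_wpM2l.
  by apply: (le_trans ler01); apply: partition_function_ge1 => //; exact: finite_weightZ.
rewrite -massZ//; apply: partition_function_le_exp => //; exact: finite_weightZ.
Qed.

End partition_function.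

Lemma le_expe {K : realType} (x y : \bar K) n : (0 <= x)%E -> (x <= y)%E ->
  (x ^+ n <= y ^+ n)%E.
Proof.
move=> x0 xy; elim: n => [//|n IH]; rewrite !expeS.
by apply: lee_pmul => //; exact: expe_ge0.
Qed.

(** * Packing bound on partition functions *)

Section packing.
Context {K : realType} {d : measure_display} {S : measurableType d}.
Context {d' : measure_display} {Y : measurableType d'}.
Variables (mu : {sigma_finite_measure set S -> \bar K}) (m : {measure set Y -> \bar K}).
Variables (c : S -> S -> K) (b : S -> set Y).
Hypothesis cc : compatibility c.
Hypothesis mb : forall x, measurable (b x).
Hypothesis mmb : measurable_fun [set: S] (fun x => fine (m (b x))).
Hypothesis cb : forall x y, 0 < c x y -> b x `&` b y = set0.

(* Each point spends [m (b x)] of the remaining volume [m U]; the factor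
   [expR (th * _)] is the exponential Markov bound for this budget. *)
Lemma conf_int_packing n (th : K) (U : set Y) f : 0 <= th -> weight f ->
  measurable U -> (m U < +oo)%E -> (forall x, 0 < f x -> b x `<=` U) ->
  (conf_int mu c n f <= (expR (th * fine (m U)))%:E *
     (\int[mu]_x (f x * expR (- (th * fine (m (b x)))))%:E) ^+ n)%E.
Proof.
move=> th0; elim: n U f => [|n IH] U f wf mU Uoo fU.
  by rewrite mule1 lee_fin -expR0 ler_expR mulr_ge0// fine_ge0.
have [_ c01 _] := cc.
pose e x := expR (- (th * fine (m (b x)))).
have wfe g : weight g -> weight (fun x => g x * e x).
  move=> [mg g0]; split => [|x]; last by rewrite mulr_ge0// expR_ge0.
  apply: measurable_funM => //; apply: measurableT_comp => //.
  by apply: measurableT_comp => //; exact: measurable_funM.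
have mf g : weight g -> measurable_fun [set: S] (fun x => (g x)%:E).
  by move=> [mg _]; exact: measurableT_comp.
set J := (\int[mu]_x _)%E.
have J0 : (0 <= J)%E.
  by apply: integral_ge0 => x _; rewrite lee_fin (weight_ge0 _ (wfe _ wf)).
have wt z := weight_thin cc z wf.
rewrite expeS muleCA [leLHS]/= -ge0_integralZr//=; last 3 first.
- exact: mf (wfe _ wf).
- by move=> x _; rewrite lee_fin (weight_ge0 _ (wfe _ wf)).
- by rewrite mule_ge0 ?expe_ge0// lee_fin expR_ge0.
apply: ge0_le_integral => //.
- move=> z _; apply: mule_ge0; first by rewrite lee_fin weight_ge0.
  exact: conf_int_thin_ge0.
- by apply: emeasurable_funM; [exact: mf|exact: measurable_conf_int_thin].
- by apply: emeasurable_funM => //; exact: mf (wfe _ wf).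
move=> z _.
have := weight_ge0 z wf; rewrite le_eqVlt => /predU1P[<-|fz0].
  by rewrite mul0r !mul0e.
have bU := fU z fz0.
have mUb : measurable (U `\` b z) by exact: measurableD.
have boo : (m (b z) < +oo)%E.
  by apply: le_lt_trans Uoo; apply: le_measure => //; rewrite inE.
have Uboo : (m (U `\` b z) < +oo)%E.
  by apply: le_lt_trans Uoo; apply: le_measure => //; rewrite ?inE//; exact: subDsetl.
have := IH (U `\` b z) (fun y => f y * c z y) (wt z) mUb Uboo.
(* A point compatible with z has a body disjoint from [b z], so the remaining bodies have to fit in
   what is left of U. *)
have hs : forall x, 0 < f x * c z x -> b x `<=` U `\` b z.
  move=> x fc; have fx0 : 0 < f x.
    have := weight_ge0 x wf; rewrite le_eqVlt => /predU1P[h|//].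
    by move: fc; rewrite -h mul0r ltxx.
  have cx0 : 0 < c z x by move: fc; rewrite pmulr_rgt0.
  move=> y bxy; split; first exact: fU fx0 y bxy.
  by move=> bzy; have := cb cx0; rewrite -subset0 => /(_ y); apply.
move=> /(_ hs) h.
rewrite EFinM -muleA; apply: lee_wpmul2l; first by rewrite lee_fin ltW.
apply: (le_trans h).
have -> : fine (m (U `\` b z)) = fine (m U) - fine (m (b z)).
  rewrite measureD// setIidr// fineB//; rewrite ge0_fin_numE//.
rewrite mulrBr expRD EFinM muleA; rewrite (muleC (e z)%:E _) -!muleA.
apply: lee_wpmul2l; first by rewrite lee_fin expR_ge0.
apply: lee_wpmul2l; first by rewrite lee_fin expR_ge0.
apply: le_expe.
  by apply: integral_ge0 => x _; rewrite lee_fin (weight_ge0 _ (wfe _ (wt z))).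
apply: ge0_le_integral => //.
- by move=> x _; rewrite lee_fin (weight_ge0 _ (wfe _ (wt z))).
- exact: mf (wfe _ (wt z)).
- exact: mf (wfe _ wf).
- move=> x _; rewrite lee_fin ler_wpM2r ?expR_ge0// ler_piMr ?weight_ge0//.
  by case/andP: (c01 z x).
Qed.

(** The previous bounds, divided by n!, are the terms of an exponential series. *)
Lemma partition_function_packing (th : K) (U : set Y) f : 0 <= th ->
  finite_weight mu f -> measurable U -> (m U < +oo)%E ->
  (forall x, 0 < f x -> b x `<=` U) ->
  partition_function mu c f <= expR (th * fine (m U) +
    mass mu (fun x => f x * expR (- (th * fine (m (b x)))))).
Proof.
move=> th0 ff mU Uoo fU; have [wf _] := ff.
pose g x := f x * expR (- (th * fine (m (b x)))).
have wg : weight g.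
  have [mf f0] := wf; split => [|x]; last by rewrite mulr_ge0// expR_ge0.
  apply: measurable_funM => //; apply: measurableT_comp => //.
  by apply: measurableT_comp => //; exact: measurable_funM.
have fg : finite_weight mu g.
  apply: (finite_weight_le wg ff) => x; rewrite ler_piMr ?weight_ge0//.
  by rewrite expR_le1 oppr_le0 mulr_ge0// fine_ge0.
have Z0 := partition_function_cvg cc ff.
have E0 := is_cvg_series_exp_coeff (mass mu g).
rewrite expRD -/g.
have C : expR (th * fine (m U)) *: series (exp_coeff (mass mu g)) n @[n --> \oo] -->
    expR (th * fine (m U)) * expR (mass mu g).
  exact: cvgZr.
apply: (ler_cvg_to Z0 C); apply: nearW => n.
rewrite /series /= scaler_sumr; apply: ler_sum => k _.
rewrite /exp_coeff /= scalerAl; rewrite ler_wpM2r//.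
rewrite -lee_fin fineK; last first.
  rewrite ge0_fin_numE; last by apply: conf_int_ge0 => // x; exact: weight_ge0.
  apply: (le_lt_trans (conf_int_le_exp mu cc k wf)).
  by rewrite (massE ff) -EFin_expe ltry.
apply: (le_trans (conf_int_packing k th0 wf mU Uoo fU)).
by rewrite (massE fg) -EFin_expe -EFinM.
Qed.

End packing.

(** * Tuples of marked points *)

(* A copy of [mu \x nu] under a new name: the library registers [\x] as a
   sigma-finite measure only for subprobabilities. *)
Section sigma_finite_product.
Context {K : realType} {d d' : measure_display}.
Context {S : measurableType d} {T : measurableType d'}.
Variable mu : {sigma_finite_measure set S -> \bar K}.
Variable nu : {sigma_finite_measure set T -> \bar K}.

Definition sigma_prod : set (S * T)%type -> \bar K := (mu \x nu)%E.

HB.instance Definition _ := Measure.on sigma_prod.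

Let sigma_prod_sigma_finite : sigma_finite setT sigma_prod.
Proof.
have /sigma_finiteP[F [TF ndF Foo]] := sigma_finiteT mu.
have /sigma_finiteP[G [TG ndG Goo]] := sigma_finiteT nu.
exists (fun n => F n `*` G n).
  rewrite -setXTT TF TG; apply/seteqP; split => -[x y] /=.
    move=> [[n _ Fnx] [k _ Gky]]; exists (maxn n k) => //; split.
      by move: x Fnx; exact/subsetPset/ndF/leq_maxl.
    by move: y Gky; exact/subsetPset/ndG/leq_maxr.
  by move=> [n _ []/= ? ?]; split; exists n.
move=> k; have [? ?] := Foo k; have [? ?] := Goo k.
split; first exact: measurableX.
by rewrite /sigma_prod product_measure1E// lte_mul_pinfty// ge0_fin_numE.
Qed.

HB.instance Definition _ := Measure_isSigmaFinite.Build _ _ _ sigma_prod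
  sigma_prod_sigma_finite.

Lemma ge0_integral_prod (f : S * T -> \bar K) :
  measurable_fun setT f -> (forall z, 0 <= f z)%E ->
  (\int[sigma_prod]_z f z = \int[mu]_x \int[nu]_y f (x, y))%E.
Proof. by move=> mf f0; exact: fubini_tonelli1. Qed.

End sigma_finite_product.

Section tuple_measure.
Context {K : realType} {d : measure_display} {S : measurableType d}.
Variable mu : {sigma_finite_measure set S -> \bar K}.

Definition pair_cons n (z : S * n.-tuple S) : n.+1.-tuple S := cons_tuple z.1 z.2.

Lemma measurable_pair_cons n : measurable_fun setT (@pair_cons n).
Proof. exact: measurable_cons. Qed.

Section successor.
Variables (n : nat) (nu : {sigma_finite_measure set (n.-tuple S) -> \bar K}).

Definition cons_measure : set (n.+1.-tuple S) -> \bar K :=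
  pushforward (sigma_prod mu nu) (@pair_cons n).

Let measurable_preimage A : measurable A -> measurable (@pair_cons n @^-1` A).
Proof.
by move=> mA; rewrite -[X in measurable X]setTI; exact: measurable_pair_cons.
Qed.

Let cons_measure0 : cons_measure set0 = 0%E.
Proof. by rewrite /cons_measure /pushforward preimage_set0 measure0. Qed.

Let cons_measure_ge0 A : (0 <= cons_measure A)%E.
Proof. exact: (measure_ge0 (sigma_prod mu nu)). Qed.

Let cons_measure_sigma_additive : semi_sigma_additive cons_measure.
Proof.
move=> F mF tF mUF; rewrite /cons_measure /pushforward preimage_bigcup.
apply: measure_semi_sigma_additive => [k| |].
- exact: measurable_preimage.
- apply/trivIsetP => /= i j _ _ ij; rewrite -preimage_setI.
  by move/trivIsetP : tF => /(_ _ _ _ _ ij) ->//; rewrite preimage_set0.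
- by rewrite -preimage_bigcup; exact: measurable_preimage.
Qed.

HB.instance Definition _ := isMeasure.Build _ _ _ cons_measure
  cons_measure0 cons_measure_ge0 cons_measure_sigma_additive.

Let cons_measure_sigma_finite : sigma_finite setT cons_measure.
Proof.
have [F FT Foo] := sigma_finiteT (sigma_prod mu nu).
(* The inverse of [pair_cons], along which an exhaustion of the product is carried over to
   tuples. *)
pose u (t : n.+1.-tuple S) := (thead t, [tuple of behead t]).
have mu' : measurable_fun setT u.
  by apply: measurable_fun_pair; [exact: measurable_tnth|exact: measurable_behead].
have uK z : u (pair_cons z) = z.
  by case: z => x t; rewrite /u /pair_cons; congr pair; apply/val_inj.
exists (fun k => u @^-1` F k).
  by rewrite -preimage_bigcup -FT.
move=> k; have [mF Fk] := Foo k; split.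
  by rewrite -[X in measurable X]setTI; exact: mu'.
rewrite /cons_measure /pushforward -comp_preimage.
by rewrite (_ : u \o _ = id)//; apply/funext.
Qed.

HB.instance Definition _ := Measure_isSigmaFinite.Build _ _ _ cons_measure
  cons_measure_sigma_finite.

End successor.

(** The n-th power of mu. The recursion returns a bundled sigma-finite measure because each new
    factor needs the sigma-finiteness of the previous ones for Fubini. *)
Fixpoint tuple_measure n : {sigma_finite_measure set (n.-tuple S) -> \bar K} :=
  match n with
  | 0 => [the {sigma_finite_measure set (0.-tuple S) -> \bar K} of \d_[tuple]]
  | n'.+1 => [the {sigma_finite_measure set (n'.+1.-tuple S) -> \bar K} of
      cons_measure (tuple_measure n')]
  end.

Lemma tuple_measureS n (A : set (n.+1.-tuple S)) :
  tuple_measure n.+1 A =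
  (\int[mu]_x tuple_measure n [set t | A (cons_tuple x t)])%E.
Proof.
rewrite /= /cons_measure /pushforward /sigma_prod /product_measure1.
apply: eq_integral => x _ /=; congr (tuple_measure n _).
by rewrite xsectionE.
Qed.

Lemma ge0_integral_tupleS n (f : n.+1.-tuple S -> \bar K) :
  measurable_fun setT f -> (forall t, 0 <= f t)%E ->
  (\int[tuple_measure n.+1]_t f t =
   \int[mu]_x \int[tuple_measure n]_t f (cons_tuple x t))%E.
Proof.
move=> mf f0; rewrite /= /cons_measure ge0_integral_pushforward//=;
  last exact: measurable_pair_cons.
rewrite preimage_setT (ge0_integral_prod _ _ (f := f \o @pair_cons n))//.
  exact: (measurableT_comp mf (@measurable_pair_cons n)).
by move=> z; exact: f0.
Qed.

Lemma measurable_cons_section n (A : set (n.+1.-tuple S)) x :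
  measurable A -> measurable [set t : n.-tuple S | A (cons_tuple x t)].
Proof.
move=> mA; rewrite -[X in measurable X]setTI.
exact: (measurable_cons (f := cst x) (g := id)).
Qed.

Lemma measurable_tuple_measure_section n (A : set (n.+1.-tuple S)) : measurable A ->
  measurable_fun setT (fun x => tuple_measure n [set t | A (cons_tuple x t)]).
Proof.
move=> mA; pose B := @pair_cons n @^-1` A.
have mB : measurable B.
  by rewrite -[X in measurable X]setTI; exact: measurable_pair_cons.
rewrite (_ : (fun x => _) = (tuple_measure n) \o xsection B).
  exact: measurable_fun_xsection.
by apply/funext => x /=; rewrite xsectionE.
Qed.

Lemma tuple_measure_box n (A : 'I_n -> set S) : (forall i, measurable (A i)) ->
  tuple_measure n [set t | forall i, A i (tnth t i)] = (\prod_(i < n) mu (A i))%E.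
Proof.
elim: n A => [|n IH] A mA.
  by rewrite big_ord0 /= diracE mem_set// => i; case: i.
rewrite tuple_measureS big_ord_recl.
transitivity (\int[mu]_x ((\1_(A ord0) x)%:E * \prod_(i < n) mu (A (lift ord0 i))))%E.
  apply: eq_integral => x _; rewrite indicE.
  have [Ax|Ax] := boolP (x \in A ord0).
    rewrite mul1e -IH//; congr (tuple_measure n _); apply/seteqP; split => t /= h i.
      by have := h (lift ord0 i); rewrite tnthS.
    by have [j ->|->] := unliftP ord0 i; [rewrite tnthS|exact/set_mem].
  rewrite mul0e (_ : [set t | _] = set0) ?measure0//.
  apply/seteqP; split => t //= /(_ ord0) h; move/negP: Ax; apply; exact/mem_set.
rewrite ge0_integralZr//=.
- by rewrite integral_indic// setIT.
- by apply: measurableT_comp => //.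
- by apply: prode_ge0 => i _.
Qed.

End tuple_measure.

(* [lebesgue_measure] lives on [measurableTypeR K], whose display differs from
   the one of [K] that tuples and random variables use. *)
Section real_lebesgue.
Context {K : realType}.

Definition real_lebesgue : set K -> \bar K := @lebesgue_measure K.

Let real_lebesgue0 : real_lebesgue set0 = 0%E.
Proof. exact: (measure0 (@lebesgue_measure K)). Qed.

Let real_lebesgue_ge0 A : (0 <= real_lebesgue A)%E.
Proof. exact: (measure_ge0 (@lebesgue_measure K)). Qed.

Let real_lebesgue_sigma_additive : semi_sigma_additive real_lebesgue.
Proof. exact: (@measure_semi_sigma_additive _ (measurableTypeR K) _ (@lebesgue_measure K)). Qed.

HB.instance Definition _ := isMeasure.Build _ _ _ real_lebesgue
  real_lebesgue0 real_lebesgue_ge0 real_lebesgue_sigma_additive.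

Let real_lebesgue_sigma_finite : sigma_finite setT real_lebesgue.
Proof. exact: (sigma_finiteT (@lebesgue_measure K)). Qed.

HB.instance Definition _ := Measure_isSigmaFinite.Build _ _ _ real_lebesgue
  real_lebesgue_sigma_finite.

Lemma ge0_integral_real_lebesgue (D : set K) (f : K -> \bar K) : measurable D ->
  measurable_fun D f -> (forall x, D x -> 0 <= f x)%E ->
  (\int[real_lebesgue]_(x in D) f x = \int[lebesgue_measure]_(x in D) f x)%E.
Proof.
move=> mD mf f0.
have mid : measurable_fun [set: measurableTypeR K] (idfun : measurableTypeR K -> K).
  by move=> _ A mA; rewrite setTI.
rewrite (_ : real_lebesgue = pushforward (@lebesgue_measure K)
   (idfun : measurableTypeR K -> K))//.
by rewrite ge0_integral_pushforward// => x /set_mem; exact: f0.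
Qed.

Lemma real_lebesgue_itv_bounded (a b : K) (x y : bool) : a <= b ->
  real_lebesgue [set` Interval (BSide x a) (BSide y b)] = (b - a)%:E.
Proof.
move=> ab; rewrite /real_lebesgue.
have := @lebesgue_measure_itv K (Interval (BSide x a) (BSide y b)).
rewrite /= lte_fin => ->; have [//|ba] := ltP a b.
by rewrite (@le_anti _ _ a b) ?ab// subrr.
Qed.

End real_lebesgue.

Section volume.
Context {K : realType}.

Definition lebesgue_tuple (d : nat) := tuple_measure (@real_lebesgue K) d.

(** [volume] integrates slices of arbitrary sets; for a measurable set the slices are measurable and
    the iterated integral is the product measure used from here on. *)
Lemma volumeE d (A : set (d.-tuple K)) : measurable A -> volume A = lebesgue_tuple d A.
Proof.
elim: d A => [//|d IH] A mA.
rewrite /lebesgue_tuple tuple_measureS ge0_integral_real_lebesgue//; last first.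
  exact: (measurable_tuple_measure_section real_lebesgue mA).
rewrite [LHS]/=; apply: eq_integral => x _; apply: IH.
exact: (@measurable_cons_section _ _ _ A x).
Qed.

End volume.

Section boxes.
Context {K : realType} {d : nat}.
Local Notation vol := (@lebesgue_tuple K d).

Definition box (a b : 'I_d -> K) : set (d.-tuple K) :=
  [set x | forall i, a i <= tnth x i <= b i].

Lemma measurable_box a b : measurable (box a b).
Proof.
rewrite (_ : box a b = \bigcap_(i in [set: 'I_d])
    (@tnth d K ^~ i @^-1` `[a i, b i]%classic)).
  apply: fin_bigcap_measurable => // i _.
  by rewrite -[X in measurable X]setTI; exact: measurable_tnth.
apply/seteqP; split => x /= h i; first by move=> _; rewrite /= in_itv/=; exact: h.
by have := h i I; rewrite /= in_itv.
Qed.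

Lemma box_volume a b : (forall i, a i <= b i) ->
  vol (box a b) = (\prod_(i < d) (b i - a i))%:E.
Proof.
move=> ab.
have := @tuple_measure_box K _ _ (@real_lebesgue K) d (fun i => `[a i, b i]%classic).
rewrite (_ : [set t | _] = box a b); last first.
  by apply/seteqP; split => x /= h i; have := h i; rewrite in_itv.
rewrite /lebesgue_tuple => -> //; rewrite -prodEFin; apply: eq_bigr => i _.
exact: (real_lebesgue_itv_bounded true false (ab i)).
Qed.

Lemma measurable_unit_cube : measurable (@unit_cube K d).
Proof. exact: (measurable_box (fun=> 0) (fun=> 1)). Qed.

End boxes.

Lemma lebesgue_tuple_cube {K : realType} d : lebesgue_tuple d (@unit_cube K d) = 1%E.
Proof.
have := @box_volume K d (fun=> 0) (fun=> 1); rewrite subr0 prodr_const expr1n.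
by apply=> i; exact: ler01.
Qed.

(** * The non-overlap probability as a partition function *)

Section relabelling_count.

(** A permutation amounts to the image j of the first index and a permutation of the remaining ones;
    injectivity and equal cardinals give the bijection. *)
Lemma sum_perm_lift n (F : 'S_n.+1 -> nat) :
  (\sum_(s : 'S_n.+1) F s = \sum_(j < n.+1) \sum_(t : 'S_n) F (lift_perm ord0 j t))%N.
Proof.
pose h (p : 'I_n.+1 * 'S_n) := lift_perm ord0 p.1 p.2.
have hI : injective h.
  move=> [j t] [j' t'] /= e.
  have e0 := congr1 (fun s : 'S_n.+1 => s ord0) e.
  rewrite /h /= !lift_perm_id in e0; subst j'; congr pair; apply/permP => k.
  have := congr1 (fun s : 'S_n.+1 => s (lift ord0 k)) e.
  by rewrite /h /= !lift_perm_lift => /lift_inj.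
have hB : bijective h.
  apply: inj_card_bij => //.
  by rewrite card_prod card_ord !card_Sn factS.
by rewrite [RHS]pair_bigA/= (reindex h)//=; exact: onW_bij.
Qed.

(** Label classes of equal sizes can be matched in any order, whence the factorials. They will
    cancel those of the Poisson probabilities. *)
Lemma count_perm_labels n (L : finType) (f g : 'I_n -> L) :
  (\sum_(s : 'S_n) \prod_(i < n) (g (s i) == f i) =
   [forall l, \sum_(i < n) (g i == l) == \sum_(i < n) (f i == l)] *
   \prod_l (\sum_(i < n) (f i == l))`!)%N.
Proof.
elim: n f g => [|n IH] f g.
  have -> : (\sum_(s : 'S_0) \prod_(i < 0) (g (s i) == f i) = 1)%N.
    by rewrite (eq_bigr (fun=> 1%N)) => [|s _]; rewrite ?big_ord0// sum1_card card_Sn.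
  rewrite big1; last by move=> l _; rewrite big_ord0.
  by rewrite (_ : [forall l, _]) //; apply/forallP => l; rewrite !big_ord0.
pose f' i := f (lift ord0 i).
have fE l : (\sum_(i < n.+1) (f i == l) = (f ord0 == l) + \sum_(i < n) (f' i == l))%N.
  by rewrite big_ord_recl.
rewrite sum_perm_lift.
have step j : (\sum_(t : 'S_n) \prod_(i < n.+1) (g (lift_perm ord0 j t i) == f i) =
   (g j == f ord0) * ([forall l, \sum_(i < n.+1) (g i == l) ==
     \sum_(i < n.+1) (f i == l)] * \prod_l (\sum_(i < n) (f' i == l))`!))%N.
  have [gj|gj] := eqVneq (g j) (f ord0); last first.
    rewrite mul0n big1// => t _.
    by rewrite big_ord_recl lift_perm_id (negbTE gj).
  rewrite mul1n; transitivity (\sum_(t : 'S_n) \prod_(i < n) (g (lift j (t i)) == f' i))%N.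
    apply: eq_bigr => t _; rewrite big_ord_recl lift_perm_id gj eqxx mul1n.
    by apply: eq_bigr => i _; rewrite lift_perm_lift.
  rewrite (IH f' (fun i => g (lift j i))); congr (nat_of_bool _ * _)%N.
  apply: eq_forallb => l; rewrite fE (bigD1_ord j)//= gj.
  by rewrite eqn_add2l.
rewrite (eq_bigr _ (fun j _ => step j)) -big_distrl /= mulnCA.
case: forallP => [eqc|_]; last by rewrite !mul0n.
(* The first index can be sent to any member of the class of [f ord0]; this factor turns k! into (k
   + 1)! for that class. *)
rewrite !mul1n (eqP (eqc (f ord0))).
rewrite (bigD1 (f ord0))//= [RHS](bigD1 (f ord0))//= mulnA; congr (_ * _)%N.
  by rewrite fE eqxx add1n factS.
by apply: eq_bigr => l lf; rewrite fE eq_sym (negbTE lf).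
Qed.

End relabelling_count.

Section finite_combinations.
Context {K : realType} {d : measure_display} {T : measurableType d}.
Variable P : {measure set T -> \bar K}.

(** Integration of a pointwise identity between combinations of indicators: combinatorial facts
    about a single outcome become identities between probabilities. *)
Lemma eq_sum_measure (I J : finType) (a : I -> K) (b : J -> K)
    (A : I -> set T) (B : J -> set T) :
  (forall i, 0 <= a i) -> (forall j, 0 <= b j) ->
  (forall i, measurable (A i)) -> (forall j, measurable (B j)) ->
  (forall w, \sum_i a i * \1_(A i) w = \sum_j b j * \1_(B j) w) ->
  (\sum_i (a i)%:E * P (A i) = \sum_j (b j)%:E * P (B j))%E.
Proof.
move=> a0 b0 mA mB AB.
have H (I' : finType) (a' : I' -> K) (A' : I' -> set T) : (forall i, 0 <= a' i) ->
    (forall i, measurable (A' i)) ->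
    (\sum_i (a' i)%:E * P (A' i) = \int[P]_w (\sum_i a' i * \1_(A' i) w)%:E)%E.
  move=> a'0 mA'; under [RHS]eq_integral do rewrite -sumEFin.
  rewrite ge0_integral_sum//=; last 2 first.
  - by move=> i; apply: measurableT_comp => //; exact: measurable_funM.
  - by move=> i w _; rewrite lee_fin mulr_ge0.
  apply: eq_bigr => i _; under eq_integral do rewrite EFinM.
  rewrite ge0_integralZl//=.
  - by rewrite integral_indic// setIT.
  - exact: measurableT_comp.
  - by rewrite lee_fin.
by rewrite !H//; apply: eq_integral => w _; rewrite AB.
Qed.

End finite_combinations.

Lemma independent_finite {K : realType} {dT dU : measure_display}
    {T : measurableType dT} {U : measurableType dU} (P : probability T K)
    (I : choiceType) (f : I -> T -> U) (F : finType) (h : F -> I) (B : F -> set U) :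
  mutually_independent P f -> injective h -> (forall i, measurable (B i)) ->
  P [set w | forall i, B i (f (h i) w)] = (\prod_(i : F) P (f (h i) @^-1` B i))%E.
Proof.
move=> indf hI mB.
(* Independence asks for one event per index j of the family. Since h is injective, [C (h i)] is
   [B i]; off the image of h, [C j] is everything. *)
pose C j : set U := \bigcap_(i in [set i | h i = j]) B i.
have CE i : C (h i) = B i.
  apply/seteqP; split => u; first by apply.
  by move=> Biu k /= /hI ->.
pose J := [fset h i | i : F]%fset.
have := indf J (fun j => f j @^-1` C j).
rewrite (_ : \bigcap_(j in [set` J]) _ = [set w | forall i, B i (f (h i) w)]).
  move=> ->.
    rewrite big_imfset/=; last by move=> x y _ _; exact: hI.
    by rewrite big_enum/=; apply: eq_bigr => i _; rewrite CE.
  move=> j _; exists (C j); last by rewrite setTI.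
  by apply: fin_bigcap_measurable => // i _; exact: mB.
apply/seteqP; split => w /= H.
  move=> i; rewrite -CE; apply: (H (h i)) => /=; rewrite /J.
  by apply/imfsetP; exists i.
by move=> j /imfsetP[i _ ->] /=; rewrite CE.
Qed.

Lemma measurable_point_count {K : realType} {dT : measure_display}
    {T : measurableType dT} (P : probability T K) (d : nat)
    (N : {RV P >-> nat}) (X : nat -> {RV P >-> d.-tuple K}) B k :
  measurable B -> measurable [set w | point_count N X B w = k].
Proof.
move=> mB.
have mN m : measurable [set w | N w = m].
  rewrite (_ : [set w | _] = N @^-1` [set m])//.
  by rewrite -[X in measurable X]setTI; exact: measurable_funPT.
have mXB i : measurable_fun [set: T] (fun w => (X i w \in B) : nat).
  apply: (measurableT_comp (f := nat_of_bool)) => //.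
  apply: (measurable_fun_bool true) => /=; rewrite setTI.
  rewrite (_ : _ @^-1` _ = X i @^-1` B).
    by rewrite -[X in measurable X]setTI; exact: measurable_funPT.
  by apply/seteqP; split => w /=; [move/set_mem|move=> h; apply/mem_set].
rewrite (_ : [set w | _] = \bigcup_m ([set w | N w = m] `&`
    [set w | (\sum_(i < m) (X i w \in B))%N = k])).
  apply: bigcupT_measurable => m; apply: measurableI => //.
  rewrite (_ : [set w | _] = (fun w => \sum_(i < m) (X i w \in B))%N @^-1` [set k])//.
  rewrite -[X in measurable X]setTI.
  suff : measurable_fun [set: T] (fun w => \sum_(i < m) (X i w \in B))%N by apply.
  elim: m => [|m IH].
    by under eq_fun do rewrite big_ord0; exact: measurable_cst.
  under eq_fun do rewrite big_ord_recr/=.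
  exact: measurable_fun_addn.
apply/seteqP; split => [w /= <-|w [m _ [/= Nm <-]]]; first by exists (N w).
by rewrite /point_count Nm.
Qed.

(** * Law of the centres, up to their order *)

Section poisson_points.
Context {K : realType} {dT : measure_display} {T : measurableType dT}.
Variables (P : probability T K) (d : nat).
Variables (N : {RV P >-> nat}) (X : nat -> {RV P >-> d.-tuple K}) (lambda : K).
Hypothesis lambda_gt0 : 0 < lambda.
Hypothesis poissonX : homogeneous_poisson_on_cube lambda N X.

Local Notation vol := (@lebesgue_tuple K d).
Local Notation cube := (@unit_cube K d).

Lemma poisson_prob1 (r : K) m : 0 <= r ->
  poisson_prob r 0%N [set m] = (expR (- r) * r ^+ m / m`!%:R)%:E.
Proof.
rewrite /poisson_prob le_eqVlt => /predU1P[<-|r0].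
  rewrite ltxx diracE oppr0 expR0 mul1r expr0n.
  case: m => [|m]; first by rewrite mem_set// fact0 divr1.
  by rewrite memNset// mul0r.
rewrite r0 esum_set1 /poisson_pmf ?r0; first by congr EFin; ring.
by rewrite lee_fin !mulr_ge0 ?expR_ge0 ?invr_ge0// exprn_ge0// ltW.
Qed.

Section labels.
Variables (L : finType) (g : d.-tuple K -> L).
Hypothesis mg : forall l, measurable [set x | g x = l].

Let E l : set (d.-tuple K) := cube `&` [set x | g x = l].

Let mE l : measurable (E l).
Proof. by apply: measurableI; [exact: measurable_unit_cube|exact: mg]. Qed.

Let a l : K := fine (vol (E l)).

Let volE l : vol (E l) = (a l)%:E.
Proof.
rewrite /a fineK// ge0_fin_numE//; apply: (@le_lt_trans _ _ (vol cube)).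
  apply: (le_measure vol); rewrite ?inE//; first exact: measurable_unit_cube.
  exact: subIsetl.
by rewrite lebesgue_tuple_cube ltry.
Qed.

Let a_ge0 l : 0 <= a l. Proof. exact: fine_ge0. Qed.

Let sum_a : \sum_l a l = 1.
Proof.
apply: EFin_inj; rewrite -sumEFin -(lebesgue_tuple_cube d).
have := @eq_sum_measure K _ _ vol L 'I_1 (fun=> 1) (fun=> 1) E (fun=> cube).
rewrite big_ord1 mul1e => <-//.
- by apply: eq_bigr => l _; rewrite mul1e; exact/esym/volE.
- by move=> _; exact: measurable_unit_cube.
move=> x; rewrite big_ord1 mul1r.
have [cx|cx] := pselect (cube x); last first.
  rewrite indicE memNset// big1// => l _.
  by rewrite indicE memNset ?mulr0// => -[].
rewrite (bigD1 (g x))//= !indicE !mem_set// mulr1 big1 ?addr0// => l lg.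
by rewrite indicE memNset ?mulr0// => -[_ /= e]; rewrite e eqxx in lg.
Qed.

Let count l w := point_count N X (E l) w.

(** The label classes partition the cube, so their counts are independent Poisson variables whose
    means lambda a_l add up to lambda. *)
Lemma label_counts_prob (m : L -> nat) :
  P [set w | forall l, count l w = m l] =
  (expR (- lambda) * \prod_l ((lambda * a l) ^+ m l / (m l)`!%:R))%:E.
Proof.
have [Xcube cnt ind] := poissonX.
have indE := ind #|L| (fun i => E (enum_val i)).
have {indE} := indE (fun i => mE _).
move=> /(_ (fun i x xE => proj1 xE)).
have tE : trivIset setT (fun i : 'I_#|L| => E (enum_val i)).
  apply/trivIsetP => i j _ _ ij; apply/seteqP; split => x // [[_ gi] [_ gj]].
  by move/negP : ij; apply; apply/eqP/enum_val_inj; rewrite -gi -gj.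
move=> /(_ tE) indE.
have := @independent_finite K _ _ _ _ P _ _ L enum_rank (fun l => [set m l]) indE
   (@enum_rank_inj L) (fun=> I).
under [X in P X]eq_set do rewrite /=.
rewrite (_ : [set w | forall i, _] = [set w | forall l, count l w = m l]); last first.
  by apply/seteqP; split => w /= h l; have := h l; rewrite enum_rankK.
move=> ->; rewrite (eq_bigr (fun l => (expR (- (lambda * a l)) *
    ((lambda * a l) ^+ m l / (m l)`!%:R))%:E)); last first.
  move=> l _; rewrite enum_rankK cnt//; last exact: subIsetl.
  by rewrite volumeE// volE/= poisson_prob1 ?mulrA// mulr_ge0// ltW.
rewrite prodEFin; congr EFin; rewrite big_split/=; congr (_ * _).
by rewrite -expR_sum sumrN -mulr_sumr sum_a mulr1.
Qed.

(** Summing over permutations erases the unknown order. By [count_perm_labels] the sum of the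
    indicators is the product of the m_l! times the indicator that each label l is met m_l times,
    and these factorials cancel those of [label_counts_prob]. *)
Lemma sum_perm_label_prob n (f : 'I_n -> L) :
  (\sum_(s : 'S_n) P [set w | N w = n /\ forall i, g (X (s i) w) = f i] =
   (expR (- lambda) * lambda ^+ n)%:E * \prod_(i < n) vol (E (f i)))%E.
Proof.
have [Xcube _ _] := poissonX.
pose m l := (\sum_(i < n) (f i == l))%N.
pose c : K := (\prod_l (m l)`!)%N%:R.
have mXl k l : measurable [set w | g (X k w) = l].
  rewrite (_ : [set w | _] = X k @^-1` [set x | g x = l])//.
  by rewrite -[X in measurable X]setTI; exact: measurable_funPT.
have mN k : measurable [set w | N w = k].
  rewrite (_ : [set w | _] = N @^-1` [set k])//.
  by rewrite -[X in measurable X]setTI; exact: measurable_funPT.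
have mA (s : 'S_n) : measurable [set w | N w = n /\ forall i, g (X (s i) w) = f i].
  rewrite (_ : [set w | _] = [set w | N w = n] `&`
      \bigcap_(i in [set: 'I_n]) [set w | g (X (s i) w) = f i]).
    apply: measurableI; first exact: mN.
    by apply: fin_bigcap_measurable => // i _; exact: mXl.
  by apply/seteqP; split => w /= [? h]; split => // i; [move=> _|]; exact: h.
have mcount l k : measurable [set w | count l w = k].
  exact: measurable_point_count.
have mB : measurable [set w | forall l, count l w = m l].
  rewrite (_ : [set w | _] = \bigcap_(l in [set: L]) [set w | count l w = m l]).
    by apply: fin_bigcap_measurable => // l _; exact: mcount.
  by apply/seteqP; split => w /= h l; [move=> _|]; exact: h.
have := @eq_sum_measure K _ _ P 'S_n 'I_1 (fun=> 1) (fun=> c)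
  (fun s => [set w | N w = n /\ forall i, g (X (s i) w) = f i])
  (fun=> [set w | forall l, count l w = m l]).
rewrite big_ord1 => H.
transitivity (\sum_(s : 'S_n) 1 * P [set w | N w = n /\ forall i, g (X (s i) w) = f i])%E.
  by apply: eq_bigr => s _; rewrite mul1e.
rewrite H//; clear H.
- rewrite [X in (_ * X)%E](label_counts_prob m) (eq_bigr (fun i => (a (f i))%:E))//.
  rewrite prodEFin -!EFinM; congr EFin.
  have -> : \prod_l ((lambda * a l) ^+ m l / (m l)`!%:R) =
      (\prod_l (lambda * a l) ^+ m l) / c.
    by rewrite big_split/= /c natr_prod prodfV.
  have -> : \prod_l (lambda * a l) ^+ m l = \prod_(i < n) (lambda * a (f i)).
    rewrite (partition_big f xpredT)//=; apply: eq_bigr => l _.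
    rewrite /m -prodrXr [RHS]big_mkcond/=; apply: eq_bigr => i _.
    by case: eqP => [->|].
  rewrite big_split/= prodr_const card_ord.
  have c0 : c != 0.
    rewrite /c pnatr_eq0 -lt0n; apply: prodn_gt0 => l; exact: fact_gt0.
  by field.
move=> w; rewrite big_ord1.
under eq_bigr do rewrite mul1r.
have [Nn|Nn] := eqVneq (N w) n; last first.
  rewrite big1; last first.
    by move=> s _; rewrite indicE memNset// => -[/eqP]; rewrite (negbTE Nn).
  rewrite indicE memNset ?mulr0// => h; move/negP : Nn; apply; apply/eqP.
  (* The counts of all labels add up to [N w] and the m_l add up to n, so equal counts force
     [N w = n]. *)
  transitivity (\sum_l count l w)%N.
    rewrite /count /point_count exchange_big/= -[LHS]card_ord -sum1_card.
    apply: eq_bigr => i _; rewrite (bigD1 (g (X i w)))//= mem_set; last first.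
      by split => //; exact: Xcube.
    rewrite big1 ?addn0// => l lg; rewrite memNset// => -[_ /= e].
    by rewrite e eqxx in lg.
  rewrite (eq_bigr m) => [|l _]; last exact: h.
  rewrite /m exchange_big/= -[RHS]card_ord -sum1_card; apply: eq_bigr => i _.
  rewrite (bigD1 (f i))//= eqxx big1 ?addn0// => l lf.
  by rewrite eq_sym (negbTE lf).
have countE l : count l w = (\sum_(i < n) (g (X i w) == l))%N.
  rewrite /count /point_count Nn; apply: eq_bigr => i _; congr nat_of_bool.
  apply/idP/eqP => [/set_mem[]//|e]; apply/mem_set; split => //.
  by apply: Xcube; rewrite Nn.
have := count_perm_labels f (fun i : 'I_n => g (X i w)).
move=> /(congr1 (fun k => k%:R : K)); rewrite natr_sum natrM -/c => e.
transitivity (\sum_(s : 'S_n) (\prod_(i < n) (g (X (s i) w) == f i))%N%:R : K).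
  apply: eq_bigr => s _; rewrite indicE; congr (_%:R).
  case: (boolP [forall i, g (X (s i) w) == f i]) => [/forallP h|/forallPn[i h]].
    rewrite mem_set; last by split => // i; apply/eqP.
    by rewrite big1// => i _; rewrite (eqP (h i)) eqxx.
  rewrite memNset; last by move=> [_ /(_ i) /eqP]; exact/negP.
  by rewrite (bigD1 i)//= (negbTE h).
rewrite e mulrC indicE; congr (_ * _%:R); congr nat_of_bool.
apply/forallP/idP => [h|/set_mem /= h].
  by apply/mem_set => l /=; rewrite countE; exact/eqP.
by move=> l; rewrite -countE h.
Qed.

End labels.

(** The sets [A i] may overlap, so a point x is labelled by the set of all i with x in [A i]. Both
    sides become sums over the label sequences f such that i belongs to f i for every i. *)
Lemma sum_perm_box_prob n (A : 'I_n -> set (d.-tuple K)) : (forall i, measurable (A i)) ->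
  (\sum_(s : 'S_n) P [set w | N w = n /\ forall i, A i (X (s i) w)] =
   (expR (- lambda) * lambda ^+ n)%:E * \prod_(i < n) vol (cube `&` A i))%E.
Proof.
move=> mA; pose L := {set 'I_n}.
pose g x : L := [set i | x \in A i]%SET.
have gE x i : (i \in g x) = (x \in A i) by rewrite inE.
have mg l : measurable [set x | g x = l].
  rewrite (_ : [set x | _] = \bigcap_(i in [set: 'I_n])
      (if i \in l then A i else ~` A i)).
    apply: fin_bigcap_measurable => // i _.
    by case: ifP => _ //; exact: measurableC.
  apply/seteqP; split => x /=.
    move=> <- i _; rewrite gE; case: ifPn => [/set_mem//|].
    by rewrite notin_setE.
  move=> h; apply/setP => i; rewrite gE; have := h i I.
  by case: (i \in l) => /= xA; [rewrite mem_set|rewrite memNset].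
pose ok (f : {ffun 'I_n -> L}) := [forall i, i \in f i].
pose Af (f : 'I_n -> L) (s : 'S_n) := [set w | N w = n /\ forall i, g (X (s i) w) = f i].
have mN k : measurable [set w | N w = k].
  rewrite (_ : [set w | _] = N @^-1` [set k])//.
  by rewrite -[X in measurable X]setTI; exact: measurable_funPT.
have mX k B : measurable B -> measurable [set w | B (X k w)].
  move=> mB; rewrite (_ : [set w | _] = X k @^-1` B)//.
  by rewrite -[X in measurable X]setTI; exact: measurable_funPT.
have mbox (B : 'I_n -> set (d.-tuple K)) (s : 'S_n) : (forall i, measurable (B i)) ->
    measurable [set w | N w = n /\ forall i, B i (X (s i) w)].
  move=> mB; rewrite (_ : [set w | _] = [set w | N w = n] `&`
      \bigcap_(i in [set: 'I_n]) [set w | B i (X (s i) w)]).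
    apply: measurableI; first exact: mN.
    by apply: fin_bigcap_measurable => // i _; exact: mX.
  by apply/seteqP; split => w /= [? h]; split => // i; [move=> _|]; exact: h.
have mAf f s : measurable (Af f s) by exact: (mbox (fun i => [set x | g x = f i]) s).
have step (s : 'S_n) : (P [set w | N w = n /\ forall i, A i (X (s i) w)] =
    \sum_(f | ok f) P (Af f s))%E.
  have := @eq_sum_measure K _ _ P 'I_1 {ffun 'I_n -> L} (fun=> 1) (fun f => (ok f)%:R)
    (fun=> [set w | N w = n /\ forall i, A i (X (s i) w)]) (fun f => Af f s).
  rewrite big_ord1 mul1e => ->//.
  - rewrite [RHS]big_mkcond/=; apply: eq_bigr => f _.
    by case: (ok f); rewrite ?mul1e ?mul0e.
  - by move=> _; exact: mbox.
  move=> w; rewrite big_ord1 mul1r.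
  have [Nn|Nn] := eqVneq (N w) n; last first.
    rewrite indicE memNset; last by move=> [/eqP]; rewrite (negbTE Nn).
    rewrite big1// => f _; rewrite indicE memNset ?mulr0//.
    by move=> [/eqP]; rewrite (negbTE Nn).
  rewrite (bigD1 [ffun i => g (X (s i) w)])//= big1 ?addr0; last first.
    move=> f /eqP ff; rewrite indicE memNset ?mulr0// => -[_ e]; apply: ff.
    by apply/ffunP => i; rewrite ffunE e.
  rewrite !indicE (@mem_set _ (Af _ _)) ?mulr1; last by split => // i; rewrite ffunE.
  congr (_%:R); congr nat_of_bool; apply/idP/forallP => [/set_mem[_ h] i|h].
    by rewrite ffunE gE; apply/mem_set; exact: h.
  by apply/mem_set; split => // i; have := h i; rewrite ffunE gE => /set_mem.
under eq_bigr do rewrite step.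
rewrite exchange_big/=.
under eq_bigr do rewrite (sum_perm_label_prob mg).
rewrite -ge0_sume_distrr; last first.
  by move=> f _; apply: prode_ge0 => i _; exact: measure_ge0.
congr (_ * _)%E.
have volA i : vol (cube `&` A i) =
    (\sum_(l : L | i \in l) vol (cube `&` [set x | g x = l]))%E.
  have := @eq_sum_measure K _ _ vol 'I_1 L (fun=> 1) (fun l => (i \in l)%:R)
    (fun=> cube `&` A i) (fun l => cube `&` [set x | g x = l]).
  rewrite big_ord1 mul1e => ->//.
  - rewrite [RHS]big_mkcond/=; apply: eq_bigr => l _.
    by case: (i \in l); rewrite ?mul1e ?mul0e.
  - by move=> _; apply: measurableI => //; exact: measurable_unit_cube.
  - by move=> l; apply: measurableI => //; exact: measurable_unit_cube.
  move=> x; rewrite big_ord1 mul1r.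
  rewrite (bigD1 (g x))//= big1 ?addr0; last first.
    move=> l /eqP lg; rewrite indicE memNset ?mulr0// => -[_ /= e].
    by apply: lg; rewrite e.
  rewrite gE; have [cx|cx] := pselect (cube x); last first.
    have nx E : (x \in cube `&` E) = false by apply/memNset => -[].
    by rewrite !indicE !nx mulr0.
  rewrite !indicE (@mem_set _ (cube `&` [set x0 | g x0 = g x])) ?mulr1//.
  congr (_%:R); congr nat_of_bool.
  by apply/idP/idP => /set_mem h; apply/mem_set; [case: h|split].
pose a (l : L) : K := fine (vol (cube `&` [set x | g x = l])).
have va l : vol (cube `&` [set x | g x = l]) = (a l)%:E.
  rewrite /a fineK// ge0_fin_numE//; apply: (@le_lt_trans _ _ (vol cube)).
    apply: (le_measure vol); rewrite ?inE.
    - by apply: measurableI; [exact: measurable_unit_cube|exact: mg].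
    - exact: measurable_unit_cube.
    - exact: subIsetl.
  by rewrite lebesgue_tuple_cube ltry.
have volAE i : vol (cube `&` A i) = (\sum_(l : L) (i \in l)%:R * a l)%:E.
  rewrite volA big_mkcond/= -sumEFin; apply: eq_bigr => l _.
  by case: (i \in l); rewrite ?mul1r ?mul0r ?va.
(* Distributing the product of sums over labels produces the sum over label sequences. *)
rewrite [RHS](eq_bigr _ (fun i _ => volAE i)) prodEFin bigA_distr_bigA/= -sumEFin.
rewrite big_mkcond/=; apply: eq_bigr => f _.
rewrite (eq_bigr (fun i => (a (f i))%:E)); last by move=> i _; exact: va.
rewrite prodEFin big_split/=; case: ifPn => [/forallP h|/forallPn[i h]].
  by rewrite [X in _ = (X * _)%:E]big1 ?mul1r// => i _; rewrite h.
by rewrite [X in _ = (X * _)%:E](bigD1 i)//= (negbTE h) !mul0r.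
Qed.

End poisson_points.

Section image_measure.
Context {K : realType} {dT dU : measure_display}.
Context {T : measurableType dT} {U : measurableType dU}.
Variables (m : {measure set T -> \bar K}) (D : set T) (mD : measurable D).
Variable Y : {mfun T >-> U}.

Definition restricted_image : set U -> \bar K := pushforward (mrestr m mD) Y.

Let measurable_preimage A : measurable A -> measurable (Y @^-1` A).
Proof. by move=> mA; rewrite -[X in measurable X]setTI; exact: measurable_funPT. Qed.

Let restricted_image0 : restricted_image set0 = 0%E.
Proof. by rewrite /restricted_image /pushforward preimage_set0 measure0. Qed.

Let restricted_image_ge0 A : (0 <= restricted_image A)%E.
Proof. exact: (measure_ge0 (mrestr m mD)). Qed.

Let restricted_image_sigma_additive : semi_sigma_additive restricted_image.
Proof.
move=> F mF tF mUF; rewrite /restricted_image /pushforward preimage_bigcup.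
apply: measure_semi_sigma_additive => [k| |].
- exact: measurable_preimage.
- apply/trivIsetP => /= i j _ _ ij; rewrite -preimage_setI.
  by move/trivIsetP : tF => /(_ _ _ _ _ ij) ->//; rewrite preimage_set0.
- by rewrite -preimage_bigcup; exact: measurable_preimage.
Qed.

HB.instance Definition _ := isMeasure.Build _ _ _ restricted_image
  restricted_image0 restricted_image_ge0 restricted_image_sigma_additive.

End image_measure.

Section marked_points.
Context {K : realType} {dT dA dB : measure_display}.
Context {T : measurableType dT} {A : measurableType dA} {B : measurableType dB}.
Variables (P : probability T K) (D : set T) (mD : measurable D).
Variables (n : nat) (X : 'I_n -> {mfun T >-> A}) (rho : 'I_n -> {mfun T >-> B}).
Variables (alpha : {sigma_finite_measure set A -> \bar K}).
Variable (nu : {sigma_finite_measure set B -> \bar K}) (k : K).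
Hypothesis k_ge0 : 0 <= k.
Hypothesis alpha_fin : (alpha setT < +oo)%E.
Hypothesis nu_fin : (nu setT < +oo)%E.
Hypothesis law : forall (E : 'I_n -> set A) (F : 'I_n -> set B),
  (forall i, measurable (E i)) -> (forall i, measurable (F i)) ->
  (\sum_(s : 'S_n) P [set w | D w /\ forall i, E i (X (s i) w) /\ F i (rho (s i) w)] =
   k%:E * \prod_(i < n) (alpha (E i) * nu (F i)))%E.

Let Z (s : 'S_n) (w : T) : n.-tuple (A * B)%type :=
  [tuple (X (s i) w, rho (s i) w) | i < n].

Let mZ s : measurable_fun setT (Z s).
Proof.
apply/measurable_fun_tnthP => i.
rewrite (_ : _ \o _ = (fun w => (X (s i) w, rho (s i) w))).
  by apply: measurable_fun_pair; exact: measurable_funPT.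
by apply/funext => w /=; rewrite tnth_mktuple.
Qed.

Let Zfun s : {mfun T >-> n.-tuple (A * B)%type} := HB.pack (Z s)
  (isMeasurableFun.Build _ _ _ _ (Z s) (mZ s)).

Let boxes : set (set (n.-tuple (A * B)%type)) := [set C | exists E F,
  [/\ forall i, measurable (E i), forall i, measurable (F i)
    & C = [set t | forall i, E i (tnth t i).1 /\ F i (tnth t i).2]]].

Let boxesE : measurable = <<s boxes >>.
Proof.
apply/seteqP; split.
  move=> C mC.
  pose V := g_sigma_algebraType boxes.
  have mi : measurable_fun [set: V] (fun t : V => t : n.-tuple (A * B)%type).
    apply/measurable_fun_tnthP => i; apply/measurable_fun_pairP; split.
      move=> _ E mE; rewrite setTI; apply: sub_sigma_algebra.
      exists (fun j => if j == i then E else setT), (fun=> setT); split => //.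
        by move=> j; case: ifP.
      apply/seteqP; split => t /= h; last by have [] := h i; rewrite eqxx.
      by move=> j; split => //; case: eqP => // ->.
    move=> _ E mE; rewrite setTI; apply: sub_sigma_algebra.
    exists (fun=> setT), (fun j => if j == i then E else setT); split => //.
      by move=> j; case: ifP.
    apply/seteqP; split => t /= h; last by have [] := h i; rewrite eqxx.
    by move=> j; split => //; case: eqP => // ->.
  by have := mi measurableT C mC; rewrite setTI.
apply: smallest_sub; first exact: sigma_algebra_measurable.
move=> C [E [F [mE mF ->]]].
rewrite (_ : [set t | _] = \bigcap_(i in [set: 'I_n])
    (@tnth n (A * B)%type ^~ i @^-1` (E i `*` F i))).
  apply: fin_bigcap_measurable => // i _.
  rewrite -[X in measurable X]setTI; apply: measurable_tnth => //.
  exact: measurableX.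
by apply/seteqP; split => t /= h i; [move=> _|]; exact: h.
Qed.

Let mu := sigma_prod alpha nu.

(** Both sides are finite measures in C that agree on [boxes], a pi-system generating the product
    sigma-algebra. *)
Lemma marked_points_law C : measurable C ->
  (\sum_(s : 'S_n) P [set w | D w /\ C [tuple (X (s i) w, rho (s i) w) | i < n]] =
   k%:E * tuple_measure mu n C)%E.
Proof.
move=> mC.
(* [msum] is indexed by integers, so the permutations are listed through [enum]. *)
pose m1 : {measure set (n.-tuple (A * B)%type) -> \bar K} :=
  msum (fun j => restricted_image P mD (Zfun (nth 1%g (enum 'S_n) j))) #|'S_n|.
pose m2 : {measure set (n.-tuple (A * B)%type) -> \bar K} :=
  mscale (NngNum k_ge0) (tuple_measure mu n).
have m1E C' : m1 C' = (\sum_(s : 'S_n) P [set w | D w /\ C' (Z s w)])%E.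
  rewrite -[RHS]big_enum/= (big_nth 1%g) -cardE big_mkord.
  apply: eq_bigr => j _; rewrite /m1 /restricted_image /pushforward /mrestr.
  by congr (P _); apply/seteqP; split => w /= [].
have m2E C' : m2 C' = (k%:E * tuple_measure mu n C')%E by [].
have m12 C' : boxes C' -> m1 C' = m2 C'.
  move=> [E [F [mE mF ->]]]; rewrite m1E m2E.
  rewrite (_ : [set t | _] = [set t | forall i, (E i `*` F i) (tnth t i)])//.
  rewrite (tuple_measure_box mu (A := fun i => E i `*` F i)); last first.
    by move=> i; exact: measurableX.
  rewrite (eq_bigr (fun i => alpha (E i) * nu (F i)))%E; last first.
    by move=> i _; exact: product_measure1E.
  rewrite -law//; apply: eq_bigr => s _; congr (P _).
  by apply/seteqP; split => w /= [Dw h]; split => // i; have := h i; rewrite tnth_mktuple.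
have boxT : boxes setT.
  by exists (fun=> setT), (fun=> setT); split => //; apply/seteqP; split => // t _ i.
rewrite -m1E -m2E.
apply: (measure_unique boxes (fun=> setT)) => //.
- move=> C1 C2 [E1 [F1 [mE1 mF1 ->]]] [E2 [F2 [mE2 mF2 ->]]].
  exists (fun i => E1 i `&` E2 i), (fun i => F1 i `&` F2 i); split.
  + by move=> i; exact: measurableI.
  + by move=> i; exact: measurableI.
  + apply/seteqP; split => t /=.
      by move=> [h1 h2] i; have [? ?] := h1 i; have [? ?] := h2 i.
    by move=> h; split => i; have [[? ?] [? ?]] := h i.
- by apply/seteqP; split => // t _; exists 0%N.
- move=> _; rewrite m12// m2E.
  have := tuple_measure_box mu (fun (i : 'I_n) => @measurableT _ (A * B)%type).
  rewrite (_ : [set t | _] = setT); last by apply/seteqP; split.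
  move=> ->; have aT : alpha setT \is a fin_num by rewrite ge0_fin_numE.
  have nT : nu setT \is a fin_num by rewrite ge0_fin_numE.
  rewrite (eq_bigr (fun=> (fine (alpha setT) * fine (nu setT))%:E)).
    by rewrite prodEFin -EFinM ltry.
  move=> i _; rewrite -setXTT /mu [LHS]product_measure1E//.
  by rewrite EFinM !fineK.
Qed.

End marked_points.

Section tuple_conf_int.
Context {K : realType} {d : measure_display} {S : measurableType d}.
Variable mu : {sigma_finite_measure set S -> \bar K}.
Variable r : S -> S -> bool.

(** For a 0-1 interaction the thinned indicator is again an indicator: choosing z shrinks W to its
    points compatible with z, and the induction runs over all W. *)
Lemma tuple_measure_pairwise n (W : set S) : symmetric r ->
  tuple_measure mu n [set t | (forall i, W (tnth t i)) /\
    forall i j : 'I_n, i != j -> r (tnth t i) (tnth t j)] =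
  conf_int mu (fun x y => (r x y)%:R) n (\1_W).
Proof.
move=> rC; elim: n W => [|n IH] W.
  by rewrite /= diracE mem_set//; split=> -[].
rewrite tuple_measureS [RHS]/=; apply: eq_integral => z _.
pose Wz : set S := [set y | W y /\ r z y].
have -> : (fun y => \1_W y * (r z y)%:R) = \1_Wz :> (S -> K).
  apply/funext => y; rewrite !indicE -natrM; congr (_%:R).
  have [Wy|Wy] := pselect (W y); last first.
    by rewrite !memNset// => -[].
  rewrite (mem_set Wy) mul1n; congr nat_of_bool.
  by apply/idP/idP => [h|/set_mem[]//]; apply/mem_set.
rewrite -IH indicE; have [Wx|Wx] := pselect (W z); last first.
  rewrite memNset// mul0e (_ : [set t | _] = set0) ?measure0//.
  by apply/seteqP; split => t //= [/(_ ord0)].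
rewrite mem_set// mul1e; congr (tuple_measure mu n _); apply/seteqP; split => t /=.
  move=> [Wt rt]; split => [i|i j ij].
    by split;
      [have := Wt (lift ord0 i); rewrite tnthS|have := rt ord0 (lift ord0 i); rewrite tnthS; apply].
  by have := rt (lift ord0 i) (lift ord0 j); rewrite !tnthS; apply;
    apply: contra ij => /eqP/lift_inj ->.
move=> [Wt rt]; split => [i|i j].
  by have [j ->|->] := unliftP ord0 i; rewrite ?tnthS//; have [] := Wt j.
have [i' ->|->] := unliftP ord0 i; have [j' ->|->] := unliftP ord0 j; rewrite ?tnthS//.
- by move=> ij; apply: rt; apply: contra ij => /eqP ->.
- by move=> _; rewrite rC; have [] := Wt i'.
- by move=> _; have [] := Wt j'.
Qed.

End tuple_conf_int.

(** * Overlap as a condition on distances *)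

Section overlap.
Context {K : realType}.

(* For points of the unit cube, coordinates differ by at most 1, so that
   [minr `|t| (1 - `|t|)] is the distance of [t] to the integers. *)
Definition coord_dist (m : model) (t : K) : K :=
  match m with Torus => Num.min `|t| (1 - `|t|) | Euclidean => `|t| end.

Definition sqdist (m : model) d (x y : d.-tuple K) : K :=
  \sum_(i < d) coord_dist m (tnth x i - tnth y i) ^+ 2.

Lemma sqdist_sym m d (x y : d.-tuple K) : sqdist m x y = sqdist m y x.
Proof. by apply: eq_bigr => i _; rewrite /coord_dist distrC. Qed.

Lemma euclidean_distance_lt d (x y : d.-tuple K) r :
  (euclidean_distance x y < r) =
  (0 < r) && (\sum_(i < d) (tnth x i - tnth y i) ^+ 2 < r ^+ 2).
Proof.
have S0 : 0 <= \sum_(i < d) (tnth x i - tnth y i) ^+ 2.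
  by apply: sumr_ge0 => i _; exact: sqr_ge0.
have [r0|r0] := ltP 0 r; rewrite /euclidean_distance /=.
  by rewrite -[in LHS](@ltr_pXn2r _ 2)// ?nnegrE ?sqrtr_ge0 ?ltW// sqr_sqrtr.
by apply/negbTE; rewrite -leNgt (le_trans r0)// sqrtr_ge0.
Qed.

(* AM-GM: [2 a b <= a^2 s / r + b^2 r / s] *)
Lemma sum_sqr_lt d (u v : 'I_d -> K) r s : 0 < r -> 0 < s ->
  \sum_(i < d) u i ^+ 2 < r ^+ 2 -> \sum_(i < d) v i ^+ 2 < s ^+ 2 ->
  \sum_(i < d) (u i + v i) ^+ 2 < (r + s) ^+ 2.
Proof.
move=> r0 s0 ur vs.
have rs : 0 < r + s by rewrite addr_gt0.
apply: (@le_lt_trans _ _ ((r + s) / r * (\sum_(i < d) u i ^+ 2) +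
    (r + s) / s * \sum_(i < d) v i ^+ 2)).
  rewrite !mulr_sumr -big_split/=; apply: ler_sum => i _.
  rewrite -subr_ge0.
  have -> : (r + s) / r * u i ^+ 2 + (r + s) / s * v i ^+ 2 - (u i + v i) ^+ 2 =
     (s * u i - r * v i) ^+ 2 / (r * s).
    by field; rewrite !gt_eqF.
  by rewrite divr_ge0 ?sqr_ge0// mulr_ge0 ?ltW.
have -> : (r + s) ^+ 2 = (r + s) / r * r ^+ 2 + (r + s) / s * s ^+ 2.
  by field; rewrite !gt_eqF.
by apply: ltrD; rewrite ltr_pM2l// divr_gt0.
Qed.

Let sum_sqrZ d (u : 'I_d -> K) (k r : K) : 0 < r -> 0 <= k ->
  \sum_(i < d) u i ^+ 2 < r ^+ 2 -> 0 < k ->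
  \sum_(i < d) (k * u i) ^+ 2 < (k * r) ^+ 2.
Proof.
move=> r0 k0 ur k1; under eq_bigr do rewrite exprMn.
by rewrite -mulr_sumr exprMn ltr_pM2l// exprn_gt0.
Qed.

Lemma overlap_Euclidean d (x y : d.-tuple K) r s :
  overlap Euclidean x r y s <->
  [&& 0 < r, 0 < s & sqdist Euclidean x y < (r + s) ^+ 2].
Proof.
have sE : sqdist Euclidean x y = \sum_(i < d) (tnth x i - tnth y i) ^+ 2.
  by apply: eq_bigr => i _; rewrite /= real_normK ?num_real.
rewrite sE; split.
  move=> [z [/=]]; rewrite !euclidean_distance_lt => /andP[r0 xz] /andP[s0 yz].
  rewrite r0 s0/=.
  rewrite (eq_bigr (fun i => ((tnth x i - tnth z i) + (tnth z i - tnth y i)) ^+ 2)).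
    apply: sum_sqr_lt => //; rewrite (eq_bigr (fun i => (tnth y i - tnth z i) ^+ 2))//.
    by move=> i _; rewrite -sqrrN opprB.
  by move=> i _; rewrite subrKA.
move=> /and3P[r0 s0 xy]; have rs : 0 < r + s by rewrite addr_gt0.
(* The common point divides the segment from x to y in the ratio r : s. *)
exists [tuple tnth x i + (r / (r + s)) * (tnth y i - tnth x i) | i < d].
split => /=; rewrite euclidean_distance_lt ?r0 ?s0/=.
  have := sum_sqrZ rs (ltW (divr_gt0 r0 rs)) xy (divr_gt0 r0 rs).
  rewrite divfK ?gt_eqF//; congr (_ < _); apply: eq_bigr => i _.
  by rewrite tnth_mktuple; congr (_ ^+ 2); ring.
have := sum_sqrZ rs (ltW (divr_gt0 s0 rs)) xy (divr_gt0 s0 rs).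
rewrite divfK ?gt_eqF//; congr (_ < _); apply: eq_bigr => i _.
rewrite tnth_mktuple -[RHS]sqrrN; congr (_ ^+ 2); field.
by rewrite gt_eqF.
Qed.

(** For |t| <= 1 the nearest integer is 0, 1 or -1. *)
Let near_int (t : K) : `|t| <= 1 -> exists k : int,
  (t - k%:~R) ^+ 2 = coord_dist Torus t ^+ 2.
Proof.
move=> t1; rewrite /coord_dist; have [h|h] := leP `|t| (1 - `|t|).
  by exists 0; rewrite subr0 real_normK ?num_real.
have [t0|t0] := leP 0 t.
  by exists 1; rewrite ger0_norm//; ring.
by exists (-1); rewrite ltr0_norm// mulrN1z; ring.
Qed.

(** A nonzero integer k has |k| >= 1, whence |t - k| >= 1 - |t|. *)
Let coord_dist_le (t : K) (k : int) : `|t| <= 1 ->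
  coord_dist Torus t ^+ 2 <= (t - k%:~R) ^+ 2.
Proof.
move=> t1.
have c0 : 0 <= coord_dist Torus t.
  by rewrite /coord_dist le_min normr_ge0 subr_ge0.
rewrite -[leRHS]real_normK ?num_real// lerXn2r ?nnegrE//.
rewrite /coord_dist ge_min; have [->|k0] := eqVneq k 0.
  by rewrite subr0 lexx.
apply/orP; right; rewrite lerBlDr.
have k1 : 1 <= `|k%:~R : K|.
  rewrite -intr_norm -[1]/(1%:~R) ler_int.
  by rewrite -gtz0_ge1 normr_gt0.
rewrite (le_trans k1)// addrC; have := ler_normB t (t - k%:~R).
by rewrite subKr.
Qed.

Lemma overlap_Torus d (x y : d.-tuple K) r s : unit_cube d x -> unit_cube d y ->
  overlap Torus x r y s <->
  [&& 0 < r, 0 < s & sqdist Torus x y < (r + s) ^+ 2].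
Proof.
move=> cx cy.
have xy1 i : `|tnth x i - tnth y i| <= 1.
  have /andP[? ?] := cx i; have /andP[? ?] := cy i.
  by rewrite ler_norml; apply/andP; split; lra.
split.
  move=> [z [/= [a + az] [b + bz]]].
  rewrite !euclidean_distance_lt => /andP[r0 xa] /andP[s0 yb].
  rewrite r0 s0/=.
  (* The two lifts a and b of the common point differ by the integer vector k, and the displacement
     from y to x is at least as short as the one shifted by k. *)
  pose k i : int := Num.floor (tnth a i) - Num.floor (tnth b i).
  have ab i : tnth a i = tnth b i + (k i)%:~R.
    have := congr1 (fun t => tnth t i) (etrans az (esym bz)).
    rewrite /mod1 !tnth_map /k intrB => e; lra.
  apply: (@le_lt_trans _ _ (\sum_(i < d) ((tnth x i - tnth a i) + (tnth b i - tnth y i)) ^+ 2)).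
    apply: ler_sum => i _; apply: le_trans (coord_dist_le (k i) (xy1 i)) _.
    rewrite le_eqVlt; apply/orP; left; apply/eqP; congr (_ ^+ 2).
    by rewrite ab; ring.
  apply: sum_sqr_lt => //; rewrite (eq_bigr (fun i => (tnth y i - tnth b i) ^+ 2))//.
  by move=> i _; rewrite -sqrrN opprB.
move=> /and3P[r0 s0 xy]; have rs : 0 < r + s by rewrite addr_gt0.
have [k hk] : exists k : 'I_d -> int, forall i,
    (tnth x i - tnth y i - (k i)%:~R) ^+ 2 = coord_dist Torus (tnth x i - tnth y i) ^+ 2.
  exists (fun i => sval (cid (near_int (xy1 i)))) => i.
  exact: (svalP (cid (near_int (xy1 i)))).
pose w i := tnth x i - tnth y i - (k i)%:~R.
have {}xy : \sum_(i < d) w i ^+ 2 < (r + s) ^+ 2.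
  by apply: le_lt_trans xy; apply: ler_sum => i _; rewrite /w hk.
(* The point b lies on the shortest displacement w starting at y; a is the lift of the same torus
   point that is close to x. *)
pose b := [tuple tnth y i + (s / (r + s)) * w i | i < d].
pose a := [tuple tnth b i + (k i)%:~R | i < d].
exists (mod1 b); split.
  exists a => /=; last first.
    apply: eq_from_tnth => i; rewrite /mod1 [LHS]tnth_map [RHS]tnth_map.
    have -> : tnth a i = tnth b i + (k i)%:~R by rewrite tnth_mktuple.
    rewrite floorDrz ?intr_int// intrKfloor intrD; ring.
  rewrite euclidean_distance_lt r0/=.
  have := sum_sqrZ rs (ltW (divr_gt0 r0 rs)) xy (divr_gt0 r0 rs).
  rewrite divfK ?gt_eqF//; congr (_ < _); apply: eq_bigr => i _.
  rewrite !tnth_mktuple; congr (_ ^+ 2); rewrite /w; field.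
  by rewrite gt_eqF.
exists b => //=; rewrite euclidean_distance_lt s0/=.
have := sum_sqrZ rs (ltW (divr_gt0 s0 rs)) xy (divr_gt0 s0 rs).
rewrite divfK ?gt_eqF//; congr (_ < _); apply: eq_bigr => i _.
by rewrite !tnth_mktuple -[RHS]sqrrN; congr (_ ^+ 2); ring.
Qed.

Lemma overlapP m d (x y : d.-tuple K) r s : unit_cube d x -> unit_cube d y ->
  overlap m x r y s <-> [&& 0 < r, 0 < s & sqdist m x y < (r + s) ^+ 2].
Proof.
by case: m; [exact: overlap_Torus|move=> _ _; exact: overlap_Euclidean].
Qed.

End overlap.

Lemma measure_integral_indic {K : realType} {d : measure_display}
    {T : measurableType d} (mu : {measure set T -> \bar K}) (A : set T) :
  measurable A -> mu A = (\int[mu]_x (\1_A x)%:E)%E.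
Proof. by move=> mA; rewrite integral_indic// setIT. Qed.

Section product_integrals.
Context {K : realType} {d d' : measure_display}.
Context {S : measurableType d} {T : measurableType d'}.
Variable mu : {sigma_finite_measure set S -> \bar K}.
Variable nu : {sigma_finite_measure set T -> \bar K}.

Lemma ge0_integral_prod_swap (f : S * T -> \bar K) :
  measurable_fun setT f -> (forall z, 0 <= f z)%E ->
  (\int[sigma_prod mu nu]_z f z = \int[nu]_y \int[mu]_x f (x, y))%E.
Proof.
by move=> mf f0; rewrite ge0_integral_prod// (fubini_tonelli f mf f0).
Qed.

Lemma ge0_integral_prod_fst (A : set S) (g : T -> \bar K) : measurable A ->
  measurable_fun setT g -> (forall y, 0 <= g y)%E ->
  (\int[sigma_prod mu nu]_z ((\1_A z.1)%:E * g z.2) = mu A * \int[nu]_y g y)%E.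
Proof.
move=> mA mg g0; rewrite ge0_integral_prod_swap; last 2 first.
- apply: emeasurable_funM; last exact: (measurableT_comp mg).
  apply: measurableT_comp => //.
  exact: (measurableT_comp (measurable_indic mA) measurable_fst).
- by move=> z; apply: mule_ge0 => //; rewrite lee_fin.
rewrite -ge0_integralZl//=; apply: eq_integral => y _ /=.
rewrite ge0_integralZr//=; last by do 2 apply: measurableT_comp => //.
by rewrite measure_integral_indic.
Qed.

End product_integrals.

Section regions.
Context {K : realType} {dO : measure_display} {O : measurableType dO}.
Variables (Q : probability O K) (d : nat).

Local Notation vol := (@lebesgue_tuple K d).
Local Notation mu := (sigma_prod vol Q).

Definition region_weight (k : K) (A : set (d.-tuple K)) : d.-tuple K * O -> K :=
  fun z => k * \1_A z.1.

Section region.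
Variables (k : K) (A : set (d.-tuple K)).
Hypothesis k_ge0 : 0 <= k.
Hypothesis mA : measurable A.
Hypothesis A_fin : (vol A < +oo)%E.

Let m1A : measurable_fun [set: d.-tuple K * O] (fun z => (\1_A z.1)%:E : \bar K).
Proof.
apply: measurableT_comp => //.
exact: (measurableT_comp (measurable_indic mA) measurable_fst).
Qed.

Let integral_region : (\int[mu]_z (region_weight k A z)%:E = k%:E * vol A)%E.
Proof.
rewrite /region_weight; under eq_integral do rewrite EFinM.
rewrite ge0_integralZl//; congr (_ * _)%E.
have := @ge0_integral_prod_fst _ _ _ _ _ vol Q A (cst 1%E) mA (measurable_cst _).
rewrite [X in _ -> _ = (_ * X)%E]integral_cst// [X in _ -> _ = (_ * (_ * X))%E](probability_setT Q).
by rewrite !mule1 => <-//; apply: eq_integral => z _; rewrite mule1.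
Qed.

Lemma finite_weight_region : finite_weight mu (region_weight k A).
Proof.
split; last by rewrite integral_region lte_mul_pinfty ?lee_fin.
split; last by move=> z; rewrite mulr_ge0.
by apply: measurable_funM => //; exact/measurable_EFinP.
Qed.

Lemma mass_region : mass mu (region_weight k A) = k * fine (vol A).
Proof.
by rewrite /mass integral_region fineM//= ge0_fin_numE//; exact: (measure_ge0 vol).
Qed.

End region.

End regions.

Section cube_weight.
Context {K : realType} {dO : measure_display} {O : measurableType dO}.
Variables (Q : probability O K) (d : nat) (lambda : K).
Hypothesis lambda_gt0 : 0 < lambda.

Let cube_fin : (lebesgue_tuple d (@unit_cube K d) < +oo)%E.
Proof. by rewrite lebesgue_tuple_cube ltry. Qed.

Lemma finite_weight_cube : finite_weight (sigma_prod (lebesgue_tuple d) Q)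
  (fun z : d.-tuple K * O => lambda * \1_(unit_cube d) z.1).
Proof. exact: finite_weight_region (ltW lambda_gt0) (@measurable_unit_cube K d) cube_fin. Qed.

Lemma mass_cube : mass (sigma_prod (lebesgue_tuple d) Q)
  (fun z : d.-tuple K * O => lambda * \1_(unit_cube d) z.1) = lambda.
Proof.
have := mass_region Q (ltW lambda_gt0) (@measurable_unit_cube K d) cube_fin.
by rewrite /region_weight [X in _ = _ * fine X -> _](lebesgue_tuple_cube d) mulr1.
Qed.

End cube_weight.

Section change_of_variables.
Context {K : realType} {d d' : measure_display}.
Context {S : measurableType d} {S' : measurableType d'}.
Variables (mu : {sigma_finite_measure set S -> \bar K}).
Variables (mu' : {sigma_finite_measure set S' -> \bar K}).
Variables (T : S -> S') (w : S -> K).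
Variables (c : S -> S -> K) (c' : S' -> S' -> K).
Hypothesis cc' : compatibility c'.
Hypothesis cT : forall x y, c x y = c' (T x) (T y).
Hypothesis muT : forall h : S' -> \bar K, measurable_fun setT h ->
  (forall x, 0 <= h x)%E ->
  (\int[mu']_z h z = \int[mu]_x ((w x)%:E * h (T x)))%E.

(** Each point contributes one density factor w, which is absorbed into the pulled-back weight. *)
Lemma conf_int_transfer n f : weight f ->
  conf_int mu' c' n f = conf_int mu c n (fun x => w x * f (T x)).
Proof.
elim: n f => [//|n IH] f wf /=.
rewrite muT; last 2 first.
- apply: emeasurable_funM; last exact: measurable_conf_int_thin.
  by apply: measurableT_comp => //; case: wf.
- move=> z; apply: mule_ge0; first by rewrite lee_fin weight_ge0.
  exact: conf_int_thin_ge0.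
apply: eq_integral => x _; rewrite IH; last exact: weight_thin.
rewrite EFinM muleA; congr (_ * conf_int _ _ _ _)%E.
by apply/funext => y; rewrite cT mulrA.
Qed.

End change_of_variables.

Section hard_sphere_compatibility.
Context {K : realType}.

Lemma measurable_sqdist m d dS (S : measurableType dS) (f g : S -> d.-tuple K) :
  measurable_fun [set: S] f -> measurable_fun [set: S] g ->
  measurable_fun [set: S] (fun z => sqdist m (f z) (g z)).
Proof.
move=> mf mg; apply: measurable_sum => i; apply: measurable_funX.
have mt : measurable_fun [set: S] (fun z => tnth (f z) i - tnth (g z) i).
  by apply: measurable_funB;
    [exact: (measurableT_comp (measurable_tnth i) mf)
    |exact: (measurableT_comp (measurable_tnth i) mg)].
have mn : measurable_fun [set: S] (fun z => `|tnth (f z) i - tnth (g z) i|).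
  exact: (measurableT_comp (@normr_measurable K setT) mt).
case: m => //=; apply: measurable_minr => //.
exact: measurable_funB.
Qed.

(** Here a mark is an arbitrary real radius. A sphere of nonpositive radius is empty and overlaps
    nothing, hence the two sign tests. *)
Definition mark_free (m : model) d (z z' : d.-tuple K * K) : bool :=
  ~~ [&& 0 < z.2, 0 < z'.2 & sqdist m z.1 z'.1 < (z.2 + z'.2) ^+ 2].

Lemma mark_free_sym m d : symmetric (@mark_free m d).
Proof. by move=> z z'; rewrite /mark_free sqdist_sym addrC andbCA. Qed.

Lemma compatibility_indicator d (S : measurableType d) (r : S -> S -> bool) :
  symmetric r -> measurable_fun setT (fun z : S * S => r z.1 z.2) ->
  compatibility (fun x y => (r x y)%:R : K).
Proof.
move=> rC mr; split.
- by apply: (measurableT_comp (f := fun b : bool => b%:R : K)).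
- by move=> x y; case: (r x y); rewrite ?lexx ?ler01.
- by move=> x y; rewrite rC.
Qed.

Lemma measurable_mark_free m d : measurable_fun setT
  (fun z : (d.-tuple K * K) * (d.-tuple K * K) => mark_free m z.1 z.2).
Proof.
apply: measurable_neg; apply: measurable_and.
  by apply: measurable_fun_ltr => //; exact: measurableT_comp.
apply: measurable_and.
  by apply: measurable_fun_ltr => //; exact: measurableT_comp.
apply: measurable_fun_ltr.
  by apply: measurable_sqdist; exact: measurableT_comp.
by apply: measurable_funX; apply: measurable_funD; exact: measurableT_comp.
Qed.

Lemma compatibility_mark_free m d : compatibility (fun z z' => (@mark_free m d z z')%:R : K).
Proof.
apply: compatibility_indicator; first exact: mark_free_sym.
exact: measurable_mark_free.
Qed.

Section random_radius.
Context {dO : measure_display} {O : measurableType dO}.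

(** With sample points as marks, the marked space does not depend on lambda. This replaces
    [mark_free] only for positive radii, for which the sign tests hold. *)
Definition sphere_free (m : model) d (R : O -> K) (L : K)
    (z z' : d.-tuple K * O) : bool :=
  ~~ (sqdist m z.1 z'.1 < ((R z.2 + R z'.2) / L) ^+ 2).

Definition sphere_compat m d (R : O -> K) (L : K) (z z' : d.-tuple K * O) : K :=
  (sphere_free m R L z z')%:R.

Lemma compatibility_sphere m d (R : {mfun O >-> K}) L :
  compatibility (@sphere_compat m d R L).
Proof.
apply: compatibility_indicator.
  by move=> z z'; rewrite /sphere_free sqdist_sym addrC.
apply: measurable_neg; apply: measurable_fun_ltr.
  by apply: measurable_sqdist; exact: measurableT_comp.
apply: measurable_funX; apply: measurable_funM => //.
apply: measurable_funD; apply: (measurableT_comp (f := R)) => //; exact: measurableT_comp.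
Qed.

End random_radius.

End hard_sphere_compatibility.

Lemma ge0_integral_mrestr {K : realType} {d : measure_display}
    {T : measurableType d} (mu : {measure set T -> \bar K}) (D : set T)
    (mD : measurable D) (f : T -> \bar K) :
  measurable_fun setT f -> (forall x, 0 <= f x)%E ->
  (\int[mrestr mu mD]_x f x = \int[mu]_(x in D) f x)%E.
Proof.
move=> mf f0; have mC := measurableC mD.
pose a : {measure set T -> \bar K} := mrestr mu mD.
pose b : {measure set T -> \bar K} := mrestr mu mC.
have muE : (\int[mu]_(x in D) f x = \int[measure_add a b]_(x in D) f x)%E.
  apply: eq_measure_integral => A mA AD.
  rewrite [RHS]measure_addE /a /b /= /mrestr (setIidl AD) (_ : A `&` ~` D = set0).
    by rewrite measure0 adde0.
  by apply/seteqP; split => x //= -[/AD].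
rewrite muE ge0_integral_measure_add//; last exact: measurable_funTS.
rewrite [X in (_ + X)%E](_ : _ = 0)%E ?adde0; last first.
  rewrite null_set_integral//; first exact: measurable_funTS.
  by rewrite /b /= /mrestr setICr measure0.
rewrite (@ge0_negligible_integral _ _ _ a setT (~` D))// ?setTD ?setCK//.
by rewrite /a /= /mrestr setICl measure0.
Qed.

Section link.
Context {K : realType} {dO : measure_display} {O : measurableType dO}.
Variables (Q : probability O K) (R R' : {RV Q >-> K}) (m : model) (d : nat).
Variables (eta lambda p : K).
Hypothesis lambda_gt0 : 0 < lambda.
Hypothesis R'_gt0 : forall w, 0 < R' w.
Hypothesis RR' : {ae Q, forall w, R w = R' w}.

Let L := lambda `^ eta.
Let L_gt0 : 0 < L. Proof. exact: powR_gt0. Qed.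

Local Notation vol := (@lebesgue_tuple K d).
Local Notation cube := (@unit_cube K d).

Let scaled (w : O) : K := R' w / L.
Let mscaled : measurable_fun setT scaled.
Proof. by apply: measurable_funM. Qed.
Let scaled_rv : {RV Q >-> K} := HB.pack scaled
  (isMeasurableFun.Build _ _ _ _ scaled mscaled).

Let nu : {sigma_finite_measure set K -> \bar K} := distribution Q scaled_rv.

Let volcube_fin : (vol cube < +oo)%E.
Proof. by rewrite lebesgue_tuple_cube ltry. Qed.

Let alpha : {sigma_finite_measure set (d.-tuple K) -> \bar K} :=
  mfrestr (@measurable_unit_cube K d) volcube_fin.

Let free := (fun z z' => (@mark_free K m d z z')%:R : K).

Let W : d.-tuple K * O -> K := fun z => \1_cube z.1.

Let weightW : weight W.
Proof.
split; last by move=> z; rewrite /W indicE.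
exact: (measurableT_comp (measurable_indic (@measurable_unit_cube K d))).
Qed.

Let massW : (\int[sigma_prod vol Q]_z (W z)%:E = 1)%E.
Proof.
have := massE (finite_weight_cube Q d ltr01); rewrite mass_cube// => <-.
by apply: eq_integral => z _; rewrite mul1r.
Qed.

(** Change of marks from radii to sample points, and from a measure restricted to the cube to a
    weight carrying the indicator of the cube. *)
Lemma law_transfer n : conf_int (sigma_prod alpha nu) free n (\1_setT) =
  conf_int (sigma_prod vol Q) (sphere_compat m R' L) n W.
Proof.
have cf : compatibility free by exact: compatibility_mark_free.
have cs : compatibility (@sphere_compat K dO O m d R' L) by exact: compatibility_sphere.
transitivity (conf_int (sigma_prod vol Q) (sphere_compat m R' L) n
  (fun x => W x * \1_[set: d.-tuple K * K] (x.1, R' x.2 / L))).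
  apply: (conf_int_transfer (T := fun z => (z.1, R' z.2 / L))) => //.
  - move=> x y; rewrite /sphere_compat /sphere_free /free /mark_free /=.
    by rewrite !divr_gt0//= mulrDl.
  - move=> h mh h0; rewrite ge0_integral_prod//.
    pose g x := (\int[Q]_w h (x, R' w / L)%R)%E.
    have mR'L : measurable_fun [set: d.-tuple K * O]
        (fun z => (z.1, R' z.2 / L)%R : d.-tuple K * K).
      apply: measurable_fun_pair => //; apply: measurable_funM => //.
      exact: (measurableT_comp (f := R')).
    have mhz : measurable_fun [set: d.-tuple K * O] (fun z => h (z.1, R' z.2 / L)%R).
      exact: (measurableT_comp mh mR'L).
    have mg : measurable_fun setT g.
      exact: (measurable_fun_fubini_tonelli_F (m2 := Q) (fun z => h (z.1, R' z.2 / L)%R)).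
    have -> : (\int[alpha]_x \int[nu]_y h (x, y) = \int[alpha]_x g x)%E.
      apply: eq_integral => x _.
      rewrite (@ge0_integral_distribution _ _ _ _ _ Q scaled_rv (fun y => h (x, y)))//.
      exact: (measurableT_comp mh (@measurable_pair1 _ _ _ _ x)).
    rewrite ge0_integral_mrestr//; last first.
      by move=> x; apply: integral_ge0.
    rewrite ge0_integral_prod; last 2 first.
    + apply: emeasurable_funM => //; apply: measurableT_comp => //.
      by case: weightW.
    + by move=> z; apply: mule_ge0; rewrite ?lee_fin.
    rewrite integral_mkcond; apply: eq_integral => x _.
    rewrite patchE /W /=; under eq_integral do rewrite /=.
    rewrite indicE; case: ifPn => _.
      by apply: eq_integral => w _; rewrite mul1e.
    by rewrite integral0_eq// => w _; rewrite mul0e.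
rewrite /W; congr (conf_int _ _ _ _); apply/funext => z.
by rewrite [X in _ * X]indicE mem_set// mulr1.
Qed.

(** The event is cut along the value n of [N]. On each piece the condition is invariant under
    permutations, so the symmetrized law gives n! times one probability, and the pieces sum to the
    series of the partition function. *)
Lemma no_overlap_probabilityE : no_overlap_probability R m d eta lambda p ->
  p = expR (- lambda) *
    partition_function (sigma_prod vol Q) (sphere_compat m R' L)
      (fun z => lambda * W z).
Proof.
move=> [dT [T [P [N [X [rho [poissonX indrho lawrho indep Pno]]]]]]].
have [Xcube _ _] := poissonX.
(* R and R' agree off the null set M, so the scaled radii have the same law. *)
have nuE B : measurable B -> forall i, P (rho i @^-1` B) = nu B.
  move=> mB i; rewrite lawrho// /nu /= /distribution /pushforward.
  have [M [mM M0 sM]] := RR'.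
  have mR (Y : {RV Q >-> K}) : measurable [set w | B (Y w / L)].
    rewrite (_ : [set w | _] = (fun w => Y w / L) @^-1` B)//.
    rewrite -[Z in measurable Z]setTI.
    suff : measurable_fun [set: O] (fun w => Y w / L) by apply.
    exact: measurable_funM.
  suff le (Y Y' : {RV Q >-> K}) : (forall w, ~ M w -> Y w = Y' w) ->
      (Q [set w | B (Y w / L)%R] <= Q [set w | B (Y' w / L)%R])%E.
    have RM w : ~ M w -> R w = R' w.
      by move=> nM; apply: contrapT => h; apply: nM; exact: sM.
    by apply/eqP; rewrite eq_le; apply/andP; split; apply: le => w /RM.
  move=> YY.
  apply: (@le_trans _ _ (Q ([set w | B (Y' w / L)%R] `|` M))).
    apply: le_measure; rewrite ?inE//; first exact: measurableU.
    by move=> w /= h; have [Mw|nM] := pselect (M w); [right|left; rewrite -YY].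
  have := measureU2 Q (mR Y') mM.
  by rewrite [X in (_ <= _ + X)%E -> _]M0 adde0.
have mN k : measurable [set w | N w = k].
  rewrite (_ : [set w | _] = N @^-1` [set k])//.
  by rewrite -[X in measurable X]setTI; exact: measurable_funPT.
pose A n : set (n.-tuple (d.-tuple K * K)%type) := [set t | (forall i, setT (tnth t i)) /\
    forall i j : 'I_n, i != j -> mark_free m (tnth t i) (tnth t j)].
have mA n : measurable (A n).
  rewrite (_ : A n = \bigcap_(i in [set: 'I_n]) \bigcap_(j in [set: 'I_n])
      (fun t : n.-tuple (d.-tuple K * K)%type =>
         (i == j) || mark_free m (tnth t i) (tnth t j)) @^-1` [set true]).
    apply: fin_bigcap_measurable => // i _; apply: fin_bigcap_measurable => // j _.
    rewrite -[X in measurable X]setTI.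
    suff : measurable_fun [set: n.-tuple (d.-tuple K * K)%type]
        (fun t => (i == j) || mark_free m (tnth t i) (tnth t j)) by apply.
    apply: measurable_or => //.
    apply: (measurableT_comp (@measurable_mark_free K m d)
      (g := fun t : n.-tuple (d.-tuple K * K)%type => (tnth t i, tnth t j))).
    by apply: measurable_fun_pair; exact: measurable_tnth.
  apply/seteqP; split => t /=.
    by move=> [_ h] i _ j _ /=; have [//|ij] := eqVneq i j; exact: h.
  by move=> h; split => // i j ij; have := h i I j I; rewrite (negbTE ij).
pose Zp n (s : 'S_n) w := [tuple (X (s i) w, rho (s i) w) | i < n].
pose E n (s : 'S_n) := [set w | N w = n /\ A n (Zp n s w)].
have mE n s : measurable (@E n s).
  rewrite (_ : @E n s = [set w | N w = n] `&` Zp n s @^-1` A n)//.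
  apply: measurableI; first exact: mN.
  rewrite -[X in measurable X]setTI.
  suff : measurable_fun [set: T] (Zp n s) by move=> /(_ measurableT _ (mA n)).
  apply/measurable_fun_tnthP => i.
  rewrite (_ : _ \o _ = (fun w => (X (s i) w, rho (s i) w))).
    by apply: measurable_fun_pair; exact: measurable_funPT.
  by apply/funext => w /=; rewrite tnth_mktuple.
have Esym n (s : 'S_n) : E n s = E n 1%g.
  apply/seteqP; split => w [Nw [_ h]]; split => //; split => // i j ij.
    have := h ((s^-1)%g i) ((s^-1)%g j).
    by rewrite !tnth_mktuple !permKV !perm1; apply; rewrite (inj_eq perm_inj).
  have := h (s i) (s j).
  by rewrite !tnth_mktuple !perm1; apply; rewrite (inj_eq perm_inj).
(* Centres are independent of radii, and the relabelled radii stay independent because s is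
   injective. *)
have box n (s : 'S_n) (C : 'I_n -> set (d.-tuple K)) (D : 'I_n -> set K) :
    (forall i, measurable (C i)) -> (forall i, measurable (D i)) ->
    (P [set w | N w = n /\ forall i, C i (X (s i) w) /\ D i (rho (s i) w)] =
     P [set w | N w = n /\ forall i, C i (X (s i) w)] * \prod_(i < n) nu (D i))%E.
  move=> mC mD.
  have -> : [set w | N w = n /\ forall i, C i (X (s i) w) /\ D i (rho (s i) w)] =
      [set w | N w = n /\ forall i, C i (X (s i) w)] `&`
      [set w | forall i, D i (rho (s i) w)].
    apply/seteqP; split => w /=.
      by move=> [Nw h]; split; [split => // i|move=> i]; case: (h i).
    by move=> [[Nw h1] h2]; split => // i; split.
  rewrite indep.
  - congr (_ * _)%E; have sI : injective (fun i : 'I_n => s i : nat).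
      by move=> i j /val_inj /perm_inj.
    rewrite (independent_finite indrho sI mD).
    by apply: eq_bigr => i _; exact: nuE.
  - pose V := g_sigma_algebraType (events_of N `|` \bigcup_i events_of (X i)).
    suff : measurable ([set w | N w = n /\ forall i, C i (X (s i) w)] : set V) by [].
    rewrite (_ : [set w | _] = [set w | N w = n] `&`
        \bigcap_(i in [set: 'I_n]) [set w | C i (X (s i) w)]); last first.
      by apply/seteqP; split => w /= [? h]; split => // i; [move=> _|]; exact: h.
    apply: (@measurableI _ V).
      by apply: sub_sigma_algebra; left; exists [set n] => //; rewrite setTI.
    apply: (@fin_bigcap_measurable _ V) => // i _.
    apply: sub_sigma_algebra; right; exists (s i : nat) => //.
    by exists (C i) => //; rewrite setTI.
  - pose V := g_sigma_algebraType (\bigcup_i events_of (rho i)).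
    suff : measurable ([set w | forall i, D i (rho (s i) w)] : set V) by [].
    rewrite (_ : [set w | _] = \bigcap_(i in [set: 'I_n]) [set w | D i (rho (s i) w)]).
      apply: (@fin_bigcap_measurable _ V) => // i _.
      apply: sub_sigma_algebra; exists (s i : nat) => //.
      by exists (D i) => //; rewrite setTI.
    by apply/seteqP; split => w /= h i; [move=> _|]; exact: h.
have lawn n : (\sum_(s : 'S_n) P (E n s) = (expR (- lambda) * lambda ^+ n)%:E *
    conf_int (sigma_prod vol Q) (sphere_compat m R' L) n W)%E.
  rewrite -law_transfer -(tuple_measure_pairwise _ _ _ (@mark_free_sym _ _ _)).
  apply: (@marked_points_law K dT _ _ T _ _ P [set w | N w = n] (mN n) n
    (fun i => X i) (fun i => rho i) alpha nu).
  - by rewrite mulr_ge0 ?expR_ge0// exprn_ge0// ltW.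
  - by rewrite /alpha /= /mfrestr /mrestr setTI lebesgue_tuple_cube ltry.
  - by rewrite /nu /= probability_setT ltry.
  - move=> C D mC mD; under eq_bigr do rewrite (box n _ C D mC mD).
    rewrite -ge0_sume_distrl//.
    rewrite (sum_perm_box_prob lambda_gt0 poissonX mC) big_split/= muleA.
    congr (_ * _ * _)%E; apply: eq_bigr => i _.
    by rewrite /alpha /= /mfrestr /mrestr setIC.
  - exact: mA.
have noE : no_overlap_event m N X rho = \bigcup_n E n 1%g.
  apply/seteqP; split => w.
    move=> h; exists (N w) => //; split => //; split => // i j ij.
    rewrite !tnth_mktuple !perm1; wlog : i j ij / (i < j)%N.
      move=> H; have /orP[ij'|ij'] : (i < j)%N || (j < i)%N by rewrite -neq_ltn.
        exact: H.
      by rewrite mark_free_sym; apply: H => //; rewrite eq_sym.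
    move=> ij'; apply/negP => o; apply: (h i j); first by rewrite ij' ltn_ord.
    by apply/overlapP => //; exact: Xcube.
  move=> [n _ [Nw [_ h]]] i j; rewrite Nw => /andP[ij jn] o.
  have := h (Ordinal (ltn_trans ij jn)) (Ordinal jn).
  rewrite !tnth_mktuple !perm1 /= -val_eqE /= neq_ltn ij => /(_ isT) /negP; apply.
  by apply/overlapP => //; apply: Xcube; rewrite Nw// (ltn_trans ij).
have ffin : finite_weight (sigma_prod vol Q) (fun z => lambda * W z).
  exact: finite_weight_cube.
have cs : compatibility (@sphere_compat K dO O m d R' L) by exact: compatibility_sphere.
have PE n : P (E n 1%g) = (expR (- lambda) * (fine (conf_int (sigma_prod vol Q)
    (sphere_compat m R' L) n (fun z => lambda * W z)) / n`!%:R))%:E.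
  have := lawn n; under eq_bigr do rewrite Esym.
  have Fn : conf_int (sigma_prod vol Q) (sphere_compat m R' L) n W \is a fin_num.
    rewrite ge0_fin_numE; last exact: conf_int_ge0.
    apply: le_lt_trans (conf_int_le_exp _ cs _ weightW) _.
    by rewrite massW -EFin_expe expr1n ltry.
  rewrite conf_intZ//; last exact: ltW.
  have PF : P (E n 1%g) \is a fin_num by exact: fin_num_measure.
  rewrite -(fineK Fn) -(fineK PF) -EFinM /= sumEFin => -[].
  rewrite sumr_const card_Sn => e; congr EFin.
  rewrite !mulrA -e -(mulr_natr (fine _)) mulfK// pnatr_eq0 -lt0n fact_gt0.
have cvgP : (fun n => \sum_(0 <= i < n) P (E i 1%g))%E @ \oo --> p%:E.
  rewrite -Pno noE; apply: (@measure_semi_sigma_additive _ _ _ P (fun n => E n 1%g)).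
  - by [].
  - apply/trivIsetP => i j _ _ /eqP ij; apply/seteqP; split => [w|w []].
    by move=> [[Nw _] [Nw' _]]; exact: ij (etrans (esym Nw) Nw').
  - exact: bigcupT_measurable.
have := @partition_function_cvg _ _ _ (sigma_prod vol Q) _ cs _ ffin.
move=> /(@cvgMl_tmp _ _ _ _ _ (expR (- lambda))) Zcvg.
suff : p%:E = (expR (- lambda) * partition_function (sigma_prod vol Q)
   (sphere_compat m R' L) (fun z => lambda * W z))%:E by move=> [].
apply: (cvg_unique _ cvgP) => //.
apply: cvg_EFin; first by near=> n; under eq_bigr do rewrite PE; rewrite sumEFin.
apply: cvg_trans Zcvg; apply: near_eq_cvg; near=> n.
by rewrite /= /series /= mulr_sumr; under [in RHS]eq_bigr do rewrite PE; rewrite sumEFin.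
Unshelve. all: by end_near.
Qed.

End link.

Lemma tnth_lift_behead n (T : Type) (t : n.+1.-tuple T) i :
  tnth t (lift ord0 i) = tnth [tuple of behead t] i.
Proof. by rewrite {1}(tuple_eta t) tnthS; congr tnth; apply/val_inj. Qed.

(** * Volumes of balls *)

Section affine_substitution.
Context {K : realType}.
Local Notation leb := (@real_lebesgue K).

(** The right-hand side is a measure in A giving ]p, q] its length, which characterizes Lebesgue
    measure. For a < 0 the preimage is closed on the other side, hence the two cases. *)
Lemma real_lebesgue_affine (a b : K) (A : set K) : a != 0 -> measurable A ->
  leb A = (`|a|%:E * leb [set x | A (a * x + b)%R])%E.
Proof.
move=> a0 mA.
pose f : measurableTypeR K -> measurableTypeR K := fun x => a * x + b.
have mf : measurable_fun [set: measurableTypeR K] f.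
  by apply: measurable_funD => //; exact: measurable_funM.
have ap : 0 <= `|a| by [].
pose fm : {mfun measurableTypeR K >-> measurableTypeR K} := HB.pack f
  (isMeasurableFun.Build _ _ _ _ f mf).
pose pm : {measure set (measurableTypeR K) -> \bar K} :=
  pushforward (@lebesgue_measure K) fm.
pose m : {measure set (measurableTypeR K) -> \bar K} :=
  mscale (NngNum ap) (pm mf).
have := @lebesgue_measure_unique K m _ A mA; apply => _ [[p q]] _ <-.
rewrite /m /= /mscale /= /pushforward /=.
have [qp|pq] := leP q p.
  have e0 : `]p, q]%classic = set0 :> set K by apply/seteqP; split => x //=; rewrite in_itv/=; lra.
  by rewrite e0 preimage_set0 !measure0 mule0.
transitivity ((q - p)%:E).
  exact: (real_lebesgue_itv_bounded false false (ltW pq)).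
have [an|ap'] := ltP a 0.
  have -> : fm @^-1` `]p, q] = `[(q - b) / a, (p - b) / a[%classic.
    apply/seteqP; split => x; rewrite /= /f !in_itv/= ler_ndivrMr// ltr_ndivlMr//; lra.
  have := real_lebesgue_itv_bounded true true (a := (q - b) / a) (b := (p - b) / a).
  rewrite /real_lebesgue => ->; last by rewrite ler_nM2r ?invr_lt0//; lra.
  rewrite ltr0_norm// -EFinM; congr EFin; field; exact: a0.
have {}ap' : 0 < a by rewrite lt_neqAle eq_sym a0.
have -> : fm @^-1` `]p, q] = `](p - b) / a, (q - b) / a]%classic.
  apply/seteqP; split => x; rewrite /= /f !in_itv/= ler_pdivlMr// ltr_pdivrMr//; lra.
have := real_lebesgue_itv_bounded false false (a := (p - b) / a) (b := (q - b) / a).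
rewrite /real_lebesgue => ->; last by rewrite ler_pM2r ?invr_gt0//; lra.
rewrite gtr0_norm// -EFinM; congr EFin; field; exact: a0.
Qed.

Lemma ge0_integral_affine (a b : K) (h : K -> \bar K) : a != 0 ->
  measurable_fun setT h -> (forall x, 0 <= h x)%E ->
  (\int[leb]_x h x = `|a|%:E * \int[leb]_x h (a * x + b)%R)%E.
Proof.
move=> a0 mh h0.
pose f : K -> K := fun x => a * x + b.
have mf : measurable_fun [set: K] f.
  by apply: measurable_funD => //; exact: measurable_funM.
have ap : 0 <= `|a| by [].
pose fm : {mfun K >-> K} := HB.pack f (isMeasurableFun.Build _ _ _ _ f mf).
pose pm : {measure set K -> \bar K} := pushforward leb fm.
pose m : {measure set K -> \bar K} := mscale (NngNum ap) (pm mf).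
have -> : (\int[leb]_x h x = \int[m]_x h x)%E.
  by apply: eq_measure_integral => A mA _; exact: real_lebesgue_affine.
rewrite ge0_integral_mscale//=; congr (_ * _)%E.
by rewrite ge0_integral_pushforward.
Qed.

Definition affine_tuple d (a : K) (b x : d.-tuple K) : d.-tuple K :=
  [tuple a * tnth x i + tnth b i | i < d].

Lemma measurable_affine_tuple d a b : measurable_fun setT (@affine_tuple d a b).
Proof.
apply/measurable_fun_tnthP => i.
rewrite (_ : _ \o _ = fun x => a * tnth x i + tnth b i).
  by apply: measurable_funD => //; apply: measurable_funM => //; exact: measurable_tnth.
by apply/funext => x /=; rewrite tnth_mktuple.
Qed.

Lemma ge0_integral_affine_tuple d (a : K) (b : d.-tuple K) (h : d.-tuple K -> \bar K) :
  a != 0 -> measurable_fun setT h -> (forall x, 0 <= h x)%E ->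
  (\int[lebesgue_tuple d]_x h x =
   (`|a| ^+ d)%:E * \int[lebesgue_tuple d]_x h (affine_tuple a b x))%E.
Proof.
move=> a0; elim: d b h => [|d IH] b h mh h0.
  by rewrite mul1e; apply: eq_integral => x _; congr h; rewrite [x]tuple0 [RHS]tuple0.
rewrite /lebesgue_tuple.
rewrite ge0_integral_tupleS//.
have mha : measurable_fun setT (fun x => h (affine_tuple a b x)).
  exact: (measurableT_comp mh (@measurable_affine_tuple _ a b)).
rewrite ge0_integral_tupleS//.
pose g (x : K) := (\int[lebesgue_tuple d]_t h (cons_tuple x t))%E.
have mc : measurable_fun [set: K * d.-tuple K] (fun z => h (pair_cons z)).
  exact: (measurableT_comp mh (@measurable_pair_cons _ _ _)).
have mg : measurable_fun setT g.
  exact: (measurable_fun_fubini_tonelli_F (m2 := lebesgue_tuple d)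
    (fun z : K * d.-tuple K => h (pair_cons z))).
have g0 x : (0 <= g x)%E by apply: integral_ge0.
rewrite -/g.
have mhx x : measurable_fun setT (fun t => h (cons_tuple x t)).
  by apply: (measurableT_comp mc (measurable_pair1 x)).
pose b' := [tuple of behead b].
have cE x t : affine_tuple a b (cons_tuple x t) =
    cons_tuple (a * x + tnth b ord0) (affine_tuple a b' t).
  apply: eq_from_tnth => i; rewrite tnth_mktuple.
  have [j ->|->] := unliftP ord0 i; last by [].
  rewrite !tnthS tnth_mktuple; congr (_ + _).
  by exact: tnth_lift_behead.
transitivity (`|a|%:E * \int[leb]_x g (a * x + tnth b ord0)%R)%E.
  exact: ge0_integral_affine.
rewrite exprS EFinM -muleA; congr (_ * _)%E.
rewrite -ge0_integralZl//=; last 2 first.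
- rewrite (_ : (fun x => _) = fun x => \int[lebesgue_tuple d]_t
     h (affine_tuple a b (cons_tuple x t)))%E//.
  apply: (measurable_fun_fubini_tonelli_F (m2 := lebesgue_tuple d)
    (fun z : K * d.-tuple K => h (affine_tuple a b (pair_cons z)))) => //.
  exact: (measurableT_comp mha (@measurable_pair_cons _ _ _)).
- by move=> x _; apply: integral_ge0.
apply: eq_integral => x _; rewrite /g (IH b')//.
by congr (_ * _)%E; apply: eq_integral => t _; rewrite cE.
Qed.

End affine_substitution.

Section ball_volume.
Context {K : realType}.
Local Notation leb := (@real_lebesgue K).

Definition sqnorm d (x : d.-tuple K) : K := \sum_(i < d) tnth x i ^+ 2.

Lemma measurable_sqnorm d : measurable_fun setT (@sqnorm d).
Proof.
by apply: measurable_sum => i; apply: measurable_funX; exact: measurable_tnth.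
Qed.

(** Balls are indexed by the square s of the radius, so that the slice at first coordinate u is the
    ball of index s - u^2, which is empty when that index is nonpositive. *)
Definition sqball d (s : K) : set (d.-tuple K) := [set x | sqnorm x < s].

Lemma measurable_sqball d s : measurable (@sqball d s).
Proof.
rewrite (_ : sqball s = (@sqnorm d) @^-1` `]-oo, s[%classic).
  by rewrite -[X in measurable X]setTI; exact: measurable_sqnorm.
by apply/seteqP; split => x; rewrite /= in_itv.
Qed.

Definition sqball_volume d (s : K) : \bar K := lebesgue_tuple d (@sqball d s).

Lemma sqball_volume_le0 d s : s <= 0 -> sqball_volume d s = 0%E.
Proof.
move=> s0; rewrite /sqball_volume (_ : sqball s = set0) ?measure0//.
apply/seteqP; split => x // /lt_le_trans /(_ s0).
by rewrite ltNge sumr_ge0// => i _; exact: sqr_ge0.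
Qed.

Lemma sqball_volume_scale d s : 0 < s ->
  sqball_volume d s = ((Num.sqrt s ^+ d)%:E * sqball_volume d 1)%E.
Proof.
move=> s0; have r0 : 0 < Num.sqrt s by rewrite sqrtr_gt0.
rewrite /sqball_volume [LHS]measure_integral_indic; last exact: measurable_sqball.
pose b := [tuple (0 : K) | i < d].
rewrite (ge0_integral_affine_tuple (a := Num.sqrt s) b)//; last 2 first.
- by rewrite gt_eqF.
- by apply: measurableT_comp => //; apply: measurable_indic; exact: measurable_sqball.
rewrite gtr0_norm//; congr (_ * _)%E.
rewrite [RHS]measure_integral_indic; last exact: measurable_sqball.
apply: eq_integral => x _; rewrite !indicE; congr ((nat_of_bool _)%:R%:E).
have e : sqnorm (affine_tuple (Num.sqrt s) b x) = s * sqnorm x.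
  rewrite /sqnorm mulr_sumr; apply: eq_bigr => i _.
  by rewrite !tnth_mktuple addr0 exprMn sqr_sqrtr ?ltW.
apply/idP/idP => /set_mem h; apply/mem_set; move: h; rewrite /sqball /= e.
  by rewrite gtr_pMr.
by rewrite gtr_pMr.
Qed.

Lemma sqball_volumeE d s : sqball_volume d s =
  ((Num.sqrt s ^+ d * \1_`]0, +oo[ s)%:E * sqball_volume d 1)%E.
Proof.
have [s0|s0] := ltP 0 s.
  by rewrite sqball_volume_scale// indicE mem_set ?mulr1//= in_itv/= s0.
rewrite sqball_volume_le0// indicE memNset ?mulr0 ?mul0e//= in_itv/= andbT.
by apply/negP; rewrite -leNgt.
Qed.

Lemma measurable_sqball_volume d : measurable_fun setT (sqball_volume d).
Proof.
rewrite (funext (@sqball_volumeE d)).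
apply: emeasurable_funM => //; apply: measurableT_comp => //.
apply: measurable_funM => //; apply: measurable_funX.
by apply: continuous_measurable_fun => x; exact: sqrt_continuous.
Qed.

Lemma sqball_volume_ge0 d s : (0 <= sqball_volume d s)%E.
Proof. exact: (measure_ge0 (lebesgue_tuple d)). Qed.

Lemma sqball_volumeS d s :
  sqball_volume d.+1 s = (\int[leb]_u sqball_volume d (s - u ^+ 2)%R)%E.
Proof.
rewrite /sqball_volume {1}/lebesgue_tuple tuple_measureS; apply: eq_integral => u _.
congr (lebesgue_tuple d _); apply/seteqP; split => t;
  rewrite /sqball /= /sqnorm big_ord_recl ltrBrDl; congr (_ + _ < _);
  by apply: eq_bigr => i _; rewrite tnthS.
Qed.

(** Layer-cake form of the integral of exp(- |x|^2) over R^d, t being the level of |x|^2. Slicing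
    evaluates it to pi^(d/2), scaling to the volume of the unit ball times Gamma(d/2 + 1). *)
Let gaussian_mass d := (\int[leb]_t (sqball_volume d t * (expR (- t))%:E))%E.

Let gaussian_massS d :
  gaussian_mass d.+1 = ((Num.sqrt pi)%:E * gaussian_mass d)%E.
Proof.
have mexp (dS : measure_display) (S : measurableType dS) (f : S -> K) :
    measurable_fun setT f -> measurable_fun setT (fun x => expR (f x)).
  by move=> mf; apply: (measurableT_comp (@measurable_expR K)).
have mF : measurable_fun [set: K * K]
   (fun z => sqball_volume d (z.2 - z.1 ^+ 2)%R * (expR (- z.2))%:E)%E.
  apply: emeasurable_funM.
    apply: (measurableT_comp (@measurable_sqball_volume d)).
    by apply: measurable_funB => //; apply: measurable_funX.
  by apply: measurableT_comp => //; apply: mexp; exact: measurableT_comp.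
have F0 (z : K * K) : (0 <= sqball_volume d (z.2 - z.1 ^+ 2)%R * (expR (- z.2))%:E)%E.
  by apply: mule_ge0; rewrite ?lee_fin ?expR_ge0//; exact: sqball_volume_ge0.
rewrite /gaussian_mass.
transitivity (\int[leb]_t \int[leb]_u
    (sqball_volume d (t - u ^+ 2)%R * (expR (- t))%:E))%E.
  apply: eq_integral => t _; rewrite sqball_volumeS ge0_integralZr//=.
  - apply: (measurableT_comp (@measurable_sqball_volume d)).
    by apply: measurable_funB => //; apply: measurable_funX.
rewrite -[LHS](fubini_tonelli (m1 := leb) (m2 := leb) _ mF F0).
transitivity (\int[leb]_u ((expR (- u ^+ 2))%:E * gaussian_mass d))%E.
  apply: eq_integral => u _ /=.
  have mFu := measurableT_comp mF (measurable_pair1 u).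
  (* Shifting t by u^2 separates the factor exp(- u^2), whose integral is the square root of pi. *)
  have := ge0_integral_affine (u ^+ 2) (oner_neq0 K) mFu (fun t => F0 (u, t)).
  move=> /= ->; rewrite normr1 mul1e /gaussian_mass -ge0_integralZl//=; last 2 first.
  - apply: emeasurable_funM; first exact: measurable_sqball_volume.
    by apply: measurableT_comp => //; apply: mexp.
  - by move=> t _; apply: mule_ge0; rewrite ?lee_fin ?expR_ge0//; exact: sqball_volume_ge0.
  apply: eq_integral => t _; rewrite mul1r addrK opprD expRD EFinM.
  by rewrite (muleC (expR (- t))%:E) muleCA.
rewrite ge0_integralZr//=; last 2 first.
- by apply: measurableT_comp => //; apply: mexp;
  apply: measurableT_comp => //; exact: measurable_funX.
- apply: integral_ge0 => t _; apply: mule_ge0; rewrite ?lee_fin ?expR_ge0//.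
congr (_ * _)%E; rewrite ge0_integral_real_lebesgue//.
  by have := @integralT_gauss K; rewrite /gauss_fun.
by apply: measurableT_comp => //; apply: mexp;
  apply: measurableT_comp => //; exact: measurable_funX.
Qed.

(** In dimension 0 the ball of index t is the whole one-point space when t > 0, so the integrand is
    the exponential density except at t = 0. *)
Let gaussian_mass0 : gaussian_mass 0 = 1%E.
Proof.
transitivity (\int[leb]_x (exponential_pdf 1 x)%:E)%E; last first.
  rewrite ge0_integral_real_lebesgue//; first exact: integral_exponential_pdf.
  - by apply: measurableT_comp => //; exact: measurable_exponential_pdf.
  - by move=> x _; rewrite lee_fin exponential_pdf_ge0.
apply: ge0_ae_eq_integral => //.
- apply: emeasurable_funM; first exact: measurable_sqball_volume.
  by apply: measurableT_comp => //; apply: (measurableT_comp (@measurable_expR K)).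
- by apply: measurableT_comp => //; exact: measurable_exponential_pdf.
- by move=> t _; apply: mule_ge0; rewrite ?lee_fin ?expR_ge0//; exact: sqball_volume_ge0.
- by move=> t _; rewrite lee_fin exponential_pdf_ge0.
exists [set 0]; split => //; first exact: lebesgue_measure_set1.
move=> t /= /not_implyP[_ h]; apply: contrapT => t0; apply: h.
rewrite /sqball_volume /lebesgue_tuple /= diracE /exponential_pdf patchE.
rewrite (_ : (t \in `[0, +oo[%classic) = (0 <= t)); last first.
  by rewrite mem_setE in_itv/= andbT.
rewrite /sqball /sqnorm.
have -> : ([tuple] \in [set x : 0.-tuple K | \sum_(i < 0) tnth x i ^+ 2 < t]) = (0 < t).
  by apply/idP/idP => [/set_mem/=|h]; [|apply/mem_set => /=]; rewrite big_ord0.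
have {}t0 : t != 0 by apply/eqP.
rewrite lt_neqAle eq_sym t0/=; case: ifP => _; last by rewrite mul0e.
by rewrite mul1e !mul1r mulN1r.
Qed.

Let gaussian_massE d : gaussian_mass d = (Num.sqrt pi ^+ d)%:E.
Proof.
elim: d => [|d IH]; first by rewrite gaussian_mass0.
by rewrite gaussian_massS IH -EFinM exprS.
Qed.

Let Gamma_integral d := (\int[leb]_(t in `]0%R, +oo[)
  (t `^ (d%:R / 2 + 1 - 1) * expR (- t))%:E)%E.

Let measurable_Gamma_integrand d : measurable_fun setT
  (fun t : K => (t `^ (d%:R / 2 + 1 - 1) * expR (- t))%:E).
Proof.
apply: measurableT_comp => //; apply: measurable_funM.
  exact: measurable_powR.
exact: (measurableT_comp (@measurable_expR K)).
Qed.

Let gaussian_mass_Gamma d :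
  gaussian_mass d = (sqball_volume d 1 * Gamma_integral d)%E.
Proof.
rewrite /Gamma_integral -ge0_integralZl//=; last 2 first.
- exact: measurable_funTS.
- by move=> t _; rewrite lee_fin mulr_ge0 ?powR_ge0 ?expR_ge0.
rewrite [RHS]integral_mkcond; apply: eq_integral => t _.
rewrite sqball_volumeE patchE indicE.
case: ifPn => t0; last by rewrite mulr0 !mul0e.
rewrite mulr1 muleC [in RHS]muleC EFinM muleA; congr (_ * _)%E.
rewrite muleC; congr (_ * _)%E; congr EFin.
move: t0; rewrite mem_setE in_itv/= andbT => t0.
by rewrite addrK [_ / 2]mulrC powRrM powR12_sqrt ?ltW// powR_mulrn// sqrtr_ge0.
Qed.

(** The two nonnegative extended reals have a positive real product, which excludes 0 and infinity
    for each of them. *)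
Let sqball_volume_Gamma d : exists v g : K, [/\ sqball_volume d 1 = v%:E,
  Gamma_integral d = g%:E, 0 < v, 0 < g & v * g = Num.sqrt pi ^+ d].
Proof.
have := gaussian_massE d; rewrite gaussian_mass_Gamma.
have v0 := sqball_volume_ge0 d 1.
have g0 : (0 <= Gamma_integral d)%E.
  by apply: integral_ge0 => t _; rewrite lee_fin mulr_ge0 ?powR_ge0 ?expR_ge0.
have p0 : 0 < Num.sqrt (pi : K) ^+ d by rewrite exprn_gt0// sqrtr_gt0 pi_gt0.
move: v0 g0; case: (sqball_volume d 1) => [v| |]; case: (Gamma_integral d) => [g| |] //=.
- rewrite !lee_fin -EFinM => v0 g0 [e]; exists v, g; split => //.
    by rewrite lt_neqAle v0 andbT; apply: contraTneq p0 => v0'; rewrite -e -v0' mul0r ltxx.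
  by rewrite lt_neqAle g0 andbT; apply: contraTneq p0 => v0'; rewrite -e -v0' mulr0 ltxx.
- rewrite lee_fin le_eqVlt => /predU1P[<-|v0] _; last by rewrite gt0_muley ?lte_fin.
  by rewrite mul0e => -[e]; rewrite -e ltxx in p0.
- rewrite lee_fin => _; rewrite le_eqVlt => /predU1P[<-|g0]; last by rewrite gt0_mulye ?lte_fin.
  by rewrite mule0 => -[e]; rewrite -e ltxx in p0.
Qed.

Let GammaE d g : Gamma_integral d = g%:E -> Gamma (d%:R / 2 + 1) = g.
Proof.
rewrite /Gamma_integral ge0_integral_real_lebesgue//; last 2 first.
- exact: measurable_funTS.
- by move=> t _; rewrite lee_fin mulr_ge0 ?powR_ge0 ?expR_ge0.
by rewrite /Gamma /Rintegral => ->.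
Qed.

Lemma sqball_volume1 d : sqball_volume d 1 = (unit_ball_volume d)%:E.
Proof.
have [v [g [-> /GammaE gE v0 g0 vg]]] := sqball_volume_Gamma d.
rewrite /unit_ball_volume gE [d%:R / 2]mulrC powRrM powR12_sqrt ?pi_ge0//.
by rewrite powR_mulrn ?sqrtr_ge0// -vg mulfK// gt_eqF.
Qed.

Lemma sqball_volume_sqr d r : 0 < r ->
  sqball_volume d (r ^+ 2) = (unit_ball_volume d * r ^+ d)%:E.
Proof.
move=> r0; rewrite sqball_volume_scale ?exprn_gt0//.
by rewrite sqball_volume1 -EFinM sqrtr_sqr gtr0_norm// mulrC.
Qed.

Lemma unit_ball_volume_gt0 d : 0 < unit_ball_volume d :> K.
Proof.
have [v [g [e _ v0 _ _]]] := sqball_volume_Gamma d.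
by move: e; rewrite sqball_volume1 => -[->].
Qed.

End ball_volume.

Section neighbourhood_volume.
Context {K : realType}.
Local Notation leb := (@real_lebesgue K).
Local Notation cube := (@unit_cube K).

(** On one period the integrand is the sum of the translates of g centred at x, x + 1 and x - 1, and
    the parts of g seen by the three of them fit together to its whole support. *)
Lemma ge0_integral_torus (g : K -> \bar K) x : 0 <= x <= 1 ->
  measurable_fun setT g -> (forall u, 0 <= g u)%E -> (forall u, g (- u)%R = g u) ->
  (forall u, 2^-1 <= `|u| -> g u = 0%E) ->
  (\int[leb]_(y in `[0%R, 1%R]) g (coord_dist Torus (x - y)) = \int[leb]_u g u)%E.
Proof.
move=> /andP[x0 x1] mg g0 gN gz.
have gabs u : g `|u| = g u by case: (ger0P u).
pose f (k y : K) := g (y - (x + k))%R.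
have mf k : measurable_fun setT (f k).
  by apply: (measurableT_comp mg); exact: measurable_funB.
have f0 k y : (0 <= f k y)%E by exact: g0.
(* At most one translate is nonzero, according to the integer nearest to x - y. *)
have fE y : `[0, 1]%classic y ->
    (g (coord_dist Torus (x - y)) = f 0%R y + f 1%R y + f (-1)%R y)%E.
  rewrite /= in_itv /= => /andP[y0 y1]; rewrite /f /coord_dist.
  set t := x - y; rewrite (_ : y - (x + 0) = - t) ?gN; last by rewrite /t; ring.
  rewrite (_ : y - (x + 1) = - (t + 1)) ?gN; last by rewrite /t; ring.
  rewrite (_ : y - (x + -1) = - (t - 1)) ?gN; last by rewrite /t; ring.
  have t1 : `|t| <= 1 by rewrite ler_norml /t; apply/andP; split; lra.
  have [h|h] := ltP `|t| (1 - `|t|).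
    have ht : `|t| < 2^-1 by lra.
    have /andP[ht1 ht2] : - 2^-1 < t < 2^-1 by rewrite -ltr_norml.
    rewrite gabs (gz (t + 1)) ?(gz (t - 1)) ?adde0//.
      by rewrite ler0_norm; lra.
    by rewrite ger0_norm; lra.
  have ht : 2^-1 <= `|t| by lra.
  rewrite (gz t)// add0e; case: (lerP 0 t) ht t1 => t0.
    rewrite ger0_norm// => ht t1; rewrite (gz (t + 1)) ?add0e; last first.
      by rewrite ger0_norm; lra.
    by rewrite -gN opprB.
  rewrite ltr0_norm// => ht t1; rewrite opprK (gz (t - 1)) ?adde0 1?addrC//.
  by rewrite ler0_norm; lra.
have mI : measurable (`[0%R, 1%R[%classic : set K) by [].
transitivity (\int[leb]_(y in `[0%R, 1%R]) (f 0%R y + f 1%R y + f (-1)%R y))%E.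
  by apply: eq_integral => y /set_mem; exact: fE.
(* The endpoint 1 is removed to make the integer translates of the interval disjoint. *)
transitivity (\int[leb]_(y in `[0%R, 1%R[) (f 0%R y + f 1%R y + f (-1)%R y))%E.
  rewrite (@ge0_negligible_integral _ _ _ leb _ [set 1])//.
  - congr (integral _ _ _); apply/seteqP; split => y /=; rewrite !in_itv/=.
      by move=> [/andP[-> y1] /eqP yn1]; rewrite lt_neqAle yn1.
    move=> /andP[-> y1]; split; first exact: ltW.
    by move=> y1'; rewrite y1' ltxx in y1.
  - by apply: measurable_funTS; apply: emeasurable_funD => //; exact: emeasurable_funD.
  - by move=> y _; rewrite !adde_ge0 ?f0.
  - exact: lebesgue_measure_set1.
have intf k : (\int[leb]_(y in `[0%R, 1%R[) f k y =
    \int[leb]_u (g u * (\1_`[0%R, 1%R[ (u + (x + k)))%:E))%E.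
  rewrite integral_mkcond [LHS](ge0_integral_affine (x + k) (oner_neq0 K)); last 2 first.
  - by apply/(measurable_restrictT _ _).1 => //; exact: measurable_funTS.
  - by move=> y; rewrite patchE; case: ifP => // _; exact: g0.
  rewrite normr1 mul1e; apply: eq_integral => u _.
  rewrite mul1r patchE indicE /f addrK; case: ifP => _; first by rewrite mule1.
  by rewrite mule0.
rewrite ge0_integralD//; last 3 first.
- by move=> y _; rewrite !adde_ge0 ?f0.
- by apply: measurable_funTS; exact: emeasurable_funD.
- exact: measurable_funTS.
rewrite ge0_integralD//; [|exact: measurable_funTS|exact: measurable_funTS].
rewrite !intf.
have mgk k : measurable_fun [set: K] (fun u => g u * (\1_`[0%R, 1%R[ (u + (x + k)))%:E)%E.
  apply: emeasurable_funM => //; apply: measurableT_comp => //.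
  by apply: (measurableT_comp (measurable_indic mI)); exact: measurable_funD.
have gk0 k u : (0 <= g u * (\1_`[0%R, 1%R[ (u + (x + k)))%:E)%E.
  by apply: mule_ge0 => //; rewrite lee_fin.
rewrite -ge0_integralD// -ge0_integralD//; last 2 first.
- by move=> y _; rewrite !adde_ge0 ?f0 ?gk0.
- exact: emeasurable_funD.
apply: eq_integral => u _; have [hu|hu] := leP 2^-1 `|u|.
  by rewrite gz// !mul0e !adde0.
rewrite -!ge0_muleDr ?lee_fin// -!EFinD.
(* For |u| < 1/2, u + x lies in ]-1/2, 3/2[, so exactly one of its shifts by 0, 1 and -1 falls in
   [0, 1[. *)
suff -> : \1_`[0, 1[ (u + (x + 0)) + \1_`[0, 1[ (u + (x + 1)) +
    \1_`[0, 1[ (u + (x + -1)) = 1 :> K by rewrite mule1.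
move: hu; rewrite ltr_norml => /andP[hu1 hu2].
rewrite !indicE !mem_setE !in_itv/=.
have [s0|s0] := ltP (u + x) 0.
  have -> : 0 <= u + (x + 0) = false by apply/negbTE; rewrite -ltNge; lra.
  have -> : 0 <= u + (x + -1) = false by apply/negbTE; rewrite -ltNge; lra.
  have -> : 0 <= u + (x + 1) by lra.
  have -> : u + (x + 1) < 1 by lra.
  by rewrite /= add0r addr0.
have [s1|s1] := ltP (u + x) 1.
  have -> : 0 <= u + (x + -1) = false by apply/negbTE; rewrite -ltNge; lra.
  have -> : u + (x + 1) < 1 = false by apply/negbTE; rewrite -leNgt; lra.
  have -> : 0 <= u + (x + 0) by lra.
  have -> : u + (x + 0) < 1 by lra.
  by rewrite andbF /= !addr0.
have -> : u + (x + 0) < 1 = false by apply/negbTE; rewrite -leNgt; lra.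
have -> : u + (x + 1) < 1 = false by apply/negbTE; rewrite -leNgt; lra.
have -> : 0 <= u + (x + -1) by lra.
have -> : u + (x + -1) < 1 by lra.
by rewrite !andbF /= !add0r.
Qed.

(** The bound on s means a radius of at most 1/2, so the ball does not wrap onto itself. Induction
    on d, slicing along the first coordinate. *)
Lemma torus_ball_volume d (x : d.-tuple K) s : cube d x -> s <= 4^-1 ->
  lebesgue_tuple d [set y | cube d y /\ sqdist Torus x y < s] = sqball_volume d s.
Proof.
elim: d x s => [|d IH] x s cx s4.
  congr (lebesgue_tuple 0 _); apply/seteqP;
    split => y; rewrite /sqball /= /sqnorm /sqdist !big_ord0.
    by case.
  by split => // -[].
rewrite {1}/lebesgue_tuple tuple_measureS sqball_volumeS.
have x0 := cx ord0.
rewrite -(ge0_integral_torus x0 (g := fun u => sqball_volume d (s - u ^+ 2)%R)).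
- rewrite [RHS]integral_mkcond; apply: eq_integral => u _; rewrite patchE.
  case: ifPn => [/set_mem|/negP]; rewrite /= ?in_itv/= => u01; last first.
    rewrite (_ : [set t | _] = set0) ?measure0//; apply/seteqP; split => t //= [ct _].
    by apply: u01; apply/mem_set; rewrite /= in_itv; exact: (ct ord0).
  rewrite -(IH [tuple of behead x]); last 2 first.
  - by move=> i; rewrite -tnth_lift_behead; exact: cx.
  - by rewrite (le_trans _ s4)// gerBl sqr_ge0.
  congr (lebesgue_tuple d _); apply/seteqP; split => t /=;
    rewrite /sqdist big_ord_recl ltrBrDl.
    move=> [ct h]; split; first by move=> i; have := ct (lift ord0 i); rewrite tnthS.
    move: h; congr (_ + _ < _); apply: eq_bigr => i _.
    by rewrite tnthS tnth_lift_behead.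
  move=> [ct h]; split.
    by move=> i; have [j ->|->] := unliftP ord0 i; [rewrite tnthS|].
  move: h; congr (_ + _ < _); apply: eq_bigr => i _.
  by rewrite tnthS tnth_lift_behead.
- apply: (measurableT_comp (@measurable_sqball_volume K d)).
  by apply: measurable_funB => //; exact: measurable_funX.
- by move=> u; exact: sqball_volume_ge0.
- by move=> u; rewrite sqrrN.
- move=> u hu; apply: sqball_volume_le0; rewrite subr_le0 (le_trans s4)//.
  rewrite -[leRHS]real_normK ?num_real// (_ : 4^-1 = 2^-1 ^+ 2); last by field.
  by rewrite lerXn2r// nnegrE.
Qed.

Lemma measurable_sqdist_ball m d (x : d.-tuple K) s :
  measurable [set y | sqdist m x y < s].
Proof.
have mf : measurable_fun [set: d.-tuple K] (fun y => sqdist m x y).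
  by apply: measurable_sqdist.
have -> : [set y | sqdist m x y < s] = (fun y => sqdist m x y) @^-1` `]-oo, s[%classic.
  by apply/seteqP; split => y; rewrite /= in_itv.
by rewrite -[X in measurable X]setTI; exact: mf.
Qed.

Lemma euclidean_ball_volume d (x : d.-tuple K) s :
  lebesgue_tuple d [set y | sqdist Euclidean x y < s] = sqball_volume d s.
Proof.
have N1 : (-1 : K) != 0 by rewrite oppr_eq0 oner_neq0.
have mA := measurable_sqdist_ball Euclidean x s.
rewrite measure_integral_indic// (ge0_integral_affine_tuple (a := -1) x)//; last first.
  by apply: measurableT_comp => //; exact: measurable_indic.
rewrite normrN1 expr1n mul1e /sqball_volume [RHS]measure_integral_indic; last first.
  exact: measurable_sqball.
apply: eq_integral => y _; rewrite !indicE; congr ((nat_of_bool _)%:R%:E).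
have e : sqdist Euclidean x (affine_tuple (-1) x y) = sqnorm y.
  apply: eq_bigr => i _; rewrite tnth_mktuple /= real_normK ?num_real//; congr (_ ^+ 2).
  ring.
by apply/idP/idP => /set_mem h; apply/mem_set; move: h; rewrite /sqball /= e.
Qed.

Definition near_set m d (x : d.-tuple K) (s : K) : set (d.-tuple K) :=
  [set y | cube d y /\ sqdist m x y < s].

Lemma measurable_near_set m d (x : d.-tuple K) s : measurable (near_set m x s).
Proof.
by apply: measurableI; [exact: measurable_unit_cube|exact: measurable_sqdist_ball].
Qed.

Let sqr_quarter (r : K) : 0 < r <= 2^-1 -> r ^+ 2 <= 4^-1.
Proof.
move=> /andP[r0 r2]; rewrite (_ : 4^-1 = 2^-1 ^+ 2); last by field.
by rewrite lerXn2r ?nnegrE// ltW.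
Qed.

Lemma near_set_volume_le m d (x : d.-tuple K) r : cube d x -> 0 < r <= 2^-1 ->
  (lebesgue_tuple d (near_set m x (r ^+ 2)) <= (unit_ball_volume d * r ^+ d)%:E)%E.
Proof.
move=> cx r2; have /andP[r0 _] := r2.
rewrite -sqball_volume_sqr//; case: m.
  by rewrite -(torus_ball_volume cx)// sqr_quarter.
rewrite -(euclidean_ball_volume x).
apply: (le_measure (lebesgue_tuple d)); rewrite ?inE.
- exact: measurable_near_set.
- exact: measurable_sqdist_ball.
- by move=> y [].
Qed.

(** In the Euclidean model a centre at distance at least r from all faces keeps its whole ball in
    the cube. *)
Lemma near_set_volume m d (x : d.-tuple K) r : cube d x -> 0 < r <= 2^-1 ->
  (m = Euclidean -> forall i, r <= tnth x i <= 1 - r) ->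
  lebesgue_tuple d (near_set m x (r ^+ 2)) = (unit_ball_volume d * r ^+ d)%:E.
Proof.
move=> cx r2; have /andP[r0 _] := r2.
rewrite -sqball_volume_sqr//; case: m => [_|ix].
  by rewrite /near_set torus_ball_volume// sqr_quarter.
rewrite -(euclidean_ball_volume x); congr (lebesgue_tuple d _).
apply/seteqP; split => y /= => [[]//|h]; split => // i.
have /andP[x1 x2] := ix erefl i.
have : `|tnth x i - tnth y i| < r.
  rewrite ltNge; apply/negP => ri; move: h; apply/negP; rewrite -leNgt.
  apply: (@le_trans _ _ (`|tnth x i - tnth y i| ^+ 2)).
    by rewrite lerXn2r ?nnegrE// ltW.
  rewrite /sqdist (bigD1 i)//= lerDl.
  by apply: sumr_ge0 => j _; exact: sqr_ge0.
by rewrite ltr_norml => /andP[? ?]; apply/andP; split; lra.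
Qed.

End neighbourhood_volume.

(** * Excluded volumes and the integrals q and q2 *)

Section excluded_volume.
Context {K : realType} {dO : measure_display} {O : measurableType dO}.
Variables (Q : probability O K) (R : {RV Q >-> K}) (m : model) (d : nat).
Variables (rbar L lambda : K).
Hypothesis rbar_gt0 : 0 < rbar.
Hypothesis R_gt0 : forall w, 0 < R w.
Hypothesis R_le : forall w, R w <= rbar.
Hypothesis L_ge : 4 * rbar <= L.
Hypothesis lambda_gt0 : 0 < lambda.

Local Notation vol := (@lebesgue_tuple K d).
Local Notation cube := (@unit_cube K d).
Local Notation mu := (sigma_prod vol Q).
Local Notation c := (@sphere_compat K dO O m d R L).
Local Notation phi := (fun z : d.-tuple K * O => lambda * \1_cube z.1).
Local Notation gamma := (@unit_ball_volume K d).

Let L_gt0 : 0 < L. Proof. by apply: lt_le_trans L_ge; rewrite mulr_gt0. Qed.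

Let range w w' : K := (R w + R w') / L.

Let range_gt0 w w' : 0 < range w w'.
Proof. by rewrite divr_gt0// addr_gt0. Qed.

Let range_le w w' : range w w' <= 2 * rbar / L.
Proof.
by rewrite ler_pM2r ?invr_gt0//; have := R_le w; have := R_le w'; lra.
Qed.

(** This is the purpose of [4 * rbar <= L]: overlap happens only within distance 1/2, where torus
    balls have their Euclidean volume. *)
Let range_half w w' : range w w' <= 2^-1.
Proof.
by apply: le_trans (range_le w w') _; rewrite ler_pdivrMr//; move: L_ge; lra.
Qed.

(** The centres whose excluded volume has its bulk value: an overlap range is at most 2 rbar / L and
    cannot reach past a face. *)
Definition inner_cube : set (d.-tuple K) := [set x | cube x /\
  (m = Euclidean -> forall i, 2 * rbar / L <= tnth x i <= 1 - 2 * rbar / L)].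

Let weight_phi : weight phi.
Proof. by case: (finite_weight_cube Q d lambda_gt0). Qed.

Let cc : compatibility c. Proof. exact: compatibility_sphere. Qed.

Let volumeN z w' := vol (near_set m z.1 (range z.2 w' ^+ 2)).

Let volumeN_integral (z : d.-tuple K * O) w' :
  volumeN z w' = (\int[vol]_x (\1_cube x * (1 - c z (x, w')))%:E)%E.
Proof.
rewrite /volumeN measure_integral_indic; last exact: measurable_near_set.
apply: eq_integral => x _; congr EFin; rewrite !indicE /sphere_compat /sphere_free /=.
rewrite -/(range _ _); have [cx|cx] := pselect (cube x); last first.
  by rewrite memNset ?memNset ?mul0r// => -[].
rewrite (mem_set cx) mul1r; have [h|h] := ltP; first by rewrite mem_set// subr0.
by rewrite memNset ?subrr// => -[_]; rewrite ltNge h.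
Qed.

Let mexcl : measurable_fun [set: d.-tuple K * O]
  (fun z => (\1_cube z.1)%:E : \bar K).
Proof.
apply: measurableT_comp => //.
exact: (measurableT_comp (measurable_indic (@measurable_unit_cube K d)) measurable_fst).
Qed.

Let mintegrand (z : d.-tuple K * O) : measurable_fun [set: d.-tuple K * O]
  (fun y => (\1_cube y.1 * (1 - c z y))%:E).
Proof.
apply: measurableT_comp => //; apply: measurable_funM; first exact/measurable_EFinP.
apply: measurable_funB => //; case: cc => mc _ _.
exact: (measurableT_comp mc (measurable_pair1 z)).
Qed.

Let integrand_ge0 (z y : d.-tuple K * O) : (0 <= (\1_cube y.1 * (1 - c z y))%:E)%E.
Proof.
rewrite lee_fin mulr_ge0// subr_ge0.
by rewrite /sphere_compat; case: sphere_free.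
Qed.

Let measurable_volumeN z : measurable_fun setT (volumeN z).
Proof.
rewrite (funext (volumeN_integral z)).
exact: (measurable_fun_fubini_tonelli_G (m1 := vol) _ (mintegrand z) (integrand_ge0 z)).
Qed.

Let volumeN_ge0 z w' : (0 <= volumeN z w')%E.
Proof. exact: (measure_ge0 vol). Qed.

Let excludedE z : excluded mu c phi z = (lambda%:E * \int[Q]_w' volumeN z w')%E.
Proof.
transitivity (\int[mu]_y (lambda%:E * (\1_cube y.1 * (1 - c z y))%:E))%E.
  by apply: eq_integral => y _; rewrite -EFinM mulrA.
rewrite ge0_integralZl ?lee_fin ?ltW//; congr (_ * _)%E.
rewrite ge0_integral_prod_swap//.
by apply: eq_integral => w' _; exact/esym/volumeN_integral.
Qed.

Let pair_moment w := (\int[Q]_w' ((R w + R w') ^+ d)%:E)%E.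

Let mpair : measurable_fun [set: O * O] (fun z => ((R z.1 + R z.2) ^+ d)%:E).
Proof.
apply: measurableT_comp => //; apply: measurable_funX; apply: measurable_funD;
  apply: (measurableT_comp (f := R)) => //.
Qed.

Let pair_ge0 (z : O * O) : (0 <= ((R z.1 + R z.2) ^+ d)%:E)%E.
Proof. by rewrite lee_fin exprn_ge0// addr_ge0// ltW. Qed.

Let pair_moment_ge0 w : (0 <= pair_moment w)%E.
Proof. by apply: integral_ge0 => w' _; exact: (pair_ge0 (w, w')). Qed.

Let measurable_pair_moment : measurable_fun setT pair_moment.
Proof. exact: (measurable_fun_fubini_tonelli_F (m2 := Q) _ mpair pair_ge0). Qed.

Let k := lambda * gamma / L ^+ d.

Let gamma_gt0 : 0 < gamma. Proof. exact: unit_ball_volume_gt0. Qed.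

Let k_ge0 : 0 <= k.
Proof.
apply: divr_ge0; last by rewrite exprn_ge0 ?ltW.
by apply: mulr_ge0; rewrite ltW.
Qed.

Let mpair1 w : measurable_fun setT (fun w' => ((R w + R w') ^+ d)%:E).
Proof. exact: (measurableT_comp mpair (measurable_pair1 w)). Qed.

Let scaled_moment w : (lambda%:E * \int[Q]_w' (gamma * range w w' ^+ d)%:E =
  k%:E * pair_moment w)%E.
Proof.
have -> : (\int[Q]_w' (gamma * range w w' ^+ d)%:E =
    (gamma / L ^+ d)%:E * pair_moment w)%E.
  rewrite -ge0_integralZl//=.
  - by apply: eq_integral => w' _; rewrite -EFinM /range expr_div_n; congr EFin; ring.
  - by move=> w' _; exact: (pair_ge0 (w, w')).
  - by rewrite lee_fin divr_ge0 ?exprn_ge0// ltW.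
by rewrite muleA -EFinM mulrA.
Qed.

Let mrange w : measurable_fun setT (fun w' => (gamma * range w w' ^+ d)%:E).
Proof.
apply: measurableT_comp => //; apply: measurable_funM => //; apply: measurable_funX.
by apply: measurable_funM => //; exact: measurable_funD.
Qed.

Let excluded_le_moment z : cube z.1 ->
  (excluded mu c phi z <= k%:E * pair_moment z.2)%E.
Proof.
move=> cz; rewrite excludedE -scaled_moment; apply: lee_wpmul2l.
  by rewrite lee_fin ltW.
apply: ge0_le_integral => //.
by move=> w' _; apply: near_set_volume_le => //; rewrite range_gt0 range_half.
Qed.

Let excluded_inner z : inner_cube z.1 ->
  excluded mu c phi z = (k%:E * pair_moment z.2)%E.
Proof.
move=> [cz iz]; rewrite excludedE -scaled_moment; congr (_ * _)%E.
apply: eq_integral => w' _; apply: near_set_volume => //.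
  by rewrite range_gt0 range_half.
move=> /iz iz' i; have /andP[i1 i2] := iz' i; have := range_le z.2 w'.
by move=> h; apply/andP; split; lra.
Qed.

Let pair_moment_le w : (pair_moment w <= ((2 * rbar) ^+ d)%:E)%E.
Proof.
apply: (@le_trans _ _ (\int[Q]_w' ((2 * rbar) ^+ d)%:E)%E); last first.
  by rewrite integral_cst// [X in (_ * X)%E](probability_setT Q) mule1.
apply: ge0_le_integral => //.
- by move=> w' _; exact: (pair_ge0 (w, w')).
- move=> w' _; rewrite lee_fin lerXn2r ?nnegrE//.
  + by rewrite addr_ge0// ltW.
  + by rewrite mulr_ge0// ltW.
  + by have := R_le w; have := R_le w'; lra.
Qed.

Let m1 := mixed_moment R d.

Let mixed_momentE : (\int[Q]_w pair_moment w = m1%:E)%E.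
Proof.
have e : (\int[(Q \x Q)%E]_w ((R w.1 + R w.2) ^+ d)%:E = \int[Q]_w pair_moment w)%E.
  exact: (ge0_integral_prod Q Q mpair pair_ge0).
rewrite /m1 /mixed_moment e fineK// ge0_fin_numE ?integral_ge0//.
apply: (@le_lt_trans _ _ (\int[Q]_w' ((2 * rbar) ^+ d)%:E)%E); last first.
  by rewrite integral_cst// [X in (_ * X)%E](probability_setT Q) mule1 ltry.
exact: ge0_le_integral.
Qed.

Let measurable_excl : measurable_fun setT (excluded mu c phi).
Proof. exact: measurable_excluded. Qed.

Let excl_ge0 z : (0 <= excluded mu c phi z)%E.
Proof. exact: excluded_ge0. Qed.

Let integral_moment (A : set (d.-tuple K)) : measurable A ->
  (\int[mu]_z ((lambda * k * \1_A z.1)%:E * pair_moment z.2) =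
   (lambda * k * m1)%:E * vol A)%E.
Proof.
move=> mA.
have mAp : measurable_fun [set: d.-tuple K * O]
    (fun z => (\1_A z.1)%:E * pair_moment z.2)%E.
  apply: emeasurable_funM; last exact: (measurableT_comp measurable_pair_moment).
  apply: measurableT_comp => //.
  exact: (measurableT_comp (measurable_indic mA) measurable_fst).
transitivity (\int[mu]_z ((lambda * k)%:E * ((\1_A z.1)%:E * pair_moment z.2)))%E.
  by apply: eq_integral => z _; rewrite EFinM muleA.
rewrite ge0_integralZl//.
- rewrite ge0_integral_prod_fst// mixed_momentE (muleC (vol A)) muleA.
  by rewrite -EFinM.
- by move=> z _; apply: mule_ge0 => //; rewrite lee_fin.
- by rewrite lee_fin mulr_ge0// ltW.
Qed.

Let pair_integral := (\int[mu]_z ((phi z)%:E * excluded mu c phi z))%E.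

Let mphi : measurable_fun [set: d.-tuple K * O] (fun z => (phi z)%:E : \bar K).
Proof. by apply: measurableT_comp => //; case: weight_phi. Qed.

Let phi_ge0 z : (0 <= (phi z)%:E :> \bar K)%E.
Proof. by rewrite lee_fin (weight_ge0 _ weight_phi). Qed.

Let pair_integral_le : (pair_integral <= (lambda * k * m1)%:E)%E.
Proof.
have := @integral_moment cube (@measurable_unit_cube K d).
rewrite [X in _ = (_ * X)%E -> _](lebesgue_tuple_cube d) mule1 => <-.
apply: ge0_le_integral => //.
- by move=> z _; exact: mule_ge0.
- exact: emeasurable_funM.
- apply: emeasurable_funM; last exact: (measurableT_comp measurable_pair_moment).
  apply: measurableT_comp => //; apply: measurable_funM => //; exact/measurable_EFinP.
move=> z _; rewrite !indicE; have [cz|cz] := pselect (cube z.1); last first.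
  by rewrite memNset// !mulr0 !mul0e.
rewrite mem_set// !mulr1 EFinM -muleA; apply: lee_wpmul2l.
  by rewrite lee_fin ltW.
exact: excluded_le_moment.
Qed.

Let inner_box : (m = Euclidean) ->
  inner_cube = box (fun=> 2 * rbar / L) (fun=> 1 - 2 * rbar / L).
Proof.
move=> mE; have rL : 0 < rbar / L by rewrite divr_gt0.
apply/seteqP; split => x => [[_ /(_ mE)]//|h]; split => // i.
by have /andP[? ?] := h i; apply/andP; split; lra.
Qed.

Let inner_torus : m = Torus -> inner_cube = cube.
Proof. by move=> mT; apply/seteqP; split => x => [[]|cx]//; split; rewrite // mT. Qed.

Lemma measurable_inner_cube : measurable inner_cube.
Proof.
case: (m) inner_torus inner_box => [-> // _|_ -> //].
  exact: measurable_unit_cube.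
exact: measurable_box.
Qed.

Definition boundary_factor : K :=
  match m with Torus => 1 | Euclidean => (1 - 4 * rbar / L) ^+ d end.

Lemma inner_cube_volume : vol inner_cube = boundary_factor%:E.
Proof.
rewrite /boundary_factor; case: (m) inner_torus inner_box => [-> // _|_ -> //].
  by rewrite lebesgue_tuple_cube.
have rL4 : 4 * (rbar / L) <= 1 by rewrite mulrA ler_pdivrMr// mul1r.
rewrite box_volume; last by move=> i; lra.
rewrite prodr_const card_ord; congr (_ ^+ _)%:E; lra.
Qed.

Let pair_integral_ge : ((lambda * k * m1 * boundary_factor)%:E <= pair_integral)%E.
Proof.
have := integral_moment measurable_inner_cube.
rewrite [X in _ = (_ * X)%E -> _]inner_cube_volume -EFinM => <-.
apply: ge0_le_integral => //.
- move=> z _; apply: mule_ge0 => //; rewrite lee_fin mulr_ge0//.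
  by rewrite mulr_ge0// ltW.
- apply: emeasurable_funM; last exact: (measurableT_comp measurable_pair_moment).
  apply: measurableT_comp => //; apply: measurable_funM => //.
  exact: (measurableT_comp (measurable_indic measurable_inner_cube) measurable_fst).
- exact: emeasurable_funM.
move=> z _; rewrite !indicE; have [cz|cz] := pselect (inner_cube z.1); last first.
  rewrite (memNset cz) mulr0 mul0e; apply: mule_ge0 => //.
  by rewrite lee_fin mulr_ge0// ltW.
rewrite mem_set// mulr1 mem_set; last by case: cz.
by rewrite mulr1 excluded_inner// EFinM muleA.
Qed.

(** Uniform bound on v over the cube, both radii being replaced by rbar. It serves for q2, where no
    sharp constant is sought. *)
Let C := lambda * (gamma * (2 * rbar) ^+ d / L ^+ d).

Let C_ge0 : 0 <= C.
Proof.
apply: mulr_ge0; first exact: ltW.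
apply: divr_ge0; last by rewrite exprn_ge0 ?ltW.
by apply: mulr_ge0; [exact: ltW|rewrite exprn_ge0// mulr_ge0// ltW].
Qed.

Let excluded_le_const z : cube z.1 -> (excluded mu c phi z <= C%:E)%E.
Proof.
move=> cz; apply: le_trans (excluded_le_moment cz) _.
apply: (@le_trans _ _ (k%:E * ((2 * rbar) ^+ d)%:E)%E).
  by apply: lee_wpmul2l; [rewrite lee_fin|exact: pair_moment_le].
by rewrite -EFinM lee_fin /k /C le_eqVlt; apply/orP; left; apply/eqP; ring.
Qed.

Let mass_phi : (\int[mu]_z (phi z)%:E = lambda%:E)%E.
Proof.
have ff := finite_weight_cube Q d lambda_gt0.
rewrite (massE ff); congr EFin; exact: mass_cube.
Qed.

Let triple_integral_le : (\int[mu]_z ((phi z)%:E *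
   (excluded mu c phi z * excluded mu c phi z)) <= (lambda * C ^+ 2)%:E)%E.
Proof.
rewrite EFinM -mass_phi -ge0_integralZr//=; last by rewrite lee_fin sqr_ge0.
apply: ge0_le_integral => //.
- by move=> z _; apply: mule_ge0 => //; exact: mule_ge0.
- by apply: emeasurable_funM => //; exact: emeasurable_funM.
- exact: emeasurable_funM.
move=> z _; rewrite indicE; have [cz|cz] := pselect (cube z.1); last first.
  by rewrite memNset// mulr0 !mul0e.
apply: lee_wpmul2l; first by rewrite mem_set// mulr1 lee_fin ltW.
rewrite expr2 EFinM; apply: lee_pmul => //; exact: excluded_le_const.
Qed.

Let q_fin : pair_integral \is a fin_num.
Proof.
rewrite ge0_fin_numE; last by apply: integral_ge0 => z _; exact: mule_ge0.
by apply: le_lt_trans pair_integral_le _; exact: ltry.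
Qed.

(** A positive function has a positive integral against a probability; this is used once for each
    factor of the product space. The strict inequality delta < 0 depends on it. *)
Lemma mixed_moment_gt0 : 0 < mixed_moment R d.
Proof.
have M0 : 0 <= m1.
  by rewrite -lee_fin -mixed_momentE; exact: integral_ge0.
rewrite lt_neqAle -/m1 M0 andbT; apply/eqP => /esym m10.
have pos w w' : (0 < ((R w + R w') ^+ d)%:E :> \bar K)%E.
  by rewrite lte_fin exprn_gt0// addr_gt0.
have zero (f : O -> \bar K) : measurable_fun setT f -> (forall w, 0 < f w)%E ->
    (\int[Q]_w f w = 0)%E -> False.
  move=> mf f0 If.
  have : (\int[Q]_w `|f w| = 0)%E.
    by rewrite -If; apply: eq_integral => w _; rewrite gee0_abs// ltW.
  move=> /(ae_eq_integral_abs Q measurableT mf).1 [N [mN N0 sN]].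
  have NT : N = setT.
    apply/seteqP; split => // w _; apply: sN => /= /(_ I) fw.
    by have := f0 w; rewrite fw ltxx.
  by have := probability_setT Q; rewrite -NT N0 => -[/esym/eqP]; rewrite oner_eq0.
apply: (zero pair_moment) => //; last by rewrite mixed_momentE m10.
move=> w; rewrite lt0e pair_moment_ge0 andbT; apply/eqP.
exact: (zero _ (mpair1 w) (pos w)).
Qed.

Lemma hard_sphere_lower :
  expR (lambda - lambda ^+ 2 / L ^+ d * (gamma * mixed_moment R d / 2)) <=
  partition_function mu c phi.
Proof.
have ff := finite_weight_cube Q d lambda_gt0.
apply: le_trans (partition_function_lower cc ff); rewrite ler_expR mass_cube//.
rewrite lerD2l lerN2 -/pair_integral.
have : fine pair_integral <= lambda * k * m1.
  by rewrite -lee_fin fineK//; exact: pair_integral_le.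
rewrite -(ler_pM2r (x := 2^-1))// => /le_trans; apply.
by rewrite /k le_eqVlt; apply/orP; left; apply/eqP; rewrite -/m1; ring.
Qed.

(** q is bounded below by the contribution of the inner cube, whence [boundary_factor], and q2 above
    by lambda C^2. *)
Lemma hard_sphere_upper :
  partition_function mu c phi <=
  expR (lambda - boundary_factor * (lambda ^+ 2 / L ^+ d * (gamma * mixed_moment R d / 2))
    + 2 / 3 * (lambda ^+ 3 / L ^+ d ^+ 2 * (gamma * (2 * rbar) ^+ d) ^+ 2)).
Proof.
have ff := finite_weight_cube Q d lambda_gt0.
apply: le_trans (partition_function_upper cc ff) _; rewrite ler_expR mass_cube//.
apply: lerD.
  rewrite lerD2l lerN2 -/pair_integral.
  have : lambda * k * m1 * boundary_factor <= fine pair_integral.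
    by rewrite -lee_fin fineK//; exact: pair_integral_ge.
  move=> h; apply: (@le_trans _ _ (lambda * k * m1 * boundary_factor / 2)); last first.
    by rewrite ler_pM2r.
  by rewrite /k le_eqVlt; apply/orP; left; apply/eqP; rewrite -/m1; ring.
set T := integral _ _ _.
have T0 : (0 <= T)%E.
  by apply: integral_ge0 => z _; apply: mule_ge0 => //; exact: mule_ge0.
have : fine T <= lambda * C ^+ 2.
  rewrite -lee_fin fineK; first exact: triple_integral_le.
  by rewrite ge0_fin_numE// (le_lt_trans triple_integral_le)// ltry.
move=> h; rewrite mulrAC; apply: (@le_trans _ _ (2 / 3 * (lambda * C ^+ 2))).
  by rewrite ler_pM2l.
rewrite le_eqVlt; apply/orP; left; apply/eqP; congr (_ * _); rewrite /C; field.
by rewrite expf_neq0// gt_eqF.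
Qed.

End excluded_volume.

(** * Packing, boundary and rescaling *)

Section coordinate_distance.
Context {K : realType}.

Lemma sqdist_coord m d (x y : d.-tuple K) r i : 0 < r ->
  sqdist m x y < r ^+ 2 -> coord_dist m (tnth x i - tnth y i) < r.
Proof.
move=> r0 h; rewrite ltNge; apply/negP => ri; move: h; apply/negP; rewrite -leNgt.
apply: (@le_trans _ _ (coord_dist m (tnth x i - tnth y i) ^+ 2)).
  by rewrite lerXn2r ?nnegrE// ltW// (lt_le_trans r0).
rewrite /sqdist (bigD1 i)//= lerDl.
by apply: sumr_ge0 => j _; exact: sqr_ge0.
Qed.

Lemma coord_dist_ge0 m (x y : K) : 0 <= x <= 1 -> 0 <= y <= 1 ->
  0 <= coord_dist m (x - y).
Proof.
move=> /andP[? ?] /andP[? ?]; case: m => //=.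
rewrite le_min normr_ge0/= subr_ge0 ler_norml; apply/andP; split; lra.
Qed.

(** On the torus, each choice of the two ways round in the right-hand side is one of four linear
    cases. *)
Lemma coord_dist_triangle m (x y z : K) :
  (m = Torus -> [/\ 0 <= x <= 1, 0 <= y <= 1 & 0 <= z <= 1]) ->
  coord_dist m (x - z) <= coord_dist m (x - y) + coord_dist m (y - z).
Proof.
case: m => /= [/(_ erefl)[/andP[? ?] /andP[? ?] /andP[? ?]]|_].
  have h1 : `|x - z| <= `|x - y| + `|y - z| by exact: ler_distD.
  have h2 : `|y - z| <= `|x - z| + `|x - y|.
    by rewrite [leRHS]addrC (distrC x y); exact: ler_distD.
  have h3 : `|x - y| <= `|x - z| + `|y - z|.
    by rewrite (distrC y z); exact: ler_distD.
  (* The distances between three points of [0, 1] add up to twice the largest. This settles the case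
     where both distances on the right go round the circle. *)
  have h4 : `|x - y| + `|y - z| + `|x - z| <= 2.
    by do 3 case: ger0P => ?; lra.
  move: `|x - z| `|x - y| `|y - z| h1 h2 h3 h4 => t a b h1 h2 h3 h4.
  rewrite ge_min; case: (ltP a (1 - a)) => _; case: (ltP b (1 - b)) => _;
    apply/orP; [left|right|right|left]; lra.
exact: ler_distD.
Qed.

End coordinate_distance.

Section packing.
Context {K : realType} {dO : measure_display} {O : measurableType dO}.
Variables (Q : probability O K) (R : {RV Q >-> K}) (m : model) (d : nat).
Variables (rbar L lambda : K).
Hypothesis rbar_gt0 : 0 < rbar.
Hypothesis R_gt0 : forall w, 0 < R w.
Hypothesis R_le : forall w, R w <= rbar.
Hypothesis L_ge : 4 * rbar <= L.
Hypothesis lambda_gt0 : 0 < lambda.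

Local Notation vol := (@lebesgue_tuple K d).
Local Notation cube := (@unit_cube K d).
Local Notation mu := (sigma_prod vol Q).
Local Notation c := (@sphere_compat K dO O m d R L).
Local Notation phi := (fun z : d.-tuple K * O => lambda * \1_cube z.1).
Local Notation gamma := (@unit_ball_volume K d).

Let L_gt0 : 0 < L. Proof. by apply: lt_le_trans L_ge; rewrite mulr_gt0. Qed.

(** Spheres have radius at most 1/2 and centres in the cube, so in the Euclidean model they stay in
    [-1/2, 3/2]^d. Its volume 2^d is the factor in [packing_volume]. *)
Let margin : K := match m with Torus => 0 | Euclidean => 2^-1 end.

Let container : set (d.-tuple K) := box (fun=> - margin) (fun=> 1 + margin).

Definition container_volume : K := match m with Torus => 1 | Euclidean => 2 ^+ d end.

Let container_torus : m = Torus -> container = cube.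
Proof. by move=> mT; rewrite /container /margin mT oppr0 addr0. Qed.

Let measurable_container : measurable container.
Proof. exact: measurable_box. Qed.

Let container_volumeE : vol container = container_volume%:E.
Proof.
rewrite box_volume; last by move=> i; rewrite /margin; case: (m); lra.
rewrite prodr_const card_ord /container_volume /margin; congr EFin.
case: (m); first by rewrite oppr0 subr0 addr0 expr1n.
by congr (_ ^+ _); lra.
Qed.

(** The body of a marked point. It is empty for a centre outside the cube, since disjointness is
    required of all compatible pairs while the torus triangle inequality is available only inside
    the cube. *)
Let packed (z : d.-tuple K * O) : set (d.-tuple K) :=
  [set y | cube z.1 /\ container y /\ sqdist m z.1 y < (R z.2 / L) ^+ 2].

Let measurable_packed z : measurable (packed z).
Proof.
have [cz|cz] := pselect (cube z.1).
  rewrite (_ : packed z = container `&` [set y | sqdist m z.1 y < (R z.2 / L) ^+ 2]).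
    by apply: measurableI => //; exact: measurable_sqdist_ball.
  by apply/seteqP; split => y /=; rewrite /packed /=; tauto.
by rewrite (_ : packed z = set0)//; apply/seteqP; split => y // [].
Qed.

Let radius_half w : 0 < R w / L <= 2^-1.
Proof.
have := R_le w; have h := L_ge; have := L_gt0; rewrite divr_gt0//= ler_pdivrMr//; lra.
Qed.

Let packed_volume z : vol (packed z) = (\1_cube z.1 * (gamma * (R z.2 / L) ^+ d))%:E.
Proof.
have [cz|cz] := pselect (cube z.1); last first.
  rewrite indicE memNset// mul0r (_ : packed z = set0) ?measure0//.
  by apply/seteqP; split => y // [].
rewrite indicE mem_set// mul1r -sqball_volume_sqr; last by case/andP: (radius_half z.2).
move: container_torus; rewrite /packed /container /margin; case: (m) => [/(_ erefl) ->|_].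
  rewrite -(torus_ball_volume cz); first by congr (vol _); apply/seteqP; split => y //= [].
  have /andP[r0 r2] := radius_half z.2.
  rewrite (_ : 4^-1 = 2^-1 ^+ 2); last by field.
  by rewrite lerXn2r ?nnegrE// ltW.
rewrite -(euclidean_ball_volume z.1); congr (vol _); apply/seteqP; split => y /= [].
  by move=> _ [].
have /andP[r0 r2] := radius_half z.2.
move=> h; split => //; split => // i; have /andP[x1 x2] := cz i.
have := sqdist_coord i r0 h; rewrite /= ltr_norml => /andP[? ?].
by apply/andP; split; lra.
Qed.

Let packed_disjoint x y : 0 < c x y -> packed x `&` packed y = set0.
Proof.
rewrite /sphere_compat /sphere_free.
case: (boolP (sqdist m x.1 y.1 < _)) => h; rewrite /= ?ltxx// => _.
apply/seteqP; split => // p [[cx [pc xp]] [cy [_ yp]]]; move: h; apply/negP; rewrite negbK.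
have /andP[r0 _] := radius_half x.2; have /andP[s0 _] := radius_half y.2.
have cp : m = Torus -> forall i, 0 <= tnth p i <= 1.
  by move=> mT; move: pc; rewrite container_torus.
rewrite mulrDl; rewrite sqdist_sym in yp.
apply: le_lt_trans (sum_sqr_lt r0 s0 xp yp).
apply: ler_sum => i _.
have tri : coord_dist m (tnth x.1 i - tnth y.1 i) <=
    coord_dist m (tnth x.1 i - tnth p i) + coord_dist m (tnth p i - tnth y.1 i).
  by apply: coord_dist_triangle => mT; split; [exact: cx|exact: cp|exact: cy].
rewrite lerXn2r ?nnegrE ?coord_dist_ge0//.
by apply: le_trans tri; exact: coord_dist_ge0.
Qed.

(** With the multiplier tau L^d a sphere of radius R / L costs tau gamma R^d, independently of the
    scale. So E is the Laplace transform of gamma R^d at tau. *)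
Lemma hard_sphere_packing (tau : K) : 0 <= tau -> exists2 E : K,
  (\int[Q]_w (expR (- (tau * gamma * R w ^+ d)))%:E = E%:E)%E &
  partition_function mu c phi <=
  expR (tau * L ^+ d * container_volume + lambda * E).
Proof.
move=> tau0.
have mexp : measurable_fun setT (fun w => (expR (- (tau * gamma * R w ^+ d)))%:E).
  apply: measurableT_comp => //; apply: (measurableT_comp (@measurable_expR K)).
  by apply: measurableT_comp => //; apply: measurable_funM => //; exact: measurable_funX.
have gamma_gt0 : 0 < gamma := @unit_ball_volume_gt0 K d.
pose E := fine (\int[Q]_w (expR (- (tau * gamma * R w ^+ d)))%:E).
have EE : (\int[Q]_w (expR (- (tau * gamma * R w ^+ d)))%:E = E%:E)%E.
  rewrite /E fineK// ge0_fin_numE ?integral_ge0//.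
  apply: (@le_lt_trans _ _ (\int[Q]_w 1)%E).
    apply: ge0_le_integral => //.
    move=> w _; rewrite lee_fin -expR0 ler_expR oppr_le0.
    apply: mulr_ge0; first by apply: mulr_ge0 => //; exact: ltW.
    by apply: exprn_ge0; exact: ltW.
  by rewrite integral_cst// [X in (_ * X)%E](probability_setT Q) mule1 ltry.
exists E => //.
have ff := finite_weight_cube Q d lambda_gt0.
have cc : compatibility c by exact: compatibility_sphere.
have mb : measurable_fun [set: d.-tuple K * O] (fun x => fine (vol (packed x))).
  rewrite (_ : (fun x => _) = (fun z => \1_cube z.1 * (gamma * (R z.2 / L) ^+ d))).
    apply: measurable_funM.
      exact: (measurableT_comp (measurable_indic (@measurable_unit_cube K d)) measurable_fst).
    apply: measurable_funM => //; apply: measurable_funX; apply: measurable_funM => //.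
    exact: (measurableT_comp (f := R)).
  by apply/funext => z; rewrite packed_volume.
have th0 : 0 <= tau * L ^+ d by rewrite mulr_ge0// exprn_ge0// ltW.
have := partition_function_packing cc measurable_packed mb packed_disjoint th0 ff
  measurable_container.
have vf : (vol container < +oo)%E by rewrite container_volumeE ltry.
move=> /(_ vf) H; apply: le_trans (H _) _; first by move=> x _ y [_ []].
rewrite ler_expR [X in _ * fine X](container_volumeE) lerD2l /mass.
have -> : (\int[mu]_z (phi z * expR (- (tau * L ^+ d * fine (vol (packed z)))))%:E =
    \int[mu]_z (lambda%:E * ((\1_cube z.1)%:E *
       (expR (- (tau * gamma * R z.2 ^+ d)))%:E)))%E.
  apply: eq_integral => z _; rewrite packed_volume /= -!EFinM; congr EFin.
  rewrite -mulrA; congr (_ * _); rewrite indicE; case: (_ \in _); rewrite ?mul0r//.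
  rewrite !mul1r; congr (expR (- _)); rewrite expr_div_n; field.
  by rewrite expf_neq0// gt_eqF.
rewrite ge0_integralZl//; last 2 first.
- apply: emeasurable_funM; last exact: (measurableT_comp mexp measurable_snd).
  apply: measurableT_comp => //.
  exact: (measurableT_comp (measurable_indic (@measurable_unit_cube K d)) measurable_fst).
- by rewrite lee_fin ltW.
rewrite (ge0_integral_prod_fst vol Q (@measurable_unit_cube K d) mexp); last first.
  by move=> w; rewrite lee_fin expR_ge0.
by rewrite EE [X in (_ * (X * _))%E](lebesgue_tuple_cube d) mul1e.
Qed.

End packing.

(** * Comparison of the two models *)

Section model_comparison.
Context {K : realType} {dO : measure_display} {O : measurableType dO}.
Variables (Q : probability O K) (R : {RV Q >-> K}) (d : nat).
Variables (rbar L lambda : K).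
Hypothesis rbar_gt0 : 0 < rbar.
Hypothesis R_gt0 : forall w, 0 < R w.
Hypothesis R_le : forall w, R w <= rbar.
Hypothesis L_ge : 4 * rbar <= L.
Hypothesis lambda_gt0 : 0 < lambda.

Local Notation vol := (@lebesgue_tuple K d).
Local Notation cube := (@unit_cube K d).
Local Notation mu := (sigma_prod vol Q).
Local Notation c m := (@sphere_compat K dO O m d R L).
Local Notation phi := (fun z : d.-tuple K * O => lambda * \1_cube z.1).

Let L_gt0 : 0 < L. Proof. by apply: lt_le_trans L_ge; rewrite mulr_gt0. Qed.

Let cc m : compatibility (c m). Proof. exact: compatibility_sphere. Qed.

Let cube_of (z : d.-tuple K * O) : 0 < phi z -> cube z.1.
Proof.
rewrite /= indicE; have [//|cz] := pselect (cube z.1).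
by rewrite memNset// mulr0 ltxx.
Qed.

(** Torus distances are the smaller ones, so more pairs overlap on the torus. *)
Lemma partition_function_torus_le :
  partition_function mu (c Torus) phi <= partition_function mu (c Euclidean) phi.
Proof.
have ff := finite_weight_cube Q d lambda_gt0.
apply: le_partition_function => // x y /cube_of cx /cube_of cy.
rewrite /sphere_compat /sphere_free ler_nat.
suff le_sq : sqdist Torus x.1 y.1 <= sqdist Euclidean x.1 y.1.
  case: (boolP (sqdist Torus _ _ < _)) => //= h.
  by rewrite lt0b -leNgt (le_trans _ le_sq)// leNgt.
apply: ler_sum => i _; rewrite lerXn2r ?nnegrE ?coord_dist_ge0//=.
by rewrite ge_min lexx.
Qed.

Let margin := box (fun _ : 'I_d => rbar / L) (fun=> 1 - rbar / L).

Let rL : 0 < rbar / L <= 4^-1.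
Proof.
have := L_ge; have := L_gt0; rewrite divr_gt0//= ler_pdivrMr//; lra.
Qed.

Let margin_cube : margin `<=` cube.
Proof.
move=> x h i; have /andP[? ?] := h i; have /andP[? ?] := rL.
by apply/andP; split; lra.
Qed.

(** Points within rbar / L of a face are split off and freed; their mass is the exponent on the
    right. For the others no overlap goes through the boundary, so Euclidean compatibility implies
    torus compatibility. *)
Lemma partition_function_euclidean_le :
  partition_function mu (c Euclidean) phi <= partition_function mu (c Torus) phi *
    expR (lambda * (1 - (1 - 2 * rbar / L) ^+ d)).
Proof.
have ff := finite_weight_cube Q d lambda_gt0.
have mmargin : measurable margin := measurable_box _ _.
have vmargin : vol margin = ((1 - 2 * rbar / L) ^+ d)%:E.
  rewrite /margin box_volume; last by move=> i; have /andP[? ?] := rL; lra.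
  rewrite (eq_bigr (fun=> 1 - 2 * rbar / L)) ?prodr_const ?card_ord// => i _; lra.
have fin A : measurable A -> A `<=` cube -> (vol A < +oo)%E.
  move=> mA Ac; apply: (@le_lt_trans _ _ (vol cube)).
    by apply: (le_measure vol); rewrite ?inE//; exact: measurable_unit_cube.
  by rewrite lebesgue_tuple_cube ltry.
have mcube : measurable cube := @measurable_unit_cube K d.
have mrest : measurable (cube `\` margin) by exact: measurableD.
have l0 : 0 <= lambda := ltW lambda_gt0.
have f1 := finite_weight_region Q l0 mmargin (fin _ mmargin margin_cube).
have f2 := finite_weight_region Q l0 mrest (fin _ mrest (@subDsetl _ _ _)).
have e : phi = (fun z => region_weight lambda margin z + region_weight lambda (cube `\` margin) z).
  apply/funext => z; rewrite /region_weight -mulrDr; congr (_ * _).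
  rewrite !indicE in_setD; have [mz|mz] := pselect (margin z.1).
    by rewrite (mem_set mz) (mem_set (margin_cube mz)) addr0.
  by rewrite (memNset mz) add0r andbT.
have := partition_functionD (cc Euclidean) f1 f2; rewrite -e => /le_trans; apply.
apply: ler_pM.
- by apply: le_trans (partition_function_ge1 (cc _) f1).
- by apply: le_trans (partition_function_ge1 (cc _) f2).
- apply: le_partition_function => // x.
    rewrite /region_weight ler_wpM2l// !indicE ler_nat.
    have [mx|mx] := pselect (margin x.1); last by rewrite memNset.
    by rewrite mem_set// mem_set//; exact: margin_cube.
  have inm (z : d.-tuple K * O) : 0 < region_weight lambda margin z -> margin z.1.
    rewrite /region_weight indicE; have [//|cz] := pselect (margin z.1).
    by rewrite memNset// mulr0 ltxx.
  move=> y /inm mx /inm my.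
  have cx := margin_cube mx; have cy := margin_cube my.
  rewrite /sphere_compat /sphere_free ler_nat.
  suff imp : sqdist Torus x.1 y.1 < ((R x.2 + R y.2) / L) ^+ 2 ->
      sqdist Euclidean x.1 y.1 <= sqdist Torus x.1 y.1.
    case: (boolP (sqdist Euclidean _ _ < _)) => //= h.
    rewrite lt0b; apply/negP => h'; move/negP: h; apply.
    exact: le_lt_trans (imp h') h'.
  move=> h; apply: ler_sum => i _; rewrite lerXn2r ?nnegrE ?coord_dist_ge0//.
  have r0 : 0 < (R x.2 + R y.2) / L by rewrite divr_gt0// addr_gt0.
  have := sqdist_coord i r0 h; rewrite /= => hi.
  have rr : (R x.2 + R y.2) / L <= 2 * (rbar / L).
    by rewrite mulrA ler_pM2r ?invr_gt0//; have := R_le x.2; have := R_le y.2; lra.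
  (* Going round through the boundary takes at least 2 rbar / L, which no overlap range exceeds. *)
  have txy : `|tnth x.1 i - tnth y.1 i| <= 1 - 2 * (rbar / L).
    have /andP[? ?] := mx i; have /andP[? ?] := my i.
    by rewrite ler_norml; apply/andP; split; lra.
  by rewrite le_min lexx/=; move: hi; rewrite gt_min => /orP[]; lra.
apply: le_trans (partition_function_le_exp (cc _) f2) _.
rewrite ler_expR mass_region//; last exact: fin.
rewrite ler_wpM2l// measureD//; last exact: (fin _ mcube).
rewrite (setIidr margin_cube).
rewrite [X in fine (X - _)%E](lebesgue_tuple_cube d) [X in fine (_ - X)%E]vmargin.
by rewrite -EFinB.
Qed.

End model_comparison.

Lemma partition_function_sum {K : realType} {dS : measure_display}
    {S : measurableType dS} (mu : {sigma_finite_measure set S -> \bar K})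
    (c : S -> S -> K) (I : Type) (r : seq I) (f : I -> S -> K) :
  compatibility c -> (forall i, finite_weight mu (f i)) ->
  finite_weight mu (fun z => \sum_(i <- r) f i z) /\
  partition_function mu c (fun z => \sum_(i <- r) f i z) <=
    \prod_(i <- r) partition_function mu c (f i).
Proof.
move=> cc ff; elim: r => [|i r [fr IH]].
  have -> : (fun z => \sum_(i <- [::]) f i z) = cst (0 : K).
    by apply/funext => z; rewrite big_nil.
  have f0 : finite_weight mu (cst (0 : K)).
    by split; [split|rewrite integral0].
  split=> //; rewrite big_nil; apply: le_trans (partition_function_le_exp cc f0) _.
  by rewrite /mass integral0 expR0.
have -> : (fun z => \sum_(j <- i :: r) f j z) = (fun z => f i z + \sum_(j <- r) f j z).
  by apply/funext => z; rewrite big_cons.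
split; first exact: finite_weightD.
rewrite big_cons; apply: le_trans (partition_functionD cc (ff i) fr) _.
rewrite ler_wpM2l//; apply: le_trans (partition_function_ge1 cc (ff i)).
exact: ler01.
Qed.

(** * Rescaling to unit intensity *)

Section rescaling.
Context {K : realType} {dO : measure_display} {O : measurableType dO}.
Variables (Q : probability O K) (R : {RV Q >-> K}) (d : nat).

Local Notation vol := (@lebesgue_tuple K d).
Local Notation mu := (sigma_prod vol Q).
Local Notation c := (@sphere_compat K dO O Euclidean d R).

(** Distances are multiplied by a, which L absorbs, and the Jacobian a^d of each point goes into the
    weight. *)
Lemma partition_function_affine (a L : K) (b : d.-tuple K) f : 0 < a ->
  weight f -> partition_function mu (c L) f =
  partition_function mu (c (L * a)) (fun z => a ^+ d * f (affine_tuple a b z.1, z.2)).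
Proof.
move=> a0 wf; rewrite /partition_function.
suff e n : conf_int mu (c L) n f =
    conf_int mu (c (L * a)) n (fun z => a ^+ d * f (affine_tuple a b z.1, z.2)).
  by congr (limn (series _)); apply/funext => n; rewrite e.
apply: (conf_int_transfer (T := fun z => (affine_tuple a b z.1, z.2)) (w := fun=> a ^+ d)) => //.
- exact: compatibility_sphere.
- move=> z z'; rewrite /sphere_compat /sphere_free /=.
  have -> : sqdist Euclidean (affine_tuple a b z.1) (affine_tuple a b z'.1) =
      a ^+ 2 * sqdist Euclidean z.1 z'.1.
    rewrite /sqdist mulr_sumr; apply: eq_bigr => i _; rewrite !tnth_mktuple /=.
    rewrite (_ : a * _ + _ - _ = a * (tnth z.1 i - tnth z'.1 i)); last by ring.
    by rewrite normrM exprMn (gtr0_norm a0).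
  rewrite invfM mulrA exprMn (exprVn a) ltr_pdivlMr ?exprn_gt0//.
  by rewrite mulrC.
- move=> h mh h0.
  have mT : measurable_fun [set: d.-tuple K * O] (fun z => (affine_tuple a b z.1, z.2)).
    apply: measurable_fun_pair => //.
    exact: (measurableT_comp (@measurable_affine_tuple K d a b) measurable_fst).
  have mhT := measurableT_comp mh mT.
  rewrite ge0_integral_prod_swap// ge0_integral_prod_swap; last 2 first.
  + exact: emeasurable_funM.
  + by move=> z; apply: mule_ge0 => //; rewrite lee_fin exprn_ge0// ltW.
  apply: eq_integral => w _ /=.
  have mhw : measurable_fun setT (fun x => h (x, w)).
    exact: (measurableT_comp mh (measurable_pair2 w)).
  rewrite (ge0_integral_affine_tuple b (lt0r_neq0 a0) mhw)// gtr0_norm//.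
  rewrite ge0_integralZl//=; last by rewrite lee_fin exprn_ge0// ltW.
  exact: (measurableT_comp mhT (measurable_pair2 w)).
Qed.

Local Notation big_box L := (box (fun _ : 'I_d => 0) (fun=> L)).

(** The gas of unit intensity and unscaled radii in a box of side L. When eta d = 1 it is the
    original gas at lambda = L^d, so different intensities become different boxes of one model. *)
Definition box_partition (L : K) : K :=
  partition_function mu (c 1) (region_weight 1 (big_box L)).

Let big_box_volume L : 0 <= L -> vol (big_box L) = (L ^+ d)%:E.
Proof.
move=> L0; rewrite box_volume//; congr EFin.
by under eq_bigr do rewrite subr0; rewrite prodr_const card_ord.
Qed.

Let finite_big_box L : 0 <= L -> finite_weight mu (region_weight 1 (big_box L)).
Proof.
move=> L0; apply: finite_weight_region; rewrite ?ler01 ?big_box_volume ?ltry//.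
exact: measurable_box.
Qed.

Let cc : compatibility (c 1). Proof. exact: compatibility_sphere. Qed.

Lemma box_partitionE L : 0 < L ->
  partition_function mu (c L) (fun z => L ^+ d * \1_(unit_cube d) z.1) =
  box_partition L.
Proof.
move=> L0; have [wf _] := finite_big_box (ltW L0).
rewrite /box_partition (partition_function_affine 1 [tuple 0 | i < d] L0 wf) mul1r.
congr (partition_function _ _ _); apply/funext => z; congr (_ * _).
rewrite /region_weight mul1r !indicE; congr (nat_of_bool _)%:R.
have e i : tnth (affine_tuple L [tuple 0 | i < d] z.1) i = L * tnth z.1 i.
  by rewrite !tnth_mktuple addr0.
apply/idP/idP => /set_mem h; apply/mem_set => i; have := h i.
  by rewrite /= e => /andP[h1 h2]; rewrite mulr_ge0 ?(ltW L0)//= ger_pMr.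
by rewrite /= e pmulr_rge0// ger_pMr.
Qed.

Lemma box_partition_ge1 L : 0 <= L -> 1 <= box_partition L.
Proof. by move=> L0; apply: partition_function_ge1 => //; exact: finite_big_box. Qed.

(** The points outside the smaller box are freed. *)
Lemma box_partition_growth L L' : 0 <= L <= L' ->
  box_partition L' <= box_partition L * expR (L' ^+ d - L ^+ d).
Proof.
move=> /andP[L0 LL]; have L'0 := le_trans L0 LL.
have sub : big_box L `<=` big_box L'.
  by move=> x h i; have /andP[-> h2] := h i; exact: le_trans LL.
have mrest : measurable (big_box L' `\` big_box L).
  by apply: measurableD; exact: measurable_box.
have fbox : (vol (big_box L') < +oo)%E by rewrite big_box_volume// ltry.
have frest : (vol (big_box L' `\` big_box L) < +oo)%E.
  apply: le_lt_trans fbox; apply: (le_measure vol); rewrite ?inE//.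
  exact: measurable_box.
have f2 := finite_weight_region Q ler01 mrest frest.
have e : region_weight 1 (big_box L') = (fun z : d.-tuple K * O =>
    region_weight 1 (big_box L) z + region_weight 1 (big_box L' `\` big_box L) z).
  apply/funext => z; rewrite /region_weight -mulrDr; congr (_ * _).
  rewrite !indicE in_setD; have [mz|mz] := pselect (big_box L z.1).
    by rewrite (mem_set mz) (mem_set (sub _ mz)) addr0.
  by rewrite (memNset mz) add0r andbT.
rewrite /box_partition e; apply: le_trans (partition_functionD cc (finite_big_box L0) f2) _.
rewrite ler_wpM2l//; first by rewrite (le_trans ler01)// box_partition_ge1.
apply: le_trans (partition_function_le_exp cc f2) _.
rewrite ler_expR mass_region// mul1r measureD//; try exact: measurable_box.
rewrite (setIidr sub).
by rewrite [X in fine (X - _)%E]big_box_volume// [X in fine (_ - X)%E]big_box_volume.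
Qed.

Let subinterval M (L x : K) : 0 <= x <= M.+1%:R * L ->
  exists k : 'I_M.+1, k%:R * L <= x <= k%:R * L + L.
Proof.
elim: M => [|M IH] /andP[x0 xM].
  by exists ord0; rewrite mul0r add0r x0; move: xM; rewrite mul1r.
have [h|h] := leP x (M.+1%:R * L).
  have [|k hk] := IH; first by rewrite x0.
  by exists (widen_ord (leqnSn _) k).
exists ord_max; rewrite (ltW h)/=; move: xM; rewrite -[M.+2%:R]natr1 mulrDl mul1r.
by [].
Qed.

(** Translates of the small box cover the large one. They share faces, so the large weight is only
    dominated by the sum of theirs, which monotonicity of the partition function allows. *)
Lemma box_partition_subadditive (M : nat) L : 0 < L ->
  box_partition (M.+1%:R * L) <= box_partition L ^+ (M.+1 ^ d).
Proof.
move=> L0; pose corner (k : {ffun 'I_d -> 'I_M.+1}) : d.-tuple K := [tuple (k i)%:R * L | i < d].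
pose cell k := box (fun i => tnth (corner k) i) (fun i => tnth (corner k) i + L).
have fcell k : finite_weight mu (region_weight 1 (cell k)).
  apply: finite_weight_region => //; first exact: measurable_box.
  by rewrite box_volume ?ltry// => i; rewrite lerDl ltW.
have [fs le_s] := partition_function_sum (index_enum _) cc fcell.
have -> : box_partition L ^+ (M.+1 ^ d) =
    \prod_(k : {ffun 'I_d -> 'I_M.+1}) partition_function mu (c 1) (region_weight 1 (cell k)).
  rewrite -[X in (X ^ d)%N]card_ord -[X in (_ ^ X)%N]card_ord -card_ffun -prodr_const.
  apply: eq_bigr => k _; have [wf _] := fcell k.
  rewrite (partition_function_affine 1 (corner k) ltr01 wf) mulr1.
  congr (partition_function _ _ _); apply/funext => z.
  rewrite /region_weight expr1n !mul1r !indicE; congr (nat_of_bool _)%:R.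
  have e i : tnth (affine_tuple 1 (corner k) z.1) i = tnth (corner k) i + tnth z.1 i.
    by rewrite tnth_mktuple mul1r addrC.
  by apply/idP/idP => /set_mem h; apply/mem_set => i; have := h i;
    rewrite e lerDl lerD2l.
apply: le_trans le_s; apply: le_partition_function => //.
  by apply: finite_big_box; rewrite mulr_ge0// ltW.
move=> z; rewrite /region_weight mul1r indicE.
have [hz|hz] := pselect (big_box (M.+1%:R * L) z.1); last first.
  by rewrite memNset//; apply: sumr_ge0 => k _; rewrite mul1r.
have [k hk] : exists k : {ffun 'I_d -> 'I_M.+1}, cell k z.1.
  have /choice[k hk] : forall i, exists k : 'I_M.+1,
      k%:R * L <= tnth z.1 i <= k%:R * L + L.
    by move=> i; apply: subinterval; exact: hz.
  by exists [ffun i => k i] => i; rewrite tnth_mktuple ffunE; exact: hk.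
rewrite (mem_set hz) (bigD1 k)//= mul1r [X in X + _]indicE (mem_set hk).
by rewrite lerDl; apply: sumr_ge0 => j _; rewrite mul1r.
Qed.

End rescaling.

(** * Asymptotics *)

Section real_limits.
Context {K : realType}.

Lemma cvg_powR_pinfty (b : K) : 0 < b -> x `^ b @[x --> +oo%R] --> +oo%R.
Proof.
move=> b0; apply/cvgryPge => A.
pose A1 := Num.max A 1; have A10 : 0 < A1 by rewrite lt_max ltr01 orbT.
near=> x; have xA : A1 `^ b^-1 <= x.
  by near: x; apply: nbhs_pinfty_ge; exact: num_real.
apply: (@le_trans _ _ A1); first by rewrite le_max lexx.
rewrite -[leLHS](powRr1 (ltW A10)) -(mulVf (lt0r_neq0 b0)) powRrM.
by rewrite ge0_ler_powR ?nnegrE ?powR_ge0 ?(ltW b0)// (le_trans (powR_ge0 _ _) xA).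
Unshelve. all: by end_near. Qed.

Lemma cvg_powRN_pinfty (b : K) : b < 0 -> x `^ b @[x --> +oo%R] --> (0 : K).
Proof.
move=> b0.
have b0' : 0 < - b by rewrite oppr_gt0.
have h : (x `^ (- b))^-1 @[x --> +oo%R] --> (0 : K).
  apply/(gtr0_cvgV0 (f := fun x : K => x `^ (- b))); last exact: cvg_powR_pinfty.
  by near=> x; apply: powR_gt0; near: x; apply: nbhs_pinfty_gt; exact: num_real.
apply: cvg_trans h; apply: near_eq_cvg; near=> x.
by rewrite /= powRN invrK.
Unshelve. all: by end_near. Qed.

Lemma powR_exprn (x b : K) n : 0 <= x -> (x `^ b) ^+ n = x `^ (b * n%:R).
Proof. by move=> x0; rewrite powRrM powR_mulrn// powR_ge0. Qed.

Lemma cvg_one_minus_div (a : K) n : (1 - a / x) ^+ n @[x --> +oo%R] --> (1 : K).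
Proof.
rewrite -[X in _ --> X](expr1n _ n).
apply: (continuous_cvg _ (@exprn_continuous K n 1)).
rewrite -[X in _ --> X]subr0; apply: cvgB; first exact: cvg_cst.
rewrite -[X in _ --> X](mulr0 a); apply: cvgM; first exact: cvg_cst.
apply/gtr0_cvgV0; last exact: cvg_id.
by near=> x; near: x; apply: nbhs_pinfty_gt; exact: num_real.
Unshelve. all: by end_near. Qed.

(** With s = ln g, the right side minus the left one is (g^2 - 1 - 2 s g) / (2 g^2), so the claim is
    s <= sinh s. *)
Lemma entropy_bound (g : K) : 1 < g ->
  g^-1 * ln g - 1 + g^-1 <= - (2^-1 * (1 - 1 / g) ^+ 2).
Proof.
move=> g1; have g0 : 0 < g by apply: lt_trans g1.
pose s := ln g; have s0 : 0 < s by rewrite ln_gt0.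
have gE : g = expR s by rewrite /s lnK// posrE.
suff h : 2 * s * g <= g ^+ 2 - 1.
  rewrite -subr_ge0 -/s.
  have -> : - (2^-1 * (1 - 1 / g) ^+ 2) - (g^-1 * s - 1 + g^-1) =
    (g ^+ 2 - 1 - 2 * s * g) / (2 * g ^+ 2) by field; rewrite gt_eqF.
  by rewrite divr_ge0 ?subr_ge0// mulr_ge0// exprn_ge0 ?ltW.
(* The quadratic Taylor polynomial p of exp at s is enough, because p (p - 2 s) = 1 + s^4 / 4. *)
have gp : 1 + s + s ^+ 2 / 2 <= g.
  rewrite gE /expR.
  have nd : nondecreasing_seq (series (exp_coeff s)).
    by apply: nondecreasing_series => n _ _; rewrite /exp_coeff /= divr_ge0// exprn_ge0// ltW.
  have := nondecreasing_cvgn_le nd (is_cvg_series_exp_coeff s) 3.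
  rewrite {1}/series /= /exp_coeff !big_nat_recr//= big_geq//= expr0 expr1.
  by rewrite add0r fact0 !divr1.
have p0 : 0 < 1 + s + s ^+ 2 / 2 by rewrite !addr_gt0// divr_gt0// exprn_gt0.
have : 1 <= g * (g - 2 * s).
  apply: (@le_trans _ _ ((1 + s + s ^+ 2 / 2) * (1 + s + s ^+ 2 / 2 - 2 * s))).
    rewrite (_ : _ * _ = 1 + s ^+ 4 / 4); last by field.
    by rewrite lerDl divr_ge0// exprn_ge0// ltW.
  apply: ler_pM; [exact: ltW| |exact: gp|by rewrite lerD2r].
  rewrite (_ : _ - _ = ((1 - s) ^+ 2 + 1) / 2); last by field.
  by rewrite divr_ge0// addr_ge0// sqr_ge0.
by rewrite mulrBr -expr2 => h; lra.
Qed.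

End real_limits.

(** Fekete's argument for integer dilations, monotonicity filling the gaps. Let L0 nearly attain the
    supremum of H L / L^d, and let L lie between (M + 1) L0 and (M + 2) L0. Then H L >= (M + 1)^d H
    L0 >= (L - L0)^d H L0 / L0^d. *)
Lemma growth_limit {K : realType} (H : K -> K) (d : nat) :
  (forall L, 0 < L -> 0 <= H L <= L ^+ d) ->
  (forall L L', 0 < L <= L' -> H L <= H L') ->
  (forall (M : nat) L, 0 < L -> M.+1%:R ^+ d * H L <= H (M.+1%:R * L)) ->
  exists l : K, H L / L ^+ d @[L --> +oo%R] --> l.
Proof.
move=> bnd mono super.
pose A := [set H L / L ^+ d | L in [set L : K | 0 < L]].
have supA : has_sup A.
  split; first by exists (H 1 / 1 ^+ d); exists 1 => //=.
  exists 1 => _ [L /= L0 <-]; have /andP[_ h] := bnd _ L0.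
  by rewrite ler_pdivrMr ?exprn_gt0// mul1r.
exists (sup A); apply/cvgrPdist_le => e e0.
have [_ [L0 /= L0_gt0 <-] hL0] := sup_adherent e0 supA.
pose q := H L0 / L0 ^+ d.
have q0 : 0 <= q by have /andP[? _] := bnd _ L0_gt0; rewrite divr_ge0// exprn_ge0// ltW.
have cq : (1 - L0 / L) ^+ d * q @[L --> +oo%R] --> q.
  by rewrite -[X in _ --> X]mul1r; apply: cvgMr_tmp; exact: cvg_one_minus_div.
near=> L.
have LL0 : L0 < L by near: L; apply: nbhs_pinfty_gt; exact: num_real.
have L_gt0 := lt_trans L0_gt0 LL0.
have up : H L / L ^+ d <= sup A by apply: sup_upper_bound => //; exists L.
rewrite ger0_norm ?subr_ge0// lerBlDr -lerBlDl.
apply: (@le_trans _ _ ((1 - L0 / L) ^+ d * q)).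
  by near: L; apply: (cvgr_ge _ cq).
have [M hM] : exists M : nat, M.+1%:R * L0 <= L < M.+2%:R * L0.
  have t0 : 1 <= L / L0 by rewrite ler_pdivlMr// mul1r ltW.
  have /truncn_itv := le_trans ler01 t0.
  have : (0 < Num.truncn (L / L0))%N by rewrite truncn_gt0.
  case: (Num.truncn _) => // M _ /andP[h1 h2]; exists M.
  by rewrite -ler_pdivlMr// -ltr_pdivrMr// h1.
have /andP[M1 M2] := hM.
have M0 : 0 < M.+1%:R * L0 by rewrite mulr_gt0.
rewrite ler_pdivlMr ?exprn_gt0//.
apply: (@le_trans _ _ (H (M.+1%:R * L0))); last by apply: mono; rewrite M0.
apply: le_trans (super M L0 L0_gt0).
have -> : (1 - L0 / L) ^+ d * q * L ^+ d = (L - L0) ^+ d * q.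
  by rewrite mulrAC -exprMn mulrBl mul1r divfK ?gt_eqF.
apply: (@le_trans _ _ ((M.+1%:R * L0) ^+ d * q)).
  rewrite ler_wpM2r// lerXn2r ?nnegrE ?subr_ge0 ?(ltW LL0) ?(ltW M0)//.
  by move: M2; rewrite -natr1 mulrDl mul1r => h; lra.
rewrite exprMn /q le_eqVlt; apply/orP; left; apply/eqP; field.
by rewrite expf_neq0// gt_eqF.
Unshelve. all: by end_near. Qed.

Section asymptotics.
Context {K : realType} {dO : measure_display} {O : measurableType dO}.
Variables (Q : probability O K) (R : {RV Q >-> K}) (d : nat) (rbar eta : K).
Hypothesis rbar_gt0 : 0 < rbar.
Hypothesis R_gt0 : forall w, 0 < R w.
Hypothesis R_le : forall w, R w <= rbar.
Hypothesis eta_gt0 : 0 < eta.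

Local Notation vol := (@lebesgue_tuple K d).
Local Notation mu := (sigma_prod vol Q).
Local Notation gamma := (@unit_ball_volume K d).
Local Notation a := (eta * d%:R).
Local Notation A := (gamma * mixed_moment R d / 2).

Definition hard_sphere_partition (m : model) (lambda L : K) : K :=
  partition_function mu (sphere_compat m R L) (fun z => lambda * \1_(unit_cube d) z.1).

(** This is ln P, expressed through the gas because [Pr] is constrained only where the spheres are
    small. *)
Definition no_overlap_log (m : model) (lambda : K) : K :=
  ln (hard_sphere_partition m lambda (lambda `^ eta)) - lambda.

Let B := 2 / 3 * (gamma * (2 * rbar) ^+ d) ^+ 2.

Let B_ge0 : 0 <= B. Proof. by rewrite mulr_ge0// sqr_ge0. Qed.

Let compat m L : compatibility (@sphere_compat K dO O m d R L).
Proof. exact: compatibility_sphere. Qed.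

Lemma hard_sphere_partition_ge1 m lambda L : 0 < lambda ->
  1 <= hard_sphere_partition m lambda L.
Proof. by move=> l0; apply: partition_function_ge1 => //; exact: finite_weight_cube. Qed.

Lemma hard_sphere_partition_gt0 m lambda L : 0 < lambda ->
  0 < hard_sphere_partition m lambda L.
Proof. by move=> l0; apply: lt_le_trans (hard_sphere_partition_ge1 m L l0). Qed.

Lemma expR_no_overlap_log m lambda : 0 < lambda ->
  expR (no_overlap_log m lambda) =
  expR (- lambda) * hard_sphere_partition m lambda (lambda `^ eta).
Proof.
move=> l0; rewrite /no_overlap_log expRD lnK ?posrE ?hard_sphere_partition_gt0//.
by rewrite mulrC.
Qed.

Lemma no_overlap_log_ge m lambda : 0 < lambda -> - lambda <= no_overlap_log m lambda.
Proof.
by move=> l0; rewrite /no_overlap_log lerDr ln_ge0// hard_sphere_partition_ge1.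
Qed.

Definition boundary (m : model) (lambda : K) : K := boundary_factor m d rbar (lambda `^ eta).

Lemma near_small : \forall lambda \near +oo%R, 0 < lambda /\ 4 * rbar <= lambda `^ eta.
Proof.
near=> l; split; first by near: l; apply: nbhs_pinfty_gt; exact: num_real.
near: l; have /cvgryPge := cvg_powR_pinfty eta_gt0; exact.
Unshelve. all: by end_near. Qed.

Let powR_sq (l : K) : 0 < l -> l ^+ 2 / (l `^ eta) ^+ d = l `^ (2 - a).
Proof.
move=> l0; rewrite powRB; last by rewrite (gt_eqF l0) implybT.
by rewrite powR_exprn ?ltW// -powR_mulrn ?ltW.
Qed.

Let powR_cube (l : K) : 0 < l -> l ^+ 3 / (l `^ eta) ^+ d ^+ 2 = l `^ (3 - 2 * a).
Proof.
move=> l0; rewrite powRB; last by rewrite (gt_eqF l0) implybT.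
by rewrite powR_exprn ?ltW// powR_exprn ?ltW// -powR_mulrn ?ltW// (mulrC 2).
Qed.

Lemma no_overlap_log_lower m l : 0 < l -> 4 * rbar <= l `^ eta ->
  - (A * l `^ (2 - a)) <= no_overlap_log m l.
Proof.
move=> l0 lL; have := hard_sphere_lower m d rbar_gt0 R_gt0 R_le lL l0.
rewrite -/(hard_sphere_partition m l (l `^ eta)) powR_sq//.
rewrite -[hard_sphere_partition _ _ _]lnK ?posrE ?hard_sphere_partition_gt0//.
by rewrite ler_expR /no_overlap_log => h; lra.
Qed.

Lemma no_overlap_log_upper m l : 0 < l -> 4 * rbar <= l `^ eta ->
  no_overlap_log m l <= - (boundary m l * (A * l `^ (2 - a))) + B * l `^ (3 - 2 * a).
Proof.
move=> l0 lL; have := hard_sphere_upper m d rbar_gt0 R_gt0 R_le lL l0.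
rewrite -/(hard_sphere_partition m l (l `^ eta)) powR_sq// powR_cube//.
rewrite -[hard_sphere_partition _ _ _]lnK ?posrE ?hard_sphere_partition_gt0//.
rewrite ler_expR /no_overlap_log /boundary /B => h; lra.
Qed.

Lemma cvg_boundary m : boundary m l @[l --> +oo%R] --> (1 : K).
Proof.
rewrite /boundary /boundary_factor; case: m; first exact: cvg_cst.
exact: (cvg_comp _ _ (cvg_powR_pinfty eta_gt0) (cvg_one_minus_div (4 * rbar) d)).
Qed.

Let upper_cvg m (u v : K -> K) (x y : K) : u l @[l --> +oo%R] --> x ->
  v l @[l --> +oo%R] --> y ->
  - (boundary m l * (A * u l)) + B * v l @[l --> +oo%R] --> - (A * x) + B * y.
Proof.
move=> ux vy; apply: cvgD; last by apply: cvgM => //; exact: cvg_cst.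
apply: cvgN; rewrite -[X in _ --> X]mul1r; apply: cvgM; first exact: cvg_boundary.
by apply: cvgM => //; exact: cvg_cst.
Qed.

(** The condition 3 / 2 < a makes the exponent 3 - 2 a of the error negative. *)
Lemma no_overlap_log_cvg m x : l `^ (2 - a) @[l --> +oo%R] --> x -> 3 / 2 < a ->
  no_overlap_log m l @[l --> +oo%R] --> - (A * x).
Proof.
move=> ux a32.
have vy : l `^ (3 - 2 * a) @[l --> +oo%R] --> (0 : K) by apply: cvg_powRN_pinfty; lra.
have up := @upper_cvg m _ _ _ _ ux vy; rewrite mulr0 addr0 in up.
have low : - (A * l `^ (2 - a)) @[l --> +oo%R] --> - (A * x).
  by apply: cvgN; apply: cvgM => //; exact: cvg_cst.
apply: (squeeze_cvgr _ low up); near=> l; have [//|l0 lL] := near near_small l.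
by rewrite no_overlap_log_lower// no_overlap_log_upper.
Unshelve. all: by end_near. Qed.

(** After division by lambda^(2 - a) the error is of order lambda^(1 - a). *)
Lemma no_overlap_log_intermediate m : 1 < a < 2 ->
  (l `^ (2 - a))^-1 * no_overlap_log m l @[l --> +oo%R] --> - A.
Proof.
move=> /andP[a1 a2].
have vy : l `^ (1 - a) @[l --> +oo%R] --> (0 : K) by apply: cvg_powRN_pinfty; lra.
have ux : (fun _ : K => (1 : K)) @ +oo%R --> (1 : K) by exact: cvg_cst.
have up := @upper_cvg m _ _ _ _ ux vy; rewrite mulr0 addr0 mulr1 in up.
apply: (squeeze_cvgr _ (cvg_cst (- A)) up).
near=> l; have [//|l0 lL] := near near_small l.
have p0 : 0 < l `^ (2 - a) by exact: powR_gt0.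
rewrite ler_pdivlMl// mulrC mulNr no_overlap_log_lower//= ler_pdivrMl//.
apply: le_trans (no_overlap_log_upper m l0 lL) _.
have -> : l `^ (3 - 2 * a) = l `^ (1 - a) * l `^ (2 - a).
  rewrite -powRD; last by rewrite (gt_eqF l0) implybT.
  by congr (_ `^ _); ring.
rewrite le_eqVlt; apply/orP; left; apply/eqP; ring.
Unshelve. all: by end_near. Qed.

Lemma no_overlap_log_torus : 3 / 2 < a ->
  no_overlap_log Torus l + A * l `^ (2 - a) @[l --> +oo%R] --> (0 : K).
Proof.
move=> a32.
have vy : B * l `^ (3 - 2 * a) @[l --> +oo%R] --> (0 : K).
  rewrite -[X in _ --> X](mulr0 B); apply: cvgM; first exact: cvg_cst.
  by apply: cvg_powRN_pinfty; lra.
apply: (squeeze_cvgr _ (cvg_cst 0) vy).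
near=> l; have [//|l0 lL] := near near_small l.
have := no_overlap_log_lower Torus l0 lL; have := no_overlap_log_upper Torus l0 lL.
by rewrite /boundary /boundary_factor mul1r => h1 h2; apply/andP; split; lra.
Unshelve. all: by end_near. Qed.

Lemma no_overlap_log_packing m tau : 0 <= tau -> exists2 E : K,
  (\int[Q]_w (expR (- (tau * gamma * R w ^+ d)))%:E = E%:E)%E &
  forall l, 0 < l -> 4 * rbar <= l `^ eta ->
    no_overlap_log m l <= tau * l `^ a * container_volume m d + l * (E - 1).
Proof.
move=> tau0.
(* E depends on tau alone. It is read off at lambda = 1 and L = 4 rbar, then identified with the
   value obtained at any other intensity. *)
have [E EE _] := hard_sphere_packing m d rbar_gt0 R_gt0 R_le (lexx _) ltr01 tau0.
exists E => // l l0 lL.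
have [E' EE' h] := hard_sphere_packing m d rbar_gt0 R_gt0 R_le lL l0 tau0.
have {EE'} E'E : E' = E by move: EE'; rewrite EE => -[].
move: h; rewrite E'E -/(hard_sphere_partition m l (l `^ eta)).
rewrite -[hard_sphere_partition _ _ _]lnK ?posrE ?hard_sphere_partition_gt0//.
rewrite ler_expR (powR_exprn _ _ (ltW l0)) /no_overlap_log => h; lra.
Qed.

Let laplace n := (\int[Q]_w (expR (- (n%:R * gamma * R w ^+ d)))%:E)%E.

(** Since R is positive, the integrand is a geometric sequence of ratio less than 1 at each sample
    point; it is dominated by 1. *)
Let laplace_cvg0 : laplace @ \oo --> 0%E.
Proof.
have gamma_gt0 : 0 < gamma := @unit_ball_volume_gt0 K d.
have mexp n : measurable_fun [set: O] (fun w => (expR (- (n%:R * gamma * R w ^+ d)))%:E).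
  apply: measurableT_comp => //; apply: (measurableT_comp (@measurable_expR K)).
  by apply: measurableT_comp => //; apply: measurable_funM => //; exact: measurable_funX.
have ptw w : (fun n : nat => (expR (- (n%:R * gamma * R w ^+ d)))%:E) @ \oo --> (0%E : \bar K).
  apply: cvg_EFin; first by near=> n.
  have c0 : 0 < gamma * R w ^+ d by rewrite mulr_gt0// exprn_gt0.
  have : `|expR (- (gamma * R w ^+ d))| < 1.
    by rewrite ger0_norm ?expR_ge0// expR_lt1 oppr_lt0.
  move=> /cvg_expr; apply: cvg_trans; apply: near_eq_cvg; near=> n.
  by rewrite /= -expRM_natl mulrN mulrA.
have := @dominated_convergence _ _ _ Q setT measurableT
  (fun n w => (expR (- (n%:R * gamma * R w ^+ d)))%:E) (cst 0%E) (cst 1%E) mexp.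
move=> [].
- exact: measurable_cst.
- by apply: aeW => w _; exact: ptw.
- exact: finite_measure_integrable_cst.
- apply: aeW => w n _; rewrite gee0_abs ?lee_fin ?expR_ge0//.
  rewrite -expR0 ler_expR oppr_le0; apply: mulr_ge0; first by rewrite mulr_ge0// ltW.
  by apply: exprn_ge0; exact: ltW.
- by move=> _ _; rewrite integral0.
Unshelve. all: by end_near. Qed.

Let laplace_small e : 0 < e -> exists n : nat, exists E : K, laplace n = E%:E /\ E <= e.
Proof.
move=> e0; have /fine_cvgP[_ cl] := laplace_cvg0.
have := cvgr_le _ cl _ e0 => -[N _ h].
have [E EE _] := no_overlap_log_packing Torus (ler0n K N).
exists N, E; split => //; have := h N (leqnn N).
by rewrite /= /laplace EE.
Qed.

(** The volume term is of order lambda^a = o(lambda), so tau is first fixed large enough to make E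
    small. *)
Lemma no_overlap_log_small m : 0 < a < 1 ->
  l^-1 * no_overlap_log m l @[l --> +oo%R] --> (- 1 : K).
Proof.
move=> /andP[a0 a1]; apply/cvgrPdist_le => e e0.
have e2 : 0 < e / 2 by rewrite divr_gt0.
have [n [E [nE Ee]]] := laplace_small e2.
have [E' EE' up] := no_overlap_log_packing m (ler0n K n).
have {EE'} E'E : E' = E by move: EE'; rewrite -/(laplace n) nE => -[].
subst E'.
have cv : l `^ (a - 1) @[l --> +oo%R] --> (0 : K) by apply: cvg_powRN_pinfty; lra.
have cv' : n%:R * container_volume m d * l `^ (a - 1) @[l --> +oo%R] --> (0 : K).
  by rewrite -[X in _ --> X](mulr0 (n%:R * container_volume m d));
    apply: cvgM => //; exact: cvg_cst.
near=> l; have [//|l0 lL] := near near_small l.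
have small : n%:R * container_volume m d * l `^ (a - 1) <= e / 2.
  by near: l; apply: (cvgr_le _ cv'); rewrite divr_gt0.
have low := no_overlap_log_ge m l0; have := up l l0 lL => {}up.
have lV : 0 < l^-1 by rewrite invr_gt0.
have h1 : - 1 <= l^-1 * no_overlap_log m l by rewrite ler_pdivlMl// mulrN1.
have h2 : l^-1 * no_overlap_log m l <= - 1 + e.
  rewrite ler_pdivrMl//; apply: le_trans up _.
  have -> : l `^ a = l `^ (a - 1) * l.
    have := powRD (r := a - 1) (s := 1) (x := l); rewrite (gt_eqF l0) implybT => /(_ isT).
    by rewrite subrK powRr1 ?(ltW l0).
  have -> : n%:R * (l `^ (a - 1) * l) * container_volume m d + l * (E - 1) =
    l * (n%:R * container_volume m d * l `^ (a - 1) + (E - 1)) by ring.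
  by rewrite ler_pM2l//; lra.
by rewrite ler0_norm; lra.
Unshelve. all: by end_near. Qed.

(** * The critical case eta d = 1 *)

Section critical.
Hypothesis a1 : a = 1.

Let powR_a l : 0 < l -> l `^ a = l.
Proof. by move=> l0; rewrite a1 powRr1// ltW. Qed.

Lemma no_overlap_log_constant_radius m delta : {ae Q, forall w, R w = rbar} ->
  1 < packing_volume m d * rbar ^+ d ->
  l^-1 * no_overlap_log m l @[l --> +oo%R] --> delta ->
  delta <= - (2^-1 * (1 - 1 / (packing_volume m d * rbar ^+ d)) ^+ 2).
Proof.
move=> Rrbar; set g := packing_volume m d * rbar ^+ d => g1 cdelta.
have gamma_gt0 : 0 < gamma := @unit_ball_volume_gt0 K d.
have rd : 0 < rbar ^+ d by rewrite exprn_gt0.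
have g0 : 0 < g by apply: lt_trans g1.
have v0 : 0 < container_volume m d :> K by rewrite /container_volume; case: (m); rewrite ?exprn_gt0.
have gE : gamma * rbar ^+ d = g * container_volume m d.
  rewrite /g /packing_volume /container_volume; case: (m); first by rewrite mulr1.
  by field; rewrite expf_neq0.
(* The minimizer of tau C + exp(- tau gamma rbar^d), with C the container volume: there the
   exponential equals C / (gamma rbar^d) = 1 / g. *)
pose tau := ln g / (gamma * rbar ^+ d).
have tau0 : 0 <= tau.
  by apply: divr_ge0; [exact/ln_ge0/ltW|apply: mulr_ge0; exact: ltW].
have [E EE up] := no_overlap_log_packing m tau0.
have mexp : measurable_fun setT (fun w => (expR (- (tau * gamma * R w ^+ d)))%:E).
  apply: measurableT_comp => //; apply: (measurableT_comp (@measurable_expR K)).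
  by apply: measurableT_comp => //; apply: measurable_funM => //; exact: measurable_funX.
have {EE} EE : E = g^-1.
  have : (\int[Q]_w (expR (- (tau * gamma * R w ^+ d)))%:E = \int[Q]_w (g^-1)%:E)%E.
    apply: ge0_ae_eq_integral => //.
    - by move=> w _; rewrite lee_fin invr_ge0 ltW.
    apply: filterS Rrbar => w -> _; congr EFin.
    rewrite (_ : tau * gamma * rbar ^+ d = ln g); last first.
      by rewrite -mulrA /tau divfK// gt_eqF// mulr_gt0.
    by rewrite expRN lnK// posrE.
  by rewrite EE integral_cst// [X in _ = (_ * X)%E -> _](probability_setT Q) mule1 => -[].
apply: le_trans (entropy_bound g1); apply: (cvgr_to_le cdelta).
near=> l; have [//|l0 lL] := near near_small l.
rewrite ler_pdivrMl//; apply: le_trans (up l l0 lL) _; rewrite powR_a// EE.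
rewrite (_ : tau * l * container_volume m d = l * (g^-1 * ln g)); last first.
  by rewrite /tau gE; field; rewrite !gt_eqF.
by rewrite -mulrDr ler_pM2l//; lra.
Unshelve. all: by end_near. Qed.

Lemma no_overlap_log_critical_lower m delta :
  l^-1 * no_overlap_log m l @[l --> +oo%R] --> delta -> - 1 <= delta /\ - A <= delta.
Proof.
move=> cdelta; split; apply: (cvgr_to_ge cdelta); near=> l;
  have [//|l0 lL] := near near_small l; rewrite ler_pdivlMl//.
  by rewrite mulrN1 no_overlap_log_ge.
have := no_overlap_log_lower m l0 lL.
by rewrite a1 (_ : 2 - 1 = 1) ?powRr1 ?(ltW l0)// 1?mulrN 1?mulrC//; lra.
Unshelve. all: by end_near. Qed.

Lemma no_overlap_log_critical_upper m delta :
  l^-1 * no_overlap_log m l @[l --> +oo%R] --> delta -> delta < 0.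
Proof.
move=> cdelta.
have A0 : 0 < A.
  rewrite divr_gt0// mulr_gt0 ?unit_ball_volume_gt0//.
  exact: mixed_moment_gt0 rbar_gt0 R_gt0 R_le.
(* At intensity th lambda with unchanged radii, the bound on ln P is lambda (- th^2 A + B th^3), up
   to the boundary factor. It is negative as soon as B th < A, and this choice also gives th <=
   1. *)
pose th := A / (A + B).
have AB0 : 0 < A + B by rewrite ltr_wpDr.
have th0 : 0 < th by rewrite divr_gt0.
have th1 : th <= 1 by rewrite ler_pdivrMr// mul1r lerDl.
have Bth : B * th < A.
  rewrite /th mulrA ltr_pdivrMr// (mulrC B) ltr_pM2l//; lra.
have cv : - (boundary m l * (th ^+ 2 * A)) + B * th ^+ 3 @[l --> +oo%R] -->
    - (1 * (th ^+ 2 * A)) + B * th ^+ 3.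
  apply: cvgD; last exact: cvg_cst.
  by apply: cvgN; apply: cvgM; [exact: cvg_boundary|exact: cvg_cst].
apply: (@le_lt_trans _ _ (- (1 * (th ^+ 2 * A)) + B * th ^+ 3)); last first.
  rewrite (_ : _ + _ = th ^+ 2 * (B * th - A)); last by ring.
  by rewrite pmulr_rlt0 ?exprn_gt0// subr_lt0.
apply: (ler_cvg_to cdelta cv); near=> l.
have [//|l0 lL] := near near_small l; rewrite ler_pdivrMl//.
have tl0 : 0 < th * l by rewrite mulr_gt0.
have up := hard_sphere_upper m d rbar_gt0 R_gt0 R_le lL tl0.
have ff := finite_weight_cube Q d l0.
have th01 : 0 <= th <= 1 by rewrite (ltW th0).
have := partition_function_thin (compat m (l `^ eta)) ff th01.
have -> : (fun x : d.-tuple K * O => th * (l * \1_(unit_cube d) x.1)) =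
    (fun x => th * l * \1_(unit_cube d) x.1).
  by apply/funext => x; rewrite mulrA.
move=> thin; have {thin up} := le_trans thin (ler_wpM2r (expR_ge0 _) up).
rewrite mass_cube// -expRD -/(hard_sphere_partition m l (l `^ eta)).
rewrite -[hard_sphere_partition _ _ _]lnK ?posrE ?hard_sphere_partition_gt0// ler_expR.
rewrite -/(boundary m l) (powR_exprn _ _ (ltW l0)) powR_a// /no_overlap_log => h.
rewrite -subr_ge0 in h; rewrite -subr_ge0; apply: le_trans h _.
rewrite le_eqVlt; apply/orP; left; apply/eqP; rewrite /B; field.
by rewrite gt_eqF.
Unshelve. all: by end_near. Qed.

(** [H L] is - ln P at lambda = L^d. Cutting a box into cells gives the dilation inequality of
    [growth_limit], freeing the points outside a smaller box gives monotonicity, and exp(- lambda)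
    <= P <= 1 gives the bounds. *)
Let euclidean_cvg : exists delta : K,
  l^-1 * no_overlap_log Euclidean l @[l --> +oo%R] --> delta.
Proof.
pose F := @box_partition K dO O Q R d; pose H L := L ^+ d - ln (F L).
have F1 L : 0 <= L -> 1 <= F L by exact: box_partition_ge1.
have F0 L : 0 <= L -> 0 < F L by move=> /F1; apply: lt_le_trans.
have lnF0 L : 0 <= L -> 0 <= ln (F L) by move=> /F1; exact: ln_ge0.
have HE L : 0 < L -> hard_sphere_partition Euclidean (L ^+ d) L = F L.
  by move=> L0; exact: box_partitionE.
have [l cl] : exists l : K, H L / L ^+ d @[L --> +oo%R] --> l.
  apply: growth_limit => [L L0|L L' /andP[L0 LL]|M L L0].
  - rewrite /H lerBlDr lerDl lnF0 ?(ltW L0)// andbT subr_ge0.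
    have Ld0 : 0 < L ^+ d by rewrite exprn_gt0.
    rewrite -ler_expR lnK ?posrE ?F0 ?(ltW L0)// -HE// -[leRHS](congr1 expR (mass_cube Q d Ld0)).
    by apply: partition_function_le_exp => //; exact: finite_weight_cube.
  - have LL' : 0 <= L <= L' by rewrite (ltW L0).
    have L'0 : 0 < L' by exact: lt_le_trans LL.
    have := box_partition_growth R d LL'; rewrite -/(F L) -/(F L').
    rewrite -ler_ln ?posrE ?mulr_gt0 ?expR_gt0 ?F0 ?(ltW L0) ?(ltW L'0)//.
    by rewrite lnM ?posrE ?expR_gt0 ?F0 ?(ltW L0)// expRK /H; lra.
  - have := box_partition_subadditive R d M L0; rewrite -/(F L) -/(F _).
    rewrite -ler_ln ?posrE ?exprn_gt0 ?F0 ?mulr_ge0 ?(ltW L0)//.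
    rewrite lnXn ?F0 ?(ltW L0)// => h.
    by rewrite /H exprMn mulrBr -natrX [X in _ - X <= _]mulr_natl lerD2l lerN2.
exists (- l).
have cN : - (H (x `^ eta) / (x `^ eta) ^+ d) @[x --> +oo%R] --> - l.
  by apply: cvgN; exact: (cvg_comp _ _ (cvg_powR_pinfty eta_gt0) cl).
apply: cvg_trans cN; apply: near_eq_cvg; near=> x.
have [//|x0 _] := near near_small x.
have e : (x `^ eta) ^+ d = x by rewrite (powR_exprn _ _ (ltW x0)) powR_a.
rewrite /= /no_overlap_log /H e -HE ?powR_gt0// e; field.
by rewrite gt_eqF.
Unshelve. all: by end_near. Qed.

(** Divided by lambda, the cost of passing from one model to the other is 1 - (1 - 2 rbar /
    lambda^eta)^d, which tends to 0. *)
Lemma no_overlap_log_critical_cvg m : exists delta : K,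
  l^-1 * no_overlap_log m l @[l --> +oo%R] --> delta.
Proof.
have [delta cdelta] := euclidean_cvg; exists delta; case: m; last exact: cdelta.
have cb : (1 - 2 * rbar / l `^ eta) ^+ d @[l --> +oo%R] --> (1 : K).
  exact: (cvg_comp _ _ (cvg_powR_pinfty eta_gt0) (cvg_one_minus_div (2 * rbar) d)).
have low : l^-1 * no_overlap_log Euclidean l -
    (1 - (1 - 2 * rbar / l `^ eta) ^+ d) @[l --> +oo%R] --> delta.
  rewrite -[X in _ --> X]subr0; apply: cvgB => //.
  by rewrite -[X in _ --> X](subrr 1); apply: cvgB => //; exact: cvg_cst.
apply: (squeeze_cvgr _ low cdelta); near=> l.
have [//|l0 lL] := near near_small l.
have p0 m := hard_sphere_partition_gt0 m (l `^ eta) l0.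
have := partition_function_torus_le R d (l `^ eta) l0.
have := partition_function_euclidean_le d rbar_gt0 R_gt0 R_le lL l0.
rewrite -!/(hard_sphere_partition _ l (l `^ eta)).
rewrite -ler_ln ?posrE ?mulr_gt0 ?expR_gt0// lnM ?posrE ?expR_gt0// expRK => h1.
rewrite -ler_ln ?posrE// => h2; apply/andP; split; last first.
  by rewrite ler_pM2l ?invr_gt0// /no_overlap_log lerB.
rewrite lerBlDr ler_pdivrMl// mulrDr mulrA divff ?gt_eqF// mul1r /no_overlap_log.
lra.
Unshelve. all: by end_near. Qed.

End critical.

End asymptotics.

(** * Reduction of the statement to the gas *)

Section setting.
Context {K : realType} {dO : measure_display} {O : measurableType dO}.
Variables (Q : probability O K) (R : {RV Q >-> K}) (m : model) (d : nat).
Variables (eta rbar : K) (Pr : K -> K).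
Hypothesis eta_gt0 : 0 < eta.

(* The radius is only almost surely in ]0, rbar]; changing it on a null set makes
   the bounds hold everywhere. *)
Lemma truncated_radius : hard_sphere_setting R m d eta rbar Pr ->
  exists R' : {RV Q >-> K}, [/\ forall w, 0 < R' w, forall w, R' w <= rbar
    & {ae Q, forall w, R w = R' w}].
Proof.
move=> [rbar_gt0 Rae _].
pose f w := if 0 < R w <= rbar then R w else rbar.
have mf : measurable_fun [set: O] f.
  apply: measurable_fun_ifT => //.
  by apply: measurable_and; [exact: measurable_fun_ltr|exact: measurable_fun_ler].
pose R' : {RV Q >-> K} := HB.pack f (isMeasurableFun.Build _ _ _ _ f mf).
exists R'; split => [w|w|]; first by rewrite /= /f; case: ifP => // /andP[].
  by rewrite /= /f; case: ifP => // /andP[].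
by apply: filterS Rae => w h; rewrite /= /f h.
Qed.

(** A pair where the integrands differ has a coordinate in the null set N, and both strips over N
    are null for the product. *)
Lemma mixed_moment_ae (R' : {RV Q >-> K}) : {ae Q, forall w, R w = R' w} ->
  mixed_moment R d = mixed_moment R' d.
Proof.
move=> [N [mN N0 sN]]; rewrite /mixed_moment; congr fine.
have mpair (Y : {RV Q >-> K}) : measurable_fun [set: O * O]
    (fun z => ((Y z.1 + Y z.2) ^+ d)%:E).
  apply: measurableT_comp => //; apply: measurable_funX; apply: measurable_funD;
    apply: (measurableT_comp (f := Y)) => //.
apply: ae_eq_integral => //.
exists ((N `*` setT) `|` (setT `*` N)); split.
- by apply: measurableU; exact: measurableX.
- have n1 : (Q \x Q)%E (N `*` setT) = 0%E.
    by rewrite product_measure1E// [X in (X * _)%E]N0 mul0e.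
  have n2 : (Q \x Q)%E (setT `*` N) = 0%E.
    by rewrite product_measure1E// [X in (_ * X)%E]N0 mule0.
  apply/eqP; rewrite -measure_le0; apply: le_trans (measureU2 _ _ _) _.
  + exact: measurableX.
  + exact: measurableX.
  + by rewrite [X in (X + _)%E]n1 [X in (_ + X)%E]n2 adde0.
move=> z /= /not_implyP[_ h].
have [N1|N1] := pselect (N z.1); first by left.
have [N2|N2] := pselect (N z.2); first by right.
have RE w : ~ N w -> R w = R' w by move=> nN; apply: contrapT => hR; apply: nN; exact: sN.
by case: h; rewrite !RE.
Qed.

(** For large lambda, 4 rbar <= lambda^eta, which lies inside the range 2 rbar / lambda^eta < 1
    where [Pr] is constrained. *)
Lemma no_overlap_probability_log (R' : {RV Q >-> K}) :
  (forall w, 0 < R' w) -> {ae Q, forall w, R w = R' w} ->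
  hard_sphere_setting R m d eta rbar Pr ->
  \forall l \near +oo%R, Pr l = expR (no_overlap_log R' d eta m l).
Proof.
move=> R'_gt0 RR' [rbar_gt0 _ HP]; near=> l.
have [//|l0 lL] := near (near_small rbar eta_gt0) l.
rewrite expR_no_overlap_log//.
apply: (no_overlap_probabilityE l0 R'_gt0 RR'); apply: HP => //.
by rewrite ltr_pdivrMr ?powR_gt0// mul1r; lra.
Unshelve. all: by end_near. Qed.

End setting.

Theorem theorem1 (K : realType) (m : model) (d : nat) (eta : K)
    (d_ge1 : (1 <= d)%N) (eta_gt0 : 0 < eta) :
  (forall (dO : measure_display) (O : measurableType dO) (Q : probability O K)
          (R : {RV Q >-> K}) (rbar : K) (Pr : K -> K),
     hard_sphere_setting R m d eta rbar Pr ->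
     let gm1 := unit_ball_volume d * mixed_moment R d in
     let gamma' := packing_volume m d in
     [/\ 2 < eta * d%:R ->
           Pr lambda @[lambda --> +oo%R] --> (1 : K),
         eta * d%:R = 2 ->
           Pr lambda @[lambda --> +oo%R] --> expR (- (gm1 / 2)),
         1 < eta * d%:R < 2 ->
           (lambda `^ (2 - eta * d%:R))^-1 * ln (Pr lambda)
             @[lambda --> +oo%R] --> - (gm1 / 2),
         0 < eta * d%:R < 1 ->
           lambda^-1 * ln (Pr lambda) @[lambda --> +oo%R] --> (- 1 : K)
       & (eta * d%:R = 1 ->
            exists delta : K,
              [/\ lambda^-1 * ln (Pr lambda) @[lambda --> +oo%R] --> delta,
                  - 1 <= delta < 0
                & {ae Q, forall w, R w = rbar} -> 1 < gamma' * rbar ^+ d ->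
                  delta <= - (2^-1 * (1 - 1 / (gamma' * rbar ^+ d)) ^+ 2)])
         /\
         (m = Torus -> 5 / 3 < eta * d%:R < 2 ->
            Pr lambda * expR (gm1 / 2 * lambda `^ (2 - eta * d%:R))
              @[lambda --> +oo%R] --> (1 : K))])
  /\
  (eta * d%:R = 1 ->
     forall eps : K, 0 < eps ->
     exists2 kappa : K, 0 < kappa &
     forall (dO : measure_display) (O : measurableType dO) (Q : probability O K)
            (R : {RV Q >-> K}) (rbar : K) (Pr : K -> K) (delta : K),
       hard_sphere_setting R m d eta rbar Pr ->
       lambda^-1 * ln (Pr lambda) @[lambda --> +oo%R] --> delta ->
       unit_ball_volume d * mixed_moment R d < kappa ->
       - eps < delta < 0).
Proof.
split=> [dO O Q R rbar Pr setting /=|a1 eps eps0].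
  have [rbar_gt0 Rae _] := setting.
  have [R' [R'0 R'le RR']] := truncated_radius setting.
  rewrite (mixed_moment_ae d RR').
  have PrE := no_overlap_probability_log eta_gt0 R'0 RR' setting.
  have Pr_cvg (y : K) : no_overlap_log R' d eta m l @[l --> +oo%R] --> y ->
      Pr l @[l --> +oo%R] --> expR y.
    move=> /(continuous_cvg _ (@continuous_expR K y)); apply: cvg_trans.
    by apply: near_eq_cvg; near=> l; rewrite (near PrE l).
  have ln_cvg (f : K -> K) (y : K) :
      f l * no_overlap_log R' d eta m l @[l --> +oo%R] --> y ->
      f l * ln (Pr l) @[l --> +oo%R] --> y.
    apply: cvg_trans; apply: near_eq_cvg; near=> l.
    by rewrite (near PrE l)// expRK.
  split.
  - move=> a2; rewrite -[X in _ --> X]expR0; apply: Pr_cvg.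
    have u0 : l `^ (2 - eta * d%:R) @[l --> +oo%R] --> (0 : K).
      by apply: cvg_powRN_pinfty; lra.
    have := no_overlap_log_cvg rbar_gt0 R'0 R'le eta_gt0 m u0.
    by rewrite mulr0 oppr0; apply; lra.
  - move=> a2; apply: Pr_cvg.
    have u1 : l `^ (2 - eta * d%:R) @[l --> +oo%R] --> (1 : K).
      by rewrite a2 subrr; under eq_fun do rewrite powRr0; exact: cvg_cst.
    have := no_overlap_log_cvg rbar_gt0 R'0 R'le eta_gt0 m u1.
    by rewrite mulr1; apply; lra.
  - move=> a12; apply: ln_cvg.
    exact: (no_overlap_log_intermediate rbar_gt0 R'0 R'le eta_gt0 m a12).
  - move=> a01; apply: ln_cvg.
    exact: (no_overlap_log_small rbar_gt0 R'0 R'le eta_gt0 m a01).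
  - split=> [a1|mT /andP[a53 a2]].
      have [delta cd] := no_overlap_log_critical_cvg rbar_gt0 R'0 R'le eta_gt0 a1 m.
      exists delta; split; first exact: ln_cvg.
        have [-> _] := no_overlap_log_critical_lower rbar_gt0 R'0 R'le eta_gt0 a1 cd.
        by rewrite (no_overlap_log_critical_upper rbar_gt0 R'0 R'le eta_gt0 a1 cd).
      move=> Rrbar g1.
      apply: (no_overlap_log_constant_radius rbar_gt0 R'0 R'le eta_gt0 a1 _ g1 cd).
      by apply: filterS2 RR' Rrbar => w -> .
    have a32 : 3 / 2 < eta * d%:R by lra.
    have := no_overlap_log_torus rbar_gt0 R'0 R'le eta_gt0 a32.
    move=> /(continuous_cvg _ (@continuous_expR K 0)); rewrite expR0; apply: cvg_trans.
    by apply: near_eq_cvg; near=> l; rewrite (near PrE l)// mT /= expRD.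
(* The bound delta >= - gamma m_1 / 2 holds for every law of R, so kappa = 2 eps serves all of
   them. *)
exists (2 * eps); first by rewrite mulr_gt0.
move=> dO O Q R rbar Pr delta setting cdelta small.
have [rbar_gt0 Rae _] := setting.
have [R' [R'0 R'le RR']] := truncated_radius setting.
have PrE := no_overlap_probability_log eta_gt0 R'0 RR' setting.
have cd : l^-1 * no_overlap_log R' d eta m l @[l --> +oo%R] --> delta.
  apply: cvg_trans cdelta; apply: near_eq_cvg; near=> l.
  by rewrite (near PrE l)// expRK.
rewrite (no_overlap_log_critical_upper rbar_gt0 R'0 R'le eta_gt0 a1 cd) andbT.
have [_] := no_overlap_log_critical_lower rbar_gt0 R'0 R'le eta_gt0 a1 cd.
apply: lt_le_trans; rewrite ltrN2; move: small; rewrite (mixed_moment_ae d RR').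
lra.
Unshelve. all: by end_near. Qed.
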